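(* Let $\underline q>0$ and $l\ge 3$ be an integer. Assume that the support of the prior $\pi$ is included in $\Theta(\underline q)$ and that the fixed initial distribution $\mu$ satisfies $\mu_i\ge\underline q$ for all $1\le i\le k$. (a) If Assumption (A1) holds, then for every neighborhood $U$ of $P_l^{\theta^*}$ in the weak topology on probability measures on $(\mathbb R^d)^l$, $$\mathbb P^{\theta^*}\Big(\lim_{n\to\infty}\pi\big(\{\theta: P_l^{\theta}\in U\}\mid Y_{1:n}\big)=1\Big)=1.$$ (b) If Assumptions (A1) and (A2) hold, then for every $\epsilon>0$, $$\mathbb P^{\theta^*}\Big(\lim_{n\to\infty}\pi\big(\{\theta: D_l(\theta,\theta^* )<\epsilon\}\mid Y_{1:n}\big)=1\Big)=1.$$
   Context: Fix integers $k\ge1$, $d\ge1$. $\lambda$ is a $\sigma$-finite reference measure on $\mathbb R^d$ (Borel $\sigma$-field) and $\mathcal F$ is the set of probability densities with respect to $\lambda$. $\Delta_k=\{x\in[0,\infty)^k:\sum_i x_i=1\}$; a transition matrix is an element $Q\in\Delta_k^k$ (each row lies in $\Delta_k$). For $\underline q\ge0$, $\Delta^k(\underline q)=\{Q\in\Delta_k^k:\min_{i,j}Q_{i,j}\ge\underline q\}$, $\Theta=\Delta_k^k\times\mathcal F^k$ and $\Theta(\underline q)=\Delta^k(\underline q)\times\mathcal F^k$. For $\underline q>0$ and $Q\in\Delta^k(\underline q)$, $\mu^Q$ denotes the unique stationary distribution of $Q$. For $\theta=(Q,f)$, $f=(f_1,\dots,f_k)\in\mathcal F^k$, and an initial distribution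 $\nu\in\Delta_k$, $\mathbb P^{\theta,\nu}$ is the law of the hidden Markov model $(X_t,Y_t)_{t\ge1}$: $(X_t)$ is a Markov chain on $\{1,\dots,k\}$ with initial law $\nu$ and transition matrix $Q$, and conditionally on $(X_t)_t$ the variables $Y_t\in\mathbb R^d$ are independent, $Y_t$ having density $f_{X_t}$ with respect to $\lambda$. $\mathbb P^\theta:=\mathbb P^{\theta,\mu^Q}$ (stationary version). The density of $Y_{1:l}$ with respect to $\lambda^{\otimes l}$ is $p_l^{\theta,\nu}(y_{1:l})=\sum_{x_1,\dots,x_l=1}^k\nu_{x_1}Q_{x_1,x_2}\cdots Q_{x_{l-1},x_l}f_{x_1}(y_1)\cdots f_{x_l}(y_l)$; $p_l^\theta:=p_l^{\theta,\mu^Q}$ and $P_l^\theta:=p_l^\theta\,\lambda^{\otimes l}$. The prior is $\pi=\pi_Q\otimes\pi_f$ on $\Theta$ ($\pi_Q$ a probability on $\Delta_k^k$, $\pi_f$ a probability on $\mathcal F^k$) together with a fixed initial distribution $\mu\in\Delta_k$; the posterior is $\pi(A\mid Y_{1:n})=\int_A p_n^{\theta,\mu}(Y_{1:n})\pi(d\theta)\big/\int_\Theta p_n^{\theta,\mu}(Y_{1:n})\pi(d\theta)$. The observations $Y_1,Y_2,\dots$ are distributed according to $\mathbb P^{\theta^*}$ with $\theta^*=(Q^*,f^* )$, $f^*=(f_1^*,\dots,f_k^* )$. Notation: $\|M\|=\max_{i,j}|M_{i,j}|$ for $k\times k$ matrices; $d(g,\tilde g)=\max_{1\le j\le k}\|g_j-\tilde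 g_j\|_{L_1(\lambda)}$ on $\mathcal F^k$; $D_l(\theta,\theta')=\|p_l^\theta-p_l^{\theta'}\|_{L_1(\lambda^{\otimes l})}$; $N(\delta,A,D)$ is the minimal number $N$ of points $a_1,\dots,a_N$ such that every $a\in A$ satisfies $D(a,a_i)\le\delta$ for some $i$. Assumption (A1) (for given $\underline q>0$): there is $\epsilon_0>0$ such that for every $\epsilon\in(0,\epsilon_0)$ there is a set $\Theta_\epsilon\subset\Theta(\underline q)$ with $\pi(\Theta_\epsilon)>0$ such that every $\theta=(Q,f)\in\Theta_\epsilon$ satisfies: (A1a) $\|Q-Q^*\|<\epsilon$; (A1b) $\max_{1\le i\le k}\int f_i^*(y)\max_{1\le j\le k}\log\big(f_j^*(y)/f_j(y)\big)\lambda(dy)<\epsilon$; (A1c) for all $y$ with $\sum_i f_i^*(y)>0$, $\sum_j f_j(y)>0$; (A1d) $\sup_{y:\sum_i f_i^*(y)>0}\max_j f_j(y)<\infty$; (A1e) $\sum_{i=1}^k\int f_i^*(y)\,\big|\log\big(\sum_{j=1}^k f_j(y)\big)\big|\lambda(dy)<\infty$. Assumption (A2) (for given $\underline q>0$ and $l$): for every $\delta>0$ there exist sets $\mathcal F_n\subset\mathcal F^k$ ($n\ge1$) and constants $r_1>0$, $C>0$ such that $\pi_f(\mathcal F^k\setminus\mathcal F_n)\le Ce^{-nr_1}$ for all $n$ and $\sum_{n\ge1}N\big(\tfrac{\delta}{36l},\mathcal F_n,d\big)\exp\big(-\tfrac{n\delta^2k^2\underline q^2}{32l}\big)<\infty$.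 *)

(* Defs.v *)
From HB Require Import structures.
From mathcomp Require Import all_boot all_order all_algebra.
From mathcomp Require Import all_classical all_reals all_analysis.
Set Implicit Arguments. Unset Strict Implicit. Unset Printing Implicit Defensive.
Import Order.TTheory GRing.Theory Num.Theory.
Import numFieldNormedType.Exports.
Local Open Scope classical_set_scope.
Local Open Scope ring_scope.

Section HMMDefs.
Context {R : realType}.

(* Observation space R^d, represented by d.-tuple R with the product (= Borel)
   sigma-algebra; (R^d)^n is n.-tuple (d.-tuple R). *)
Notation Obs d := (d.-tuple R).

Definition is_dist (k : nat) (nu : 'rV[R]_k) : Prop :=
  (forall i, 0 <= nu 0 i) /\ \sum_i nu 0 i = 1.

Definition is_trans (k : nat) (Q : 'M[R]_k) : Prop :=
  forall i, is_dist (row i Q).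

Definition trans_lb (k : nat) (q : R) (Q : 'M[R]_k) : Prop :=
  is_trans Q /\ forall i j, q <= Q i j.

Definition is_stationary (k : nat) (Q : 'M[R]_k) (nu : 'rV[R]_k) : Prop :=
  is_dist nu /\ nu *m Q = nu.

(* mu^Q : the (unique, when Q has positive entries) stationary distribution *)
Definition stat_dist (k : nat) (Q : 'M[R]_k) : 'rV[R]_k :=
  xget 0 [set nu | is_stationary Q nu].

Definition is_density (d : nat) (lam : {measure set (Obs d) -> \bar R})
  (f : Obs d -> R) : Prop :=
  measurable_fun setT f /\ (forall y, 0 <= f y) /\
  (\int[lam]_y (f y)%:E = 1)%E.

Definition path_weight (k : nat) (Q : 'M[R]_k) (nu : 'rV[R]_k) (m : nat)
  (x : {ffun 'I_m.+1 -> 'I_k}) : R :=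
  nu 0 (x ord0) * \prod_(s < m) Q (x (widen_ord (leqnSn m) s)) (x (lift ord0 s)).

Definition hmm_dens (d k : nat) (Q : 'M[R]_k) (nu : 'rV[R]_k)
  (f : 'I_k -> Obs d -> R) (n : nat) : n.-tuple (Obs d) -> R :=
  match n return n.-tuple (Obs d) -> R with
  | 0 => fun _ => 1
  | m.+1 => fun y => \sum_(x : {ffun 'I_m.+1 -> 'I_k})
             path_weight Q nu x * \prod_(t < m.+1) f (x t) (tnth y t)
  end.

(* integral with respect to lambda^{\otimes n} (iterated integral) *)
Fixpoint iint (d : nat) (lam : {measure set (Obs d) -> \bar R}) (n : nat) :
  (n.-tuple (Obs d) -> \bar R) -> \bar R :=
  match n return (n.-tuple (Obs d) -> \bar R) -> \bar R with
  | 0 => fun F => F [tuple]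
  | m.+1 => fun F => (\int[lam]_z iint lam (fun t => F [tuple of z :: t]))%E
  end.

Definition L1dist (d : nat) (lam : {measure set (Obs d) -> \bar R}) (n : nat)
  (p p' : n.-tuple (Obs d) -> R) : \bar R :=
  iint lam (fun y => (`|p y - p' y|)%:E).

Definition is_density_n (d : nat) (lam : {measure set (Obs d) -> \bar R})
  (n : nat) (p : n.-tuple (Obs d) -> R) : Prop :=
  measurable_fun setT p /\ (forall y, 0 <= p y) /\
  iint lam (fun y => (p y)%:E) = 1%E.

(* continuity on (R^d)^n (Euclidean topology, via the sup metric) *)
Definition tcont (d n : nat) (g : n.-tuple (Obs d) -> R) : Prop :=
  forall y (e : R), 0 < e -> exists2 del : R, 0 < del &
    forall z, (forall t i, `|tnth (tnth z t) i - tnth (tnth y t) i| < del) ->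
      `|g z - g y| < e.

Definition bounded_cont (d n : nat) (g : n.-tuple (Obs d) -> R) : Prop :=
  tcont g /\ exists M : R, forall y, `|g y| <= M.

(* U (a set of probability measures on (R^d)^n, each given by its density
   w.r.t. lambda^{\otimes n}) is a neighborhood of the law with density p0 in
   the weak topology: it contains a basic weak neighborhood
   { P : |int g_i dP - int g_i dP0| < e, i < m }, g_i bounded continuous. *)
Definition weak_nbhd (d : nat) (lam : {measure set (Obs d) -> \bar R}) (n : nat)
  (p0 : n.-tuple (Obs d) -> R) (U : set (n.-tuple (Obs d) -> R)) : Prop :=
  exists (m : nat) (g : 'I_m -> n.-tuple (Obs d) -> R) (e : R), 0 < e /\
    (forall i, bounded_cont (g i)) /\
    forall p, is_density_n lam p ->
      (forall i, (`| iint lam (fun y => (g i y * p y)%:E)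
                    - iint lam (fun y => (g i y * p0 y)%:E) | < e%:E)%E) ->
      U p.

Definition elogratio (a b : R) : \bar R :=
  if a == 0 then -oo%E else if b == 0 then +oo%E else (ln (a / b))%:E.

Definition elog (a : R) : \bar R := if 0 < a then (ln a)%:E else -oo%E.

Definition dF (d k : nat) (lam : {measure set (Obs d) -> \bar R})
  (g g' : 'I_k -> Obs d -> R) : \bar R :=
  (\big[maxe/-oo]_(j < k) \int[lam]_y (`|g j y - g' j y|)%:E)%E.

(* covering number N(delta, A, d), with centers in F^k; +oo if no finite cover *)
Definition cov_num (d k : nat) (lam : {measure set (Obs d) -> \bar R})
  (delta : R) (A : set ('I_k -> Obs d -> R)) : \bar R :=
  ereal_inf [set (N%:R)%:E | N in
    [set N : nat | exists c : 'I_N -> 'I_k -> Obs d -> R,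
       (forall i j, is_density lam (c i j)) /\
       forall a, A a -> exists i, (dF lam a (c i) <= delta%:E)%E]].

End HMMDefs.

Section HMMPosterior.
Context {R : realType} {d k : nat} (lam : {measure set (d.-tuple R) -> \bar R}).
Context {dQ dF : measure_display} {TQ : measurableType dQ} {TF : measurableType dF}.
Context (piQ : probability TQ R) (piF : probability TF R).
Context (Qof : TQ -> 'M[R]_k) (fof : TF -> 'I_k -> d.-tuple R -> R).

Definition prior := (piQ \x piF)%E.

Definition posterior (mu : 'rV[R]_k) (n : nat) (A : set (TQ * TF))
  (y : n.-tuple (d.-tuple R)) : R :=
  fine (\int[prior]_(th in A) (hmm_dens (Qof th.1) mu (fof th.2) y)%:E)%E /
  fine (\int[prior]_th (hmm_dens (Qof th.1) mu (fof th.2) y)%:E)%E.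

Definition A1_cond (Qs : 'M[R]_k) (fs : 'I_k -> d.-tuple R -> R) (e : R)
  (Q : 'M[R]_k) (f : 'I_k -> d.-tuple R -> R) : Prop :=
  [/\ \big[Num.max/0]_(i < k) \big[Num.max/0]_(j < k) `|Q i j - Qs i j| < e,
      (\big[maxe/-oo]_(i < k) \int[lam]_y
          ((fs i y)%:E * \big[maxe/-oo]_(j < k) elogratio (fs j y) (f j y))
        < e%:E)%E,
      (forall y, 0 < \sum_(i < k) fs i y -> 0 < \sum_(j < k) f j y),
      (exists M : R, forall y, 0 < \sum_(i < k) fs i y -> forall j, f j y <= M) &
      (\sum_(i < k) \int[lam]_y ((fs i y)%:E * `|elog (\sum_(j < k) f j y)|)
        < +oo)%E].

Definition A1 (q : R) (Qs : 'M[R]_k) (fs : 'I_k -> d.-tuple R -> R) : Prop :=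
  exists2 e0 : R, 0 < e0 & forall e : R, 0 < e < e0 ->
    exists S : set (TQ * TF),
      [/\ measurable S, (prior S > 0)%E,
          (forall th, S th -> trans_lb q (Qof th.1)) &
          (forall th, S th -> A1_cond Qs fs e (Qof th.1) (fof th.2))].

Definition A2 (q : R) (l : nat) : Prop :=
  forall delta : R, 0 < delta ->
    exists (Fn : nat -> set TF) (r1 C : R),
      [/\ 0 < r1, 0 < C,
          (forall n : nat, (0 < n)%N -> measurable (Fn n) /\
             (piF (~` Fn n) <= (C * expR (- (n%:R * r1)))%:E)%E) &
          (\sum_(1 <= n <oo)
             (cov_num lam (delta / (36 * l%:R)) (fof @` Fn n) *
              (expR (- (n%:R * delta ^+ 2 * k%:R ^+ 2 * q ^+ 2 / (32 * l%:R))))%:E)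
            < +oo)%E].

End HMMPosterior.

(* Main.v *)
(** The evidence is bounded below by comparing likelihoods path by path: for theta in the
    set of (A1), p_n^{theta*} is at most C^n exp(sum_t G_theta(Y_t)) p_n^theta, where
    G_theta is the positive part of max_j log(f*_j / f_j).  Only the one-step conditional
    means of G_theta matter, so a dyadic truncation argument (second moments of positive
    parts, then Borel-Cantelli) bounds the sums of the prior average of G_theta, and
    Markov's inequality in theta bounds the evidence below by exp(-n beta) p_n^{theta*}
    for every beta > 0.

    Exponential tests come from averages of a [0,1]-valued function over blocks of length
    l separated by gaps of length w.  After a gap the hidden state is within (1 - kq)^w of
    its stationary law whatever the past, so the exponential moment of the block sum is at
    most kappa^N, with kappa < 1 independent of theta.  For (a) the blocks test the
    functions defining the weak neighborhood; for (b) they test the sets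
    {p_center > p*} for centers of a finite cover, delta in (A2) being taken small enough
    that the covering numbers are beaten by the exponential rate.

    The stationary law of theta is replaced by mu Q^w throughout, so measurability of
    theta |-> stat_dist is never needed. *)

Require Import Defs.
From HB Require Import structures.
From mathcomp Require Import all_boot all_order all_algebra.
From mathcomp Require Import all_classical all_reals all_analysis.
From mathcomp Require Import measurable_realfun.
From mathcomp Require Import ring lra zify.
Import Order.TTheory GRing.Theory Num.Theory.
Import numFieldNormedType.Exports.
Local Open Scope classical_set_scope.
Local Open Scope ring_scope.

Set Implicit Arguments. Unset Strict Implicit. Unset Printing Implicit Defensive.

(** (A1b) bounds a signed integral, while the likelihood comparison needs the positive part
    [pos_logratio]. The negative part is recovered from both densities having integral one: with
    epsilon = eta^2 in (A1), the mean of the positive part is at most 3 eta. Only this first moment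
    is controlled, which is why a truncation enters.

    Likelihoods are total masses of unnormalised row vectors. The inequalities along the chain are
    homogeneous in the mass of the row, so they iterate over observations or blocks without dividing
    by a likelihood.

    The two exponential rates are decoupled. The test rate b is fixed by tau, hence by the
    neighborhood, while the evidence bound holds at every positive rate, in particular at a quarter
    of the type II rate. In (b), delta <= min(1, b, e) and k q <= 1 give exp(- n b) <= exp(- n
    delta^2 k^2 q^2 / (32 l)), so the summability in (A2) pays for the union of tests. (A1) also
    forces Q* >= q entrywise, so blocks mix under the true law as well. *)

(** * Tonelli calculus for iterated integrals *)

Section IteratedIntegral.
Context {R : realType} {d : nat} (lam : {measure set (d.-tuple R) -> \bar R}).
Hypothesis hlam : sigma_finite setT lam.
Local Notation Obs := (d.-tuple R).
Local Open Scope ereal_scope.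

Let lam_sfinite := isSFinite.Build _ _ _ (Measure.sort lam)
  (sfinite_measure_sigma_finite hlam).
Let lam_sigma_finite := isSigmaFinite.Build _ _ _ (Measure.sort lam) hlam.
(** [lam] comes as a bare measure; packing it with [hlam] gives a structure convertible to it, on
    which Tonelli's theorem can be invoked. *)
Let lamS : {sigma_finite_measure set Obs -> \bar R} :=
  HB.pack_for (SigmaFiniteMeasure.type Obs R) (Measure.sort lam)
    lam_sfinite lam_sigma_finite.

Lemma measurable_integral_param dT (T : measurableType dT) (F : T -> Obs -> \bar R) :
  measurable_fun setT (fun p : T * Obs => F p.1 p.2) -> (forall t z, 0 <= F t z) ->
  measurable_fun setT (fun t => \int[lam]_z F t z).
Proof.
move=> mF F0.
exact: (@measurable_fun_fubini_tonelli_F _ _ _ _ _ lamS (fun p => F p.1 p.2)).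
Qed.

Lemma integral_exchange dT (T : measurableType dT)
    (m : {sigma_finite_measure set T -> \bar R}) (F : T -> Obs -> \bar R) :
  measurable_fun setT (fun p : T * Obs => F p.1 p.2) -> (forall t z, 0 <= F t z) ->
  \int[m]_t \int[lam]_z F t z = \int[lam]_z \int[m]_t F t z.
Proof.
move=> mF F0; exact: (@fubini_tonelli _ _ _ _ _ m lamS (fun p => F p.1 p.2)).
Qed.

Lemma measurable_cons_tuple n :
  measurable_fun setT (fun p : Obs * n.-tuple Obs => [tuple of p.1 :: p.2]).
Proof. exact: measurable_cons. Qed.

Lemma measurable_cons_section n (z : Obs) :
  measurable_fun setT (fun t : n.-tuple Obs => [tuple of z :: t]).
Proof. by apply: measurable_cons. Qed.

Lemma iint_ge0 n (F : n.-tuple Obs -> \bar R) :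
  (forall y, 0 <= F y) -> 0 <= iint lam F.
Proof.
elim: n F => [|n IH] F F0 /=; first exact: F0.
by apply: integral_ge0 => z _; apply: IH.
Qed.

Lemma eq_iint n (F G : n.-tuple Obs -> \bar R) :
  (forall y, F y = G y) -> iint lam F = iint lam G.
Proof. by move=> FG; congr iint; apply/funext. Qed.

(** The parameter type is quantified inside the induction: when the head of the tuple is split off
    it joins the parameter, so T turns into T * Obs. *)
Lemma measurable_iint_param dT (T : measurableType dT) n
    (F : T -> n.-tuple Obs -> \bar R) :
  measurable_fun setT (fun p : T * n.-tuple Obs => F p.1 p.2) ->
  (forall t y, 0 <= F t y) ->
  measurable_fun setT (fun t => iint lam (F t)).
Proof.
elim: n dT T F => [|n IH] dT T F mF F0 /=.
  exact: (measurableT_comp mF (measurable_pair2 [tuple])).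
pose G t (z : Obs) := iint lam (fun y : n.-tuple Obs => F t [tuple of z :: y]).
apply: (@measurable_integral_param _ _ G); last by move=> t z; apply: iint_ge0.
apply: (IH _ _ (fun (p : T * Obs) (t : n.-tuple Obs) => F p.1 [tuple of p.2 :: t])) => //.
apply: (measurableT_comp (f := fun p : T * n.+1.-tuple Obs => F p.1 p.2)
  (g := fun q : T * Obs * n.-tuple Obs => (q.1.1, [tuple of q.1.2 :: q.2]))) => //.
apply: measurable_fun_pair; first exact: measurableT_comp.
apply: measurable_cons => //; exact: measurableT_comp.
Qed.

Lemma measurable_iint_cons n (F : n.+1.-tuple Obs -> \bar R) :
  measurable_fun setT F -> (forall y, 0 <= F y) ->
  measurable_fun setT (fun z => iint lam (fun t : n.-tuple Obs => F [tuple of z :: t])).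
Proof.
move=> mF F0.
apply: (@measurable_iint_param _ _ n (fun (z : Obs) (t : n.-tuple Obs) => F [tuple of z :: t])) => //.
by apply: (measurableT_comp (f := F)) => //; exact: measurable_cons_tuple.
Qed.

Lemma le_iint n (F G : n.-tuple Obs -> \bar R) :
  measurable_fun setT F -> measurable_fun setT G ->
  (forall y, 0 <= F y) -> (forall y, F y <= G y) -> iint lam F <= iint lam G.
Proof.
elim: n F G => [|n IH] F G mF mG F0 FG /=; first exact: FG.
have G0 y : 0 <= G y by exact: le_trans (F0 y) (FG y).
apply: ge0_le_integral => //.
- by move=> z _; apply: iint_ge0.
- exact: measurable_iint_cons.
- exact: measurable_iint_cons.
- move=> z _; apply: IH => //.
  + by apply: (measurableT_comp (f := F)) => //; exact: measurable_cons_section.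
  + by apply: (measurableT_comp (f := G)) => //; exact: measurable_cons_section.
Qed.

Lemma iintD n (F G : n.-tuple Obs -> \bar R) :
  measurable_fun setT F -> measurable_fun setT G ->
  (forall y, 0 <= F y) -> (forall y, 0 <= G y) ->
  iint lam (fun y => F y + G y) = iint lam F + iint lam G.
Proof.
elim: n F G => [|n IH] F G mF mG F0 G0 //=.
rewrite -ge0_integralD//; first last.
- exact: measurable_iint_cons.
- by move=> z _; apply: iint_ge0.
- exact: measurable_iint_cons.
- by move=> z _; apply: iint_ge0.
apply: eq_integral => z _; rewrite IH//.
- by apply: (measurableT_comp (f := F)) => //; exact: measurable_cons_section.
- by apply: (measurableT_comp (f := G)) => //; exact: measurable_cons_section.
Qed.

Lemma iintZl n (c : \bar R) (F : n.-tuple Obs -> \bar R) :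
  0 <= c -> measurable_fun setT F -> (forall y, 0 <= F y) ->
  iint lam (fun y => c * F y) = c * iint lam F.
Proof.
move=> c0; elim: n F => [|n IH] F mF F0 //=.
rewrite -ge0_integralZl//; first last.
- by move=> z _; apply: iint_ge0.
- exact: measurable_iint_cons.
apply: eq_integral => z _; rewrite IH//.
by apply: (measurableT_comp (f := F)) => //; exact: measurable_cons_section.
Qed.

Lemma iint_nneseries n (F : nat -> n.-tuple Obs -> \bar R) :
  (forall i, measurable_fun setT (F i)) -> (forall i y, 0 <= F i y) ->
  iint lam (fun y => \sum_(i <oo) F i y) = \sum_(i <oo) iint lam (F i).
Proof.
elim: n F => [|n IH] F mF F0 //=.
rewrite -integral_nneseries//; first last.
- by move=> i z _; apply: iint_ge0.
- by move=> i; exact: measurable_iint_cons.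
apply: eq_integral => z _; rewrite IH// => i.
by apply: (measurableT_comp (f := F i)) => //; exact: measurable_cons_section.
Qed.

Lemma iint0 n : iint lam (fun _ : n.-tuple Obs => 0) = 0.
Proof. by elim: n => //= n IH; under eq_integral do rewrite IH; exact: integral0. Qed.

Lemma iint_sum n (I : Type) (r : seq I) (F : I -> n.-tuple Obs -> \bar R) :
  (forall i, measurable_fun setT (F i)) -> (forall i y, 0 <= F i y) ->
  iint lam (fun y => \sum_(i <- r) F i y) = \sum_(i <- r) iint lam (F i).
Proof.
move=> mF F0; elim: r => [|i r IH].
  rewrite big_nil; under eq_iint do rewrite big_nil.
  exact: iint0.
rewrite big_cons -IH -iintD//; first by apply: eq_iint => y; rewrite big_cons.
- exact: emeasurable_sum.
- by move=> y; exact: sume_ge0.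
Qed.

Lemma iint_exchange dT (T : measurableType dT)
    (m : {sigma_finite_measure set T -> \bar R}) n (F : T -> n.-tuple Obs -> \bar R) :
  measurable_fun setT (fun p : T * n.-tuple Obs => F p.1 p.2) ->
  (forall t y, 0 <= F t y) ->
  \int[m]_t iint lam (F t) = iint lam (fun y => \int[m]_t F t y).
Proof.
elim: n F => [|n IH] F mF F0 //=.
have mF' : measurable_fun setT (fun q : T * Obs * n.-tuple Obs =>
    F q.1.1 [tuple of q.1.2 :: q.2]).
  apply: (measurableT_comp (f := fun p : T * n.+1.-tuple Obs => F p.1 p.2)
   (g := fun q : T * Obs * n.-tuple Obs => (q.1.1, [tuple of q.1.2 :: q.2]))) => //.
  apply: measurable_fun_pair; first exact: measurableT_comp.
  apply: measurable_cons => //; exact: measurableT_comp.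
pose G t (z : Obs) := iint lam (fun y : n.-tuple Obs => F t [tuple of z :: y]).
rewrite (@integral_exchange _ _ m G); first last.
- by move=> t z; apply: iint_ge0.
- exact: (@measurable_iint_param _ _ _ (fun (p : T * Obs) (t : n.-tuple Obs) => F p.1 [tuple of p.2 :: t])).
apply: eq_integral => z _; rewrite IH//.
apply: (measurableT_comp (f := fun q : T * Obs * n.-tuple Obs => F q.1.1 [tuple of q.1.2 :: q.2])
   (g := fun p : T * n.-tuple Obs => ((p.1, z), p.2))) => //.
by apply: measurable_fun_pair => //; apply: measurable_fun_pair.
Qed.

(** Both sides unfold to the same nested integrals, so the identity holds for arbitrary F. Taking F
    on sequences avoids casts between tuple lengths, which is why later integrands are functions of
    [seq Obs]. *)
Lemma iint_cat m n (F : seq Obs -> \bar R) :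
  iint lam (fun y : (m + n).-tuple Obs => F y) =
  iint lam (fun s : m.-tuple Obs => iint lam (fun t : n.-tuple Obs => F (s ++ t))).
Proof.
elim: m F => [|m IH] F //=.
by apply: eq_integral => z _; rewrite (IH (fun s => F (z :: s))).
Qed.

End IteratedIntegral.

(** * Forward recursion for the likelihood *)

Section ForwardAlgebra.
Context {R : realType} {d k : nat}.
Local Notation Obs := (d.-tuple R).
Implicit Types (Q : 'M[R]_k) (f : 'I_k -> Obs -> R) (v : 'rV[R]_k).

(** Emission at the current state first, transition afterwards: the result is the predictive law of
    the next hidden state, weighted by the likelihood. Its total mass is the likelihood itself
    because the rows of Q sum to one. *)
Definition hmm_step Q f v (z : Obs) : 'rV[R]_k :=
  \row_j \sum_i v 0 i * f i z * Q i j.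

(* The unnormalised predictive law of the hidden state after the observations [s]. *)
Definition hmm_fwd Q f v (s : seq Obs) : 'rV[R]_k := foldl (hmm_step Q f) v s.

Definition hmm_lik Q f v (s : seq Obs) : R := \sum_j hmm_fwd Q f v s 0 j.

(** A bijection between pairs (first state, remaining path) and paths, used to reindex the path
    sum. *)
Let fcons n (i : 'I_k) (x : {ffun 'I_n -> 'I_k}) : {ffun 'I_n.+1 -> 'I_k} :=
  [ffun t => if unlift ord0 t is Some s then x s else i].

Let fcons0 n i (x : {ffun 'I_n -> 'I_k}) : fcons i x ord0 = i.
Proof. by rewrite ffunE unlift_none. Qed.

Let fconsS n i (x : {ffun 'I_n -> 'I_k}) s : fcons i x (lift ord0 s) = x s.
Proof. by rewrite ffunE liftK. Qed.

Let big_fcons n (F : {ffun 'I_n.+1 -> 'I_k} -> R) :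
  \sum_x F x = \sum_i \sum_(x : {ffun 'I_n -> 'I_k}) F (fcons i x).
Proof.
rewrite pair_big /=.
rewrite (reindex (fun p : 'I_k * {ffun 'I_n -> 'I_k} => fcons p.1 p.2)) //=.
exists (fun x => (x ord0, [ffun s => x (lift ord0 s)])) => [[i x] _|x _] /=.
  by rewrite fcons0; congr pair; apply/ffunP => s; rewrite ffunE fconsS.
apply/ffunP => t; rewrite ffunE.
by case: unliftP => [s ->|->//]; rewrite ffunE.
Qed.

(** In the path sum the first state i occurs only in v_i f_i(z) Q_{i,x}, with x the second state;
    summing over i gives entry x of [hmm_step]. A length of at least two guarantees that x
    exists. *)
Lemma hmm_dens_cons Q v f m z (y : m.+1.-tuple Obs) :
  hmm_dens Q v f [tuple of z :: y] = hmm_dens Q (hmm_step Q f v z) f y.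
Proof.
rewrite /= big_fcons exchange_big /=; apply: eq_bigr => x _.
rewrite /path_weight mxE !mulr_suml; apply: eq_bigr => i _.
rewrite fcons0 [in LHS]big_ord_recl [X in _ * X]big_ord_recl.
rewrite (_ : widen_ord _ ord0 = ord0); last exact: val_inj.
rewrite fcons0 fconsS (tnth_nth z) /=.
under [X in _ * (_ * X) * _]eq_bigr => s _.
  rewrite fconsS (_ : widen_ord _ _ = lift ord0 (widen_ord (leqnSn m) s)); last exact: val_inj.
  rewrite fconsS; over.
under [X in _ * (f _ _ * X)]eq_bigr => t _ do rewrite fconsS tnthS.
ring.
Qed.

Lemma hmm_dens1 Q v f (y : 1.-tuple Obs) :
  hmm_dens Q v f y = \sum_i v 0 i * f i (tnth y ord0).
Proof.
rewrite /= big_fcons; apply: eq_bigr => i _.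
under eq_bigr do rewrite /path_weight !big_ord1 big_ord0 fcons0 mulr1.
by rewrite sumr_const card_ffun !card_ord expn0.
Qed.

Lemma sum_hmm_step Q f v z : is_trans Q ->
  \sum_j hmm_step Q f v z 0 j = \sum_i v 0 i * f i z.
Proof.
move=> HQ; under eq_bigr do rewrite mxE.
rewrite exchange_big /=; apply: eq_bigr => i _.
rewrite -mulr_sumr (_ : \sum_j Q i j = 1) ?mulr1//.
by have [_ <-] := HQ i; apply: eq_bigr => j _; rewrite mxE.
Qed.

Lemma hmm_densE Q v f n (y : n.-tuple Obs) : is_trans Q -> is_dist v ->
  hmm_dens Q v f y = hmm_lik Q f v y.
Proof.
move=> HQ [_ v1]; case: n y => [|n] y.
  by rewrite (tuple0 y) /hmm_lik /= v1.
(* [v1] has settled the empty tuple, whose density is 1 by definition; it is cleared here because a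
   step changes the mass of the row. *)
elim: n v {v1} y => [|n IH] v y; case/tupleP: y => z y.
  rewrite hmm_dens1 (tnth_nth z)/= (tuple0 y) /hmm_lik /=.
  by rewrite sum_hmm_step.
by rewrite hmm_dens_cons IH.
Qed.

Lemma hmm_lik_cons Q f v z s : hmm_lik Q f v (z :: s) = hmm_lik Q f (hmm_step Q f v z) s.
Proof. by []. Qed.

Lemma hmm_lik_cat Q f v s t : hmm_lik Q f v (s ++ t) = hmm_lik Q f (hmm_fwd Q f v s) t.
Proof. by rewrite /hmm_lik /hmm_fwd foldl_cat. Qed.

Definition nneg_row v := forall i, 0 <= v 0 i.

Lemma hmm_step_ge0 Q f v z : is_trans Q -> (forall i y, 0 <= f i y) ->
  nneg_row v -> nneg_row (hmm_step Q f v z).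
Proof.
move=> HQ f0 v0 j; rewrite mxE; apply: sumr_ge0 => i _.
rewrite !mulr_ge0//; by have [/(_ j)] := HQ i; rewrite mxE.
Qed.

Lemma hmm_fwd_ge0 Q f v s : is_trans Q -> (forall i y, 0 <= f i y) ->
  nneg_row v -> nneg_row (hmm_fwd Q f v s).
Proof.
move=> HQ f0; elim: s v => [//|z s IH] v v0 /=.
by apply: IH; apply: hmm_step_ge0.
Qed.

Lemma hmm_lik_ge0 Q f v s : is_trans Q -> (forall i y, 0 <= f i y) ->
  nneg_row v -> 0 <= hmm_lik Q f v s.
Proof. by move=> HQ f0 v0; apply: sumr_ge0 => j _; apply: hmm_fwd_ge0. Qed.

(** The induction absorbs the first observation into the parameter, so the starting row must depend
    on the parameter as well. *)
Lemma measurable_hmm_fwd dT (T : measurableType dT) n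
  (Q : T -> 'M[R]_k) (f : T -> 'I_k -> Obs -> R) (v : T -> 'rV[R]_k) :
  (forall i j, measurable_fun setT (fun t => Q t i j)) ->
  (forall i, measurable_fun setT (fun p : T * Obs => f p.1 i p.2)) ->
  (forall i, measurable_fun setT (fun t => v t 0 i)) ->
  forall j, measurable_fun setT (fun p : T * n.-tuple Obs => hmm_fwd (Q p.1) (f p.1) (v p.1) p.2 0 j).
Proof.
elim: n dT T Q f v => [|n IH] dT T Q f v mQ mf mv j.
  under eq_fun do rewrite (tuple0 _) /=.
  exact: (measurableT_comp (f := fun t => v t 0 j) (mv j) measurable_fst).
pose Q' (p : T * Obs) := Q p.1; pose f' (p : T * Obs) := f p.1.
pose v' (p : T * Obs) := hmm_step (Q p.1) (f p.1) (v p.1) p.2.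
pose h (p : T * n.+1.-tuple Obs) : (T * Obs) * n.-tuple Obs :=
  ((p.1, tnth p.2 ord0), [tuple of behead p.2]).
have mh : measurable_fun setT h.
  apply: measurable_fun_pair.
    apply: measurable_fun_pair => //.
    apply: (measurableT_comp (f := fun y : n.+1.-tuple Obs => tnth y ord0)) => //.
    exact: measurable_tnth.
  by apply: (measurableT_comp (f := fun y : n.+1.-tuple Obs => [tuple of behead y])) => //; exact: measurable_behead.
rewrite (_ : (fun p => _) = (fun q : T * Obs * n.-tuple Obs =>
    hmm_fwd (Q' q.1) (f' q.1) (v' q.1) q.2 0 j) \o h); last first.
  by apply/funext => -[t y]; case/tupleP: y => z y.
apply: measurableT_comp mh; apply: IH.
- by move=> i i'; apply: (measurableT_comp (f := fun t => Q t i i')).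
- move=> i; apply: (measurableT_comp (f := fun p : T * Obs => f p.1 i p.2)
    (g := fun q : T * Obs * Obs => (q.1.1, q.2))) => //.
  by apply: measurable_fun_pair => //; exact: measurableT_comp.
- move=> i; rewrite /v'; under eq_fun do rewrite mxE.
  apply: measurable_sum => i'; apply: measurable_funM.
    by apply: measurable_funM => //; apply: (measurableT_comp (f := fun t => v t 0 i')).
  by apply: (measurableT_comp (f := fun t => Q t i' i)).
Qed.

Lemma measurable_hmm_lik dT (T : measurableType dT) n
  (Q : T -> 'M[R]_k) (f : T -> 'I_k -> Obs -> R) (v : T -> 'rV[R]_k) :
  (forall i j, measurable_fun setT (fun t => Q t i j)) ->
  (forall i, measurable_fun setT (fun p : T * Obs => f p.1 i p.2)) ->
  (forall i, measurable_fun setT (fun t => v t 0 i)) ->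
  measurable_fun setT (fun p : T * n.-tuple Obs => hmm_lik (Q p.1) (f p.1) (v p.1) p.2).
Proof.
by move=> mQ mf mv; apply: measurable_sum => j; apply: measurable_hmm_fwd.
Qed.

End ForwardAlgebra.

(** * Stochastic matrices: contraction, stationary laws, perturbation *)

Section StochasticMatrices.
Context {R : realType} {k : nat}.
Implicit Types (Q : 'M[R]_k) (v : 'rV[R]_k).

Definition l1norm v : R := \sum_i `|v 0 i|.

Lemma l1norm_ge0 v : 0 <= l1norm v.
Proof. exact: sumr_ge0. Qed.

Lemma l1normD u v : l1norm (u + v) <= l1norm u + l1norm v.
Proof.
rewrite /l1norm -big_split; apply: ler_sum => i _ /=.
by rewrite mxE ler_normD.
Qed.

Lemma trans_ge0 Q i j : is_trans Q -> 0 <= Q i j.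
Proof. by move=> /(_ i)[/(_ j) + _]; rewrite mxE. Qed.

Lemma trans_sum1 Q i : is_trans Q -> \sum_j Q i j = 1.
Proof. by move=> /(_ i)[_ <-]; apply: eq_bigr => j _; rewrite mxE. Qed.

Lemma trans_le1 Q i j : is_trans Q -> Q i j <= 1.
Proof.
move=> HQ; rewrite -(trans_sum1 i HQ) (bigD1 j)//= lerDl.
by apply: sumr_ge0 => l _; apply: trans_ge0.
Qed.

Lemma dist_l1norm v : is_dist v -> l1norm v = 1.
Proof. by move=> [v0 <-]; apply: eq_bigr => i _; rewrite ger0_norm. Qed.

Lemma sum_mulmx_trans Q v : is_trans Q ->
  \sum_j (v *m Q) 0 j = \sum_i v 0 i.
Proof.
move=> HQ; under eq_bigr do rewrite mxE.
rewrite exchange_big /=; apply: eq_bigr => i _.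
by rewrite -mulr_sumr trans_sum1// mulr1.
Qed.

Lemma l1norm_mulmx_le (c : R) (A : 'M[R]_k) v : (forall i, \sum_j `|A i j| <= c) ->
  l1norm (v *m A) <= c * l1norm v.
Proof.
move=> HA; rewrite /l1norm.
apply: (@le_trans _ _ (\sum_j \sum_i `|v 0 i| * `|A i j|)).
  apply: ler_sum => j _; rewrite mxE (le_trans (ler_norm_sum _ _ _))//.
  by apply: ler_sum => i _; rewrite normrM.
rewrite exchange_big mulr_sumr; apply: ler_sum => i _ /=.
by rewrite -mulr_sumr mulrC ler_wpM2r.
Qed.

(* A row vector of total mass 0 does not see the constant part [q] of the entries. *)
Lemma l1norm_contract q Q v : trans_lb q Q -> \sum_i v 0 i = 0 ->
  l1norm (v *m Q) <= (1 - k%:R * q) * l1norm v.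
Proof.
move=> [HQ Hq] v0.
have -> : v *m Q = v *m (Q - const_mx q).
  rewrite mulmxBr (_ : v *m const_mx q = 0) ?subr0//.
  apply/rowP => j; rewrite !mxE; under eq_bigr do rewrite mxE.
  by rewrite -mulr_suml v0 mul0r.
apply: l1norm_mulmx_le => i.
under eq_bigr => j _.
  rewrite !mxE ger0_norm ?subr_ge0//; over.
by rewrite sumrB trans_sum1// sumr_const card_ord mulr_natl.
Qed.

Definition chain_law w Q v := iter w (fun u => u *m Q) v.

Lemma mulmx_dist Q v : is_trans Q -> is_dist v -> is_dist (v *m Q).
Proof.
move=> HQ [v0 v1]; split; last by rewrite sum_mulmx_trans.
move=> j; rewrite mxE; apply: sumr_ge0 => i _.
by rewrite mulr_ge0// trans_ge0.
Qed.

Lemma chain_law_dist w Q v : is_trans Q -> is_dist v -> is_dist (chain_law w Q v).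
Proof. by move=> HQ Hv; elim: w => //= w IH; apply: mulmx_dist. Qed.

Lemma sum_chain_law w Q v : is_trans Q -> \sum_i chain_law w Q v 0 i = \sum_i v 0 i.
Proof. by move=> HQ; elim: w => //= w IH; rewrite sum_mulmx_trans. Qed.

Lemma chain_law_ge0 w Q v : is_trans Q -> nneg_row v -> nneg_row (chain_law w Q v).
Proof.
move=> HQ v0; elim: w => //= w IH j; rewrite mxE; apply: sumr_ge0 => i _.
by rewrite mulr_ge0// trans_ge0.
Qed.

Lemma trans_lb_kq q Q : (0 < k)%N -> trans_lb q Q -> k%:R * q <= 1.
Proof.
move=> k0 [HQ Hq].
rewrite mulr_natl -(trans_sum1 (Ordinal k0) HQ) -[X in _ *+ X]card_ord -sumr_const.
exact: ler_sum.
Qed.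

(** The difference of two laws has mass 0 and keeps it, so each step contracts it by 1 - kq; the 2
    bounds the initial l1 distance. *)
Lemma chain_law_mixing q w Q u v : (0 < k)%N -> trans_lb q Q -> is_dist u -> is_dist v ->
  l1norm (chain_law w Q u - chain_law w Q v) <= 2 * (1 - k%:R * q) ^+ w.
Proof.
move=> k0 HQ Hu Hv; have HQ' := HQ.1.
have q1 : 0 <= 1 - k%:R * q by rewrite subr_ge0 (trans_lb_kq k0 HQ).
elim: w => [|w IH] /=.
  rewrite expr0 mulr1 (le_trans (l1normD _ _))//.
  rewrite (_ : l1norm (- v) = l1norm v); last by apply: eq_bigr => i _; rewrite mxE normrN.
  by rewrite !dist_l1norm.
rewrite -mulmxBl (le_trans (l1norm_contract HQ _))//.
  under eq_bigr do rewrite !mxE.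
  by rewrite sumrB !sum_chain_law// Hu.2 Hv.2 subrr.
by rewrite exprS mulrCA ler_wpM2l.
Qed.

(** Q - 1 annihilates the all-ones column, hence is singular and has a nonzero left kernel vector v.
    The entrywise absolute value u of v satisfies u <= uQ; both sides have the same total mass, so
    they are equal, and u can be normalised. *)
Lemma stationary_exists Q : (0 < k)%N -> is_trans Q -> exists v, is_stationary Q v.
Proof.
move=> k0 HQ.
have [v v0 vQ] : exists2 v : 'rV[R]_k, v != 0 & v *m Q = v.
  have nf : ~~ row_free (Q - 1%:M).
    rewrite row_free_unit; apply/negP => u.
    have : (Q - 1%:M) *m (const_mx 1 : 'cV[R]_k) = 0.
      apply/colP => i; rewrite mulmxBl mul1mx !mxE.
      under eq_bigr do rewrite mxE mulr1.
      by rewrite trans_sum1// subrr.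
    move=> /(congr1 (mulmx (invmx (Q - 1%:M)))); rewrite mulmx0 mulKmx//.
    by move=> /colP/(_ (Ordinal k0)); rewrite !mxE => /eqP; rewrite oner_eq0.
  have /rowV0Pn[v /sub_kermxP vK v0] : kermx (Q - 1%:M) != 0.
    by rewrite kermx_eq0.
  exists v => //; apply/eqP; rewrite -subr_eq0; apply/eqP.
  by rewrite -[X in _ - X]mulmx1 -mulmxBr.
pose u : 'rV[R]_k := \row_i `|v 0 i|.
have ule j : u 0 j <= (u *m Q) 0 j.
  rewrite !mxE -{1}vQ mxE (le_trans (ler_norm_sum _ _ _))//.
  by apply: ler_sum => i _; rewrite mxE normrM [`|Q _ _|]ger0_norm// trans_ge0.
have uQ : u *m Q = u.
  apply/rowP => j; apply/eqP; rewrite -subr_eq0.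
  have : \sum_i ((u *m Q) 0 i - u 0 i) == 0.
    by rewrite sumrB sum_mulmx_trans// subrr.
  rewrite psumr_eq0; last by move=> i _; rewrite subr_ge0.
  by move=> /allP/(_ j); rewrite mem_index_enum => /(_ isT).
have s0 : 0 < \sum_i u 0 i.
  have [i vi] : exists i, v 0 i != 0.
    apply/existsP; apply: contraR v0; rewrite negb_exists => /forallP v0.
    by apply/eqP/rowP => i; have := v0 i; rewrite negbK mxE => /eqP.
  rewrite (bigD1 i)//= ltr_pwDl//; first by rewrite mxE normr_gt0.
  by apply: sumr_ge0 => j _; rewrite mxE.
exists ((\sum_i u 0 i)^-1 *: u); split; last by rewrite -scalemxAl uQ.
split; first by move=> i; rewrite !mxE mulr_ge0// invr_ge0 ltW.
under eq_bigr do rewrite mxE.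
by rewrite -mulr_sumr mulVf// gt_eqF.
Qed.

Lemma stat_distP Q : (0 < k)%N -> is_trans Q -> is_stationary Q (stat_dist Q).
Proof.
move=> k0 HQ; have [v vQ] := stationary_exists k0 HQ.
exact: (xgetPex 0 (ex_intro _ v vQ)).
Qed.

Lemma chain_law_stat w Q v : is_stationary Q v -> chain_law w Q v = v.
Proof. by move=> [_ vQ]; elim: w => //= w ->. Qed.

(** One more step carries the old error through Q, which does not expand the l1 norm, and adds at
    most k eta from replacing Q by Q'. *)
Lemma chain_law_perturb w Q Q' (eta : R) v : is_trans Q -> is_trans Q' ->
  is_dist v -> (forall i j, `|Q i j - Q' i j| <= eta) ->
  l1norm (chain_law w Q v - chain_law w Q' v) <= w%:R * (k%:R * eta).
Proof.
move=> HQ HQ' Hv He; elim: w => [|w IH] /=.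
  rewrite subrr mul0r /l1norm big1// => i _; by rewrite mxE normr0.
set a := chain_law w Q v; set b := chain_law w Q' v.
have -> : a *m Q - b *m Q' = (a - b) *m Q + b *m (Q - Q').
  by rewrite mulmxBl mulmxBr addrA subrK.
rewrite (le_trans (l1normD _ _))// -natr1 mulrDl mul1r lerD//.
  rewrite (le_trans (@l1norm_mulmx_le 1 _ _ _)) ?mul1r// => i.
  rewrite -(trans_sum1 i HQ); apply: ler_sum => j _.
  by rewrite ger0_norm// trans_ge0.
rewrite (le_trans (@l1norm_mulmx_le (k%:R * eta) _ _ _)) ?dist_l1norm ?mulr1//.
  move=> i; rewrite mulr_natl -[X in _ *+ X]card_ord -sumr_const.
  by apply: ler_sum => j _; rewrite !mxE.
exact: chain_law_dist.
Qed.

End StochasticMatrices.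

(** * Measurability of comparison sets and of functions of sequences *)

Section ComparisonSets.
Context {R : realType} {dT : measure_display} {T : measurableType dT}.

Lemma measurable_bool_set (b : T -> bool) : measurable_fun setT b -> measurable [set x | b x].
Proof.
move=> mb; rewrite (_ : [set x | b x] = setT `&` b @^-1` [set true]).
  exact: (mb measurableT).
by rewrite setTI.
Qed.

Lemma measurable_ler_set (F G : T -> R) : measurable_fun setT F ->
  measurable_fun setT G -> measurable [set x | F x <= G x].
Proof. by move=> mF mG; apply: measurable_bool_set; exact: measurable_fun_ler. Qed.

Lemma measurable_ltr_set (F G : T -> R) : measurable_fun setT F ->
  measurable_fun setT G -> measurable [set x | F x < G x].
Proof. by move=> mF mG; apply: measurable_bool_set; exact: measurable_fun_ltr. Qed.

Lemma measurable_lee_set (F G : T -> \bar R) : measurable_fun setT F ->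
  measurable_fun setT G -> measurable [set x | (F x <= G x)%E].
Proof. by move=> mF mG; apply: measurable_bool_set; exact: measurable_fun_lee. Qed.

Lemma measurable_lte_set (F G : T -> \bar R) : measurable_fun setT F ->
  measurable_fun setT G -> measurable [set x | (F x < G x)%E].
Proof. by move=> mF mG; apply: measurable_bool_set; exact: measurable_fun_lte. Qed.

End ComparisonSets.

Section SeqMeasurability.
Context {R : realType} {d : nat}.
Local Notation Obs := (d.-tuple R).

(* Functions on sequences of arbitrary length, measurable on each (R^d)^n. *)
Definition smeas (F : seq Obs -> R) :=
  forall n, measurable_fun setT (fun y : n.-tuple Obs => F y).

Lemma measurable_drop_tuple n w :
  measurable_fun setT (fun y : n.-tuple Obs => [tuple of drop w y]).
Proof.
apply/measurable_fun_tnthP => i.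
have wi : (w + i < n)%N by have := ltn_ord i; lia.
rewrite (_ : _ \o _ = fun y : n.-tuple Obs => tnth y (Ordinal wi)).
  exact: measurable_tnth.
apply/funext => y /=; have z := tnth y (Ordinal wi).
by rewrite !(tnth_nth z) /= nth_drop.
Qed.

Lemma measurable_take_tuple n w :
  measurable_fun setT (fun y : n.-tuple Obs => [tuple of take w y]).
Proof.
apply/measurable_fun_tnthP => i.
have wi : (i < n)%N by have := ltn_ord i; lia.
have iw : (i < w)%N by have := ltn_ord i; lia.
rewrite (_ : _ \o _ = fun y : n.-tuple Obs => tnth y (Ordinal wi)).
  exact: measurable_tnth.
apply/funext => y /=; have z := tnth y (Ordinal wi).
by rewrite !(tnth_nth z) /= nth_take.
Qed.

Lemma measurable_cat_tuple m n :
  measurable_fun setT (fun p : m.-tuple Obs * n.-tuple Obs => [tuple of p.1 ++ p.2]).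
Proof.
apply/measurable_fun_tnthP => i.
case: (ltnP i m) => im.
  rewrite (_ : _ \o _ = fun p : m.-tuple Obs * n.-tuple Obs => tnth p.1 (Ordinal im)).
    by apply: (measurableT_comp (f := fun y : m.-tuple Obs => tnth y (Ordinal im))) => //; exact: measurable_tnth.
  apply/funext => -[s t] /=; have z := tnth s (Ordinal im).
  by rewrite !(tnth_nth z) /= nth_cat size_tuple im.
have im' : (i - m < n)%N by have := ltn_ord i; lia.
rewrite (_ : _ \o _ = fun p : m.-tuple Obs * n.-tuple Obs => tnth p.2 (Ordinal im')).
  by apply: (measurableT_comp (f := fun y : n.-tuple Obs => tnth y (Ordinal im'))) => //; exact: measurable_tnth.
apply/funext => -[s t] /=; have z := tnth t (Ordinal im').
by rewrite !(tnth_nth z) /= nth_cat size_tuple ltnNge im.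
Qed.

Lemma smeas_drop w F : smeas F -> smeas (fun s => F (drop w s)).
Proof.
move=> mF n; rewrite (_ : (fun _ => _) = (fun y : (n - w).-tuple Obs => F y) \o
  (fun y : n.-tuple Obs => [tuple of drop w y]))//.
exact: (measurableT_comp (mF _) (@measurable_drop_tuple _ _)).
Qed.

Lemma smeas_take w F : smeas F -> smeas (fun s => F (take w s)).
Proof.
move=> mF n; rewrite (_ : (fun _ => _) = (fun y : (minn w n).-tuple Obs => F y) \o
  (fun y : n.-tuple Obs => [tuple of take w y]))//.
exact: (measurableT_comp (mF _) (@measurable_take_tuple _ _)).
Qed.

Lemma smeas_cat2 m n F : smeas F ->
  measurable_fun setT (fun p : m.-tuple Obs * n.-tuple Obs => F (p.1 ++ p.2)).
Proof.
move=> mF; rewrite (_ : (fun _ => _) = (fun y : (m + n).-tuple Obs => F y) \o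
  (fun p : m.-tuple Obs * n.-tuple Obs => [tuple of p.1 ++ p.2]))//.
exact: (measurableT_comp (mF _) (@measurable_cat_tuple _ _)).
Qed.

Lemma smeas_hmm_fwd k (Q : 'M[R]_k) (f : 'I_k -> Obs -> R) v j :
  (forall i, measurable_fun setT (f i)) -> smeas (fun s => hmm_fwd Q f v s 0 j).
Proof.
move=> mf n.
have := @measurable_hmm_fwd R d k _ unit n (fun _ => Q) (fun _ => f) (fun _ => v) _ _ _ j.
move=> H; have {}H := H (fun _ _ => measurable_cst _) (fun i => measurableT_comp (mf i) measurable_snd)
  (fun _ => measurable_cst _).
exact: (measurableT_comp H (measurable_pair1 tt)).
Qed.

Lemma smeas_hmm_lik k (Q : 'M[R]_k) (f : 'I_k -> Obs -> R) v :
  (forall i, measurable_fun setT (f i)) -> smeas (hmm_lik Q f v).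
Proof. by move=> mf n; apply: measurable_sum => j; apply: (smeas_hmm_fwd _ _ _ mf). Qed.

(** Each block is preceded by its gap, so that even the first block is read after w transitions,
    whatever the initial law. *)
Fixpoint block_sum (g : seq Obs -> R) (w l N : nat) (s : seq Obs) : R :=
  if N is N'.+1 then g (take l (drop w s)) + block_sum g w l N' (drop (w + l) s)
  else 0.

Lemma smeas_block_sum g w l N : smeas g -> smeas (block_sum g w l N).
Proof.
move=> mg; elim: N => [|N IH] n /=; first exact: measurable_cst.
apply: measurable_funD.
  exact: (smeas_drop w (smeas_take l mg)).
exact: (smeas_drop (w + l) IH).
Qed.

End SeqMeasurability.

(** * Expectations under a hidden Markov model and exponential moments of block sums *)

Section HMMIntegrals.
Context {R : realType} {d k : nat} (lam : {measure set (d.-tuple R) -> \bar R}).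
Hypothesis hlam : sigma_finite setT lam.
Local Notation Obs := (d.-tuple R).
Variables (Q : 'M[R]_k) (f : 'I_k -> Obs -> R).
Hypotheses (HQ : is_trans Q) (Hf : forall j, is_density lam (f j)).
Implicit Types (v : 'rV[R]_k) (g : seq Obs -> R) (c : 'I_k -> R).

Let mf i : measurable_fun setT (f i). Proof. by have [] := Hf i. Qed.
Let f0 i y : 0 <= f i y. Proof. by have [_ []] := Hf i. Qed.
Let f1 i : (\int[lam]_y (f i y)%:E = 1)%E. Proof. by have [_ []] := Hf i. Qed.
Local Notation step := (hmm_step Q f).
Local Notation fwd := (hmm_fwd Q f).
Local Notation lik := (hmm_lik Q f).

Lemma integral_hmm_step v c : nneg_row v -> (forall j, 0 <= c j) ->
  (\int[lam]_z (\sum_j step v z 0 j * c j)%:E = (\sum_j (v *m Q) 0 j * c j)%:E)%E.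
Proof.
move=> v0 c0.
have E z : \sum_j step v z 0 j * c j = \sum_i (v 0 i * \sum_j Q i j * c j) * f i z.
  under eq_bigr do rewrite mxE mulr_suml.
  rewrite exchange_big; apply: eq_bigr => i _ /=.
  by rewrite mulr_sumr mulr_suml; apply: eq_bigr => j _; ring.
have a0 i : 0 <= v 0 i * \sum_j Q i j * c j.
  by rewrite mulr_ge0// sumr_ge0// => j _; rewrite mulr_ge0// trans_ge0.
under eq_integral do rewrite E -sumEFin.
rewrite ge0_integral_sum//; first last.
- by move=> i z _; rewrite lee_fin mulr_ge0.
- by move=> i; apply/measurable_EFinP; apply: measurable_funM.
under eq_bigr => i _.
  under eq_integral do rewrite EFinM.
  rewrite ge0_integralZl//; first last.
  - by rewrite lee_fin.
  - by move=> z _; rewrite lee_fin.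
  - exact/measurable_EFinP.
  rewrite f1 mule1; over.
rewrite sumEFin; congr EFin.
under [RHS]eq_bigr do rewrite mxE mulr_suml.
rewrite [RHS]exchange_big; apply: eq_bigr => i _ /=.
by rewrite mulr_sumr; apply: eq_bigr => j _; ring.
Qed.

Lemma iint_hmm_fwd w v c : nneg_row v -> (forall j, 0 <= c j) ->
  iint lam (fun s : w.-tuple Obs => (\sum_j fwd v s 0 j * c j)%:E) =
  (\sum_j chain_law w Q v 0 j * c j)%:E.
Proof.
elim: w c => [|w IH] c v0 c0 //.
(* The last observation is split off: integrating it out replaces the weights c by Qc, to which the
   induction hypothesis applies. *)
rewrite -addn1 (iint_cat _ _ _ (fun s => (\sum_j fwd v s 0 j * c j)%:E)) addn1.
under eq_iint => s.
  rewrite /=; under eq_integral do rewrite /hmm_fwd foldl_cat /=.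
  rewrite integral_hmm_step//; last exact: hmm_fwd_ge0.
  have -> : \sum_j (foldl step v s *m Q) 0 j * c j =
            \sum_i fwd v s 0 i * (\sum_j Q i j * c j).
    under eq_bigr do rewrite mxE mulr_suml.
    rewrite exchange_big; apply: eq_bigr => i _ /=.
    by rewrite mulr_sumr; apply: eq_bigr => j _; rewrite mulrA.
  over.
rewrite IH//; last by move=> i; apply: sumr_ge0 => j _; rewrite mulr_ge0// trans_ge0.
congr EFin; rewrite /=.
under [RHS]eq_bigr do rewrite mxE mulr_suml.
rewrite [RHS]exchange_big; apply: eq_bigr => i _ /=.
by rewrite mulr_sumr; apply: eq_bigr => j _; rewrite mulrA.
Qed.

Lemma iint_hmm_lik n v : nneg_row v ->
  iint lam (fun s : n.-tuple Obs => (lik v s)%:E) = (\sum_i v 0 i)%:E.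
Proof.
move=> v0; rewrite -(sum_chain_law n v HQ).
under [in RHS]eq_bigr do rewrite -[chain_law _ _ _ _ _]mulr1.
rewrite -iint_hmm_fwd//; apply: eq_iint => s; congr EFin.
by apply: eq_bigr => j _; rewrite mulr1.
Qed.

(** The forward recursion multiplies the row by a matrix that depends on s but not on the row. *)
Lemma hmm_lik_linear v s : lik v s = \sum_x v 0 x * lik (delta_mx 0 x) s.
Proof.
have [M HM] : exists M : 'M[R]_k, forall u, fwd u s = u *m M.
  elim: s => [|z s [M IH]]; first by exists 1%:M => u; rewrite mulmx1.
  exists ((\matrix_(i, j) (f i z * Q i j)) *m M) => u /=.
  rewrite IH mulmxA; congr (_ *m _); apply/rowP => j; rewrite !mxE.
  by apply: eq_bigr => i _; rewrite mxE mulrA.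
rewrite /lik HM; under [RHS]eq_bigr do rewrite HM.
under [LHS]eq_bigr do rewrite mxE.
rewrite exchange_big /=; apply: eq_bigr => x _; rewrite -mulr_sumr; congr (_ * _).
by apply: eq_bigr => j _; rewrite -rowE mxE.
Qed.

Lemma nneg_delta x : nneg_row (delta_mx 0 x : 'rV[R]_k).
Proof. by move=> i; rewrite mxE ler0n. Qed.

Lemma sum_delta x : \sum_i (delta_mx 0 x : 'rV[R]_k) 0 i = 1.
Proof.
rewrite (bigD1 x)//= mxE !eqxx big1 ?addr0// => i ix.
by rewrite mxE (negbTE ix) andbF.
Qed.

(** Expectation of g over l observations when the hidden chain starts at x; [block_meanE] shows that
    [fine] loses nothing for bounded g. *)
Definition block_mean g l x : R :=
  fine (iint lam (fun t : l.-tuple Obs => (g t * lik (delta_mx 0 x) t)%:E)).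

Let mglik g v n : smeas g ->
  measurable_fun setT (fun t : n.-tuple Obs => (g t * lik v t)%:E).
Proof.
move=> mg; apply/measurable_EFinP; apply: measurable_funM; first exact: mg.
exact: smeas_hmm_lik.
Qed.

Let lik0 v s : nneg_row v -> 0 <= lik v s.
Proof. by move=> v0; apply: hmm_lik_ge0. Qed.

Lemma block_meanE g l x (M : R) : smeas g -> (forall s, 0 <= g s <= M) ->
  iint lam (fun t : l.-tuple Obs => (g t * lik (delta_mx 0 x) t)%:E) =
  (block_mean g l x)%:E.
Proof.
move=> mg g0; have M0 : 0 <= M by have /andP[] := g0 [::]; exact: le_trans.
rewrite fineK// ge0_fin_numE.
  apply: (@le_lt_trans _ _ (M%:E * iint lam (fun t : l.-tuple Obs => (lik (delta_mx 0 x) t)%:E))%E).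
    rewrite -iintZl//; first last.
    - by move=> y; rewrite lee_fin; apply: lik0; apply: nneg_delta.
    - by apply/measurable_EFinP; apply: smeas_hmm_lik.
    apply: le_iint => //; first exact: mglik.
    - apply: measurable_funeM; apply/measurable_EFinP; exact: smeas_hmm_lik.
    - move=> y; rewrite lee_fin mulr_ge0//; first by have /andP[] := g0 y.
      by apply: lik0; apply: nneg_delta.
    - move=> y; rewrite -EFinM lee_fin ler_wpM2r//; last by have /andP[] := g0 y.
      by apply: lik0; apply: nneg_delta.
  by rewrite iint_hmm_lik ?sum_delta; [rewrite -EFinM ltry|exact: nneg_delta].
apply: iint_ge0 => y; rewrite lee_fin mulr_ge0//; first by have /andP[] := g0 y.
by apply: lik0; apply: nneg_delta.
Qed.

Lemma block_mean_ge0 g l x : (forall s, 0 <= g s) -> 0 <= block_mean g l x.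
Proof.
move=> g0; apply: fine_ge0; apply: iint_ge0 => y.
by rewrite lee_fin mulr_ge0// lik0//; exact: nneg_delta.
Qed.

Lemma block_mean_linear g l v (M : R) : smeas g -> (forall s, 0 <= g s <= M) ->
  nneg_row v ->
  iint lam (fun t : l.-tuple Obs => (g t * lik v t)%:E) =
  (\sum_x v 0 x * block_mean g l x)%:E.
Proof.
move=> mg g0 v0.
have gl0 x (t : l.-tuple Obs) : (0 <= (g t * lik (delta_mx 0 x) t)%:E)%E.
  rewrite lee_fin mulr_ge0//; first by have /andP[] := g0 t.
  by apply: lik0; exact: nneg_delta.
under eq_iint => t.
  rewrite hmm_lik_linear mulr_sumr -sumEFin.
  under eq_bigr do rewrite mulrCA EFinM.
  over.
rewrite iint_sum//; first last.
- by move=> x y; rewrite mule_ge0// lee_fin.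
- by move=> x; apply: measurable_funeM; exact: mglik.
rewrite -sumEFin; apply: eq_bigr => x _; rewrite iintZl//; first last.
- exact: mglik.
- by rewrite lee_fin.
by rewrite (block_meanE _ _ mg g0).
Qed.

(** Integrating out the observations of the gap leaves only w transitions of the hidden chain. *)
Lemma block_mean_gap g w l v (M : R) : smeas g -> (forall s, 0 <= g s <= M) ->
  nneg_row v ->
  iint lam (fun s : (w + l).-tuple Obs => (g (drop w s) * lik v s)%:E) =
  (\sum_x chain_law w Q v 0 x * block_mean g l x)%:E.
Proof.
move=> mg g0 v0.
rewrite (iint_cat _ _ _ (fun s => (g (drop w s) * lik v s)%:E)).
rewrite -iint_hmm_fwd//; last first.
  by move=> j; apply: block_mean_ge0 => s; have /andP[] := g0 s.
apply: eq_iint => s; rewrite -(block_mean_linear _ mg g0); last exact: hmm_fwd_ge0.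
by apply: eq_iint => t; rewrite hmm_lik_cat drop_size_cat// size_tuple.
Qed.

(** The likelihood started from a point mass has integral one, so the constant A passes through
    unchanged. This transfers the affine bound on exp(a (g - c)) to block means. *)
Lemma block_mean_le (g h : seq Obs -> R) l x (A a M : R) : smeas g -> smeas h ->
  0 <= A -> 0 <= a -> (forall s, 0 <= g s <= M) -> (forall s, 0 <= h s) ->
  (forall s, h s <= A + a * g s) -> block_mean h l x <= A + a * block_mean g l x.
Proof.
move=> mg mh A0 a0 g0 h0 hg.
have hb s : 0 <= h s <= A + a * M.
  rewrite h0 (le_trans (hg s))// lerD2l ler_wpM2l//; by have /andP[] := g0 s.
have gd0 (s : l.-tuple Obs) : 0 <= g s * lik (delta_mx 0 x) s.
  by rewrite mulr_ge0//; [have /andP[] := g0 s|apply: lik0; exact: nneg_delta].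
rewrite -lee_fin EFinD EFinM -(block_meanE _ _ mh hb) -(block_meanE _ _ mg g0).
rewrite -iintZl//; last exact: mglik.
have -> : A%:E = (A%:E * iint lam (fun s : l.-tuple Obs => (lik (delta_mx 0 x) s)%:E))%E.
  by rewrite iint_hmm_lik ?sum_delta ?mule1//; exact: nneg_delta.
have mlik : measurable_fun setT (fun s : l.-tuple Obs => (lik (delta_mx 0 x) s)%:E).
  by apply/measurable_EFinP; exact: smeas_hmm_lik.
have l0 (s : l.-tuple Obs) : (0 <= (lik (delta_mx 0 x) s)%:E)%E.
  by rewrite lee_fin; apply: lik0; exact: nneg_delta.
rewrite -iintZl// -iintD//; first last.
- by move=> y; rewrite mule_ge0// lee_fin.
- by move=> y; rewrite mule_ge0// lee_fin.
- by apply: measurable_funeM; exact: mglik.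
- exact: measurable_funeM.
apply: le_iint => //; first exact: mglik.
- apply: emeasurable_funD; first exact: measurable_funeM.
  by apply: measurable_funeM; exact: mglik.
- by move=> y; rewrite lee_fin mulr_ge0//; exact: l0.
- move=> y; rewrite -!EFinM -EFinD lee_fin mulrA -mulrDl ler_wpM2r//.
  by apply: lik0; exact: nneg_delta.
Qed.

(** exp x <= 1 / (1 - x), and (1 - x)(1 + x + 2 x^2) = 1 + x^2 (1 - 2 x) is at least 1 for x <=
    1/2. *)
Lemma expR_le_quad (x : R) : x <= 2^-1 -> expR x <= 1 + x + 2 * x ^+ 2.
Proof.
move=> x1; have h : 0 < 1 - x by lra.
have : expR x <= (1 - x)^-1.
  rewrite -[expR x]invrK -expRN lef_pV2 ?posrE ?expR_gt0//.
  exact: expR_ge1Dx.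
move=> /le_trans; apply; rewrite -(ler_pM2r h) mulVf ?gt_eqF//; nra.
Qed.

(** With a = tau / 32, one block multiplies the mass by at most 1 - a c + 8 a^2 + a (c - tau / 2) =
    1 - tau^2 / 128; this a minimises 8 a^2 - a tau / 2. Hypothesis and conclusion are homogeneous
    in v because the row left by a block is not normalised. The range of c accommodates both m + tau
    and 1 - (m + tau) for m, tau in [0, 1]. Observations after the last block are integrated out. *)
Lemma block_exp_moment g w l (c tau : R) : smeas g -> (forall s, 0 <= g s <= 1) ->
  -1 <= c <= 2 -> 0 < tau <= 1 ->
  (forall v, nneg_row v ->
    \sum_x chain_law w Q v 0 x * block_mean g l x <= (c - tau / 2) * \sum_x v 0 x) ->
  forall N n v, (N * (w + l) <= n)%N -> nneg_row v ->
  (iint lam (fun s : n.-tuple Obs =>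
     (expR (tau / 32 * (block_sum g w l N s - N%:R * c)) * lik v s)%:E)
   <= ((1 - tau ^+ 2 / 128) ^+ N * \sum_x v 0 x)%:E)%E.
Proof.
move=> mg g0 /andP[c0 c1] /andP[t0 t1] Hmean; set a := tau / 32.
pose h s := expR (a * (g s - c)).
have mh : smeas h.
  move=> n; apply: measurableT_comp => //; apply: measurable_funM => //.
  by apply: measurable_funB => //; exact: mg.
have a0 : 0 <= a by rewrite /a; lra.
(* The range of c gives |g - c| <= 2, so the quadratic term 2 (a (g - c))^2 is at most 8 a^2. *)
have hq s : h s <= (1 - a * c + 8 * a ^+ 2) + a * g s.
  have /andP[gs0 gs1] := g0 s.
  rewrite /h (le_trans (expR_le_quad _))//.
    by rewrite /a; nra.
  suff : (a * (g s - c)) ^+ 2 <= 4 * a ^+ 2 by nra.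
  rewrite exprMn mulrC ler_wpM2r ?sqr_ge0//; nra.
have A0 : 0 <= 1 - a * c + 8 * a ^+ 2 by rewrite /a; nra.
have hb s : 0 <= h s <= 1 - a * c + 8 * a ^+ 2 + a.
  rewrite expR_ge0 (le_trans (hq s))// lerD2l.
  by have /andP[? ?] := g0 s; rewrite ler_piMr.
elim=> [|N IH] n v Nn v0.
  under eq_iint do rewrite /= mul0r subrr mulr0 expR0 mul1r.
  by rewrite iint_hmm_lik// expr0 mul1r.
have -> : n = (w + l + (n - (w + l)))%N by lia.
set n' := (n - (w + l))%N.
have Nn' : (N * (w + l) <= n')%N by rewrite /n'; lia.
pose E N s := expR (a * (block_sum g w l N s - N%:R * c)).
have mE M : smeas (E M).
  move=> m; apply: measurableT_comp => //; apply: measurable_funM => //.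
  by apply: measurable_funB => //; exact: smeas_block_sum.
(* The first gap and block contribute h; the remaining blocks see the past only through the forward
   row. *)
have ES (s : (w + l).-tuple Obs) (t : n'.-tuple Obs) :
    E N.+1 (s ++ t) * lik v (s ++ t) = h (drop w s) * (E N t * lik (fwd v s) t).
  rewrite hmm_lik_cat mulrA; congr (_ * _).
  rewrite /E /h -expRD /= take_drop take_size_cat; last by rewrite size_tuple addnC.
  rewrite [drop (w + l) _]drop_size_cat ?size_tuple// -natr1.
  by congr expR; ring.
rewrite (iint_cat _ _ _ (fun s => (E N.+1 s * lik v s)%:E)).
under eq_iint => s.
  under eq_iint do rewrite ES EFinM.
  rewrite iintZl//; first last.
  - by move=> y; rewrite lee_fin mulr_ge0 ?expR_ge0//; apply: lik0; apply: hmm_fwd_ge0.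
  - by apply: mglik.
  - by rewrite lee_fin expR_ge0.
  over.
have k0 : 0 <= 1 - tau ^+ 2 / 128 by nra.
apply: (@le_trans _ _ (iint lam (fun s : (w + l).-tuple Obs =>
  ((1 - tau ^+ 2 / 128) ^+ N)%:E * (h (drop w s) * lik v s)%:E)%E)).
  apply: le_iint => //.
  - apply: emeasurable_funM.
      by apply/measurable_EFinP; exact: (smeas_drop w mh).
    apply: (measurable_iint_param hlam (F := fun (s : (w + l).-tuple Obs) (t : n'.-tuple Obs) => (E N t * lik (fwd v s) t)%:E)).
      apply/measurable_EFinP; apply: measurable_funM.
        by apply: (measurableT_comp (f := fun y : n'.-tuple Obs => E N y)) => //; exact: mE.
      under eq_fun do rewrite -hmm_lik_cat.
      apply: smeas_cat2; exact: smeas_hmm_lik.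
    by move=> s t; rewrite lee_fin mulr_ge0 ?expR_ge0//; apply: lik0; apply: hmm_fwd_ge0.
  - apply: measurable_funeM; apply/measurable_EFinP.
    by apply: measurable_funM; [exact: (smeas_drop w mh)|exact: smeas_hmm_lik].
  - move=> s; rewrite mule_ge0 ?lee_fin ?expR_ge0//; apply: iint_ge0 => t.
    by rewrite lee_fin mulr_ge0 ?expR_ge0//; apply: lik0; apply: hmm_fwd_ge0.
  - move=> s; apply: (@le_trans _ _ ((h (drop w s))%:E * ((1 - tau ^+ 2 / 128) ^+ N * lik v s)%:E)%E).
      by apply: lee_wpmul2l; [rewrite lee_fin expR_ge0|apply: IH => //; apply: hmm_fwd_ge0].
    by rewrite -!EFinM lee_fin mulrCA.
rewrite iintZl//; first last.
- by move=> s; rewrite lee_fin mulr_ge0 ?expR_ge0//; exact: lik0.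
- by apply/measurable_EFinP; apply: measurable_funM; [exact: (smeas_drop w mh)|exact: smeas_hmm_lik].
- by rewrite lee_fin exprn_ge0.
rewrite (block_mean_gap _ _ mh hb)// -EFinM lee_fin (exprSr _ N).
rewrite -[X in _ <= X]mulrA; apply: ler_wpM2l; first exact: exprn_ge0.
apply: (@le_trans _ _ (\sum_x (chain_law w Q v 0 x * (1 - a * c + 8 * a ^+ 2) +
   a * (chain_law w Q v 0 x * block_mean g l x)))).
  apply: ler_sum => x _; rewrite [X in _ <= _ + X]mulrCA -mulrDr.
  apply: ler_wpM2l; first exact: chain_law_ge0.
  by apply: (block_mean_le _ _ mg mh _ _ g0) => // s; rewrite expR_ge0.
rewrite big_split /= -mulr_suml sum_chain_law// -mulr_sumr.
have := Hmean v v0; set S := \sum_x chain_law _ _ _ _ _ * _.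
have : 0 <= \sum_x v 0 x by apply: sumr_ge0.
set V := \sum_x v 0 x => V0 SV.
apply: (@le_trans _ _ (V * (1 - a * c + 8 * a ^+ 2) + a * ((c - tau / 2) * V))).
  by rewrite lerD2l ler_wpM2l.
by rewrite le_eqVlt; apply/orP; left; apply/eqP; rewrite /a; field.
Qed.

(** Chernoff's bound: on the event, the exponential of [block_exp_moment] is at least 1. *)
Lemma block_tail g w l (c tau : R) : smeas g -> (forall s, 0 <= g s <= 1) ->
  -1 <= c <= 2 -> 0 < tau <= 1 ->
  (forall v, nneg_row v ->
    \sum_x chain_law w Q v 0 x * block_mean g l x <= (c - tau / 2) * \sum_x v 0 x) ->
  forall N n v, (N * (w + l) <= n)%N -> is_dist v ->
  (iint lam (fun s : n.-tuple Obs =>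
     (\1_[set s : n.-tuple Obs | N%:R * c <= block_sum g w l N s] s * lik v s)%:E)
   <= ((1 - tau ^+ 2 / 128) ^+ N)%:E)%E.
Proof.
move=> mg g0 hc ht Hm N n v Nn [v0 v1].
have := block_exp_moment mg g0 hc ht Hm Nn v0; rewrite v1 mulr1; apply: le_trans.
have mset : measurable [set s : n.-tuple Obs | N%:R * c <= block_sum g w l N s].
  by apply: measurable_ler_set => //; exact: smeas_block_sum.
apply: (le_iint hlam).
- apply/measurable_EFinP; apply: measurable_funM; last exact: smeas_hmm_lik.
  exact: measurable_indic.
- apply/measurable_EFinP; apply: measurable_funM; last exact: smeas_hmm_lik.
  apply: measurableT_comp => //; apply: measurable_funM => //.
  by apply: measurable_funB => //; exact: smeas_block_sum.
- by move=> s; rewrite lee_fin mulr_ge0//; exact: lik0.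
- move=> s; rewrite lee_fin ler_wpM2r//; first exact: lik0.
  rewrite indicE; case: (boolP (s \in _)) => [|_]; last exact: expR_ge0.
  rewrite inE /= => hs; rewrite (le_trans _ (expR_ge1Dx _))// lerDl.
  have /andP[t0 _] := ht.
  by rewrite mulr_ge0 ?subr_ge0//; lra.
Qed.

End HMMIntegrals.

(** * From rectangles to the joint law of the observations *)

Section LawOfObservations.
Context {R : realType} {d : nat} (lam : {measure set (d.-tuple R) -> \bar R}).
Hypothesis hlam : sigma_finite setT lam.
Local Notation Obs := (d.-tuple R).

Section DensityMeasure.
Variables (n : nat) (p : n.-tuple Obs -> R).
Hypotheses (mp : measurable_fun setT p) (p0 : forall y, 0 <= p y).

Definition dens_measure (A : set (n.-tuple Obs)) : \bar R :=
  iint lam (fun y => (\1_A y * p y)%:E).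

Let dm0 : dens_measure set0 = 0%E.
Proof.
rewrite /dens_measure; under eq_iint do rewrite indic0 mul0r.
exact: iint0.
Qed.

Let dm_ge0 A : (0 <= dens_measure A)%E.
Proof. by apply: iint_ge0 => y; rewrite lee_fin mulr_ge0. Qed.

Let dm_sigma_additive : semi_sigma_additive dens_measure.
Proof.
move=> F mF tF mUF.
have -> : dens_measure (\bigcup_n F n) = (\sum_(i <oo) dens_measure (F i))%E.
  rewrite /dens_measure -(iint_nneseries hlam); first last.
  - by move=> i y; rewrite lee_fin mulr_ge0.
  - by move=> i; apply/measurable_EFinP; apply: measurable_funM => //.
  apply: eq_iint => y; under eq_eseriesr do rewrite EFinM muleC.
  rewrite nneseriesZl//; rewrite mulrC EFinM; congr (_ * _)%E.
  by rewrite indic_bigcup.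
by apply/cvg_closeP; split; [apply: is_cvg_nneseries => *; exact: dm_ge0|rewrite closeE].
Qed.

Let dm_mixin := isMeasure.Build _ _ _ dens_measure dm0 dm_ge0 dm_sigma_additive.

(** The measure structure is needed to apply uniqueness of measures that agree on rectangles. *)
Definition densM : {measure set (n.-tuple Obs) -> \bar R} :=
  HB.pack_for (Measure.type (n.-tuple Obs) R) dens_measure dm_mixin.

End DensityMeasure.

(** A coordinate preimage is a rectangle whose other sides are full; conversely a rectangle is a
    finite intersection of such preimages. Rectangles, unlike single-coordinate preimages, are
    stable under intersection, as uniqueness of measures requires. *)
Lemma measurable_tuple_rectangles n : @measurable _ (n.-tuple Obs) =
  <<s [set A : set (n.-tuple Obs) | exists B : 'I_n -> set Obs,
    (forall t, measurable (B t)) /\ A = [set y | forall t, B t (tnth y t)]] >>.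
Proof.
apply/seteqP; split.
  apply: smallest_sub; first exact: smallest_sigma_algebra.
  rewrite -bigcup_seq => A [i _ [B mB <-]]; apply: sub_sigma_algebra.
  exists (fun t => if t == i then B else setT); split.
    by move=> t; case: ifP.
  rewrite setTI; apply/seteqP; split => [y /= By t|y /= /(_ i)]; last by rewrite eqxx.
  by case: eqP => // ->.
apply: smallest_sub; first exact: sigma_algebra_measurable.
move=> _ [B [mB ->]].
rewrite (_ : mkset _ = \bigcap_(t in [set: 'I_n]) ((fun y : n.-tuple Obs => tnth y t) @^-1` (B t))).
  apply: fin_bigcap_measurable => // t _.
  by rewrite -[X in measurable X]setTI; apply: measurable_tnth.
by apply/seteqP; split => [y By t _|y By t]; apply: By.
Qed.

Context {dO : measure_display} {Om : measurableType dO} (P : probability Om R).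
Variable Yobs : nat -> Om -> Obs.
Hypothesis HYm : forall t, measurable_fun setT (Yobs t).

Definition obs_tuple n (w : Om) : n.-tuple Obs := [tuple Yobs i w | i < n].

Lemma measurable_obs_tuple n : measurable_fun setT (obs_tuple n).
Proof.
apply/measurable_fun_tnthP => i.
rewrite (_ : _ \o _ = Yobs i)//.
by apply/funext => w /=; rewrite tnth_mktuple.
Qed.

Variable p : forall n, n.-tuple Obs -> R.
Hypothesis mp : forall n, measurable_fun setT (@p n).
Hypothesis p0 : forall n y, 0 <= @p n y.
Hypothesis HYlaw : forall (n : nat) (B : 'I_n.+1 -> set Obs),
  (forall t, measurable (B t)) ->
  P [set w | forall t : 'I_n.+1, B t (Yobs t w)] =
  iint lam (fun y : n.+1.-tuple Obs =>
    ((\prod_(t < n.+1) (\1_(B t) (tnth y t) : R)) * p y)%:E).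

(** Both sides are finite measures agreeing on the pi-system of rectangles. Positivity of n matches
    [HYlaw], which describes n.+1 coordinates. *)
Lemma obs_lawE n (A : set (n.-tuple Obs)) : (0 < n)%N -> measurable A ->
  P (obs_tuple n @^-1` A) = iint lam (fun y => (\1_A y * p y)%:E).
Proof.
case: n A => // n A _ mA.
pose G := [set A : set (n.+1.-tuple Obs) | exists B : 'I_n.+1 -> set Obs,
    (forall t, measurable (B t)) /\ A = [set y | forall t, B t (tnth y t)]].
have mobs := @measurable_obs_tuple n.+1.
have mrect (B : 'I_n.+1 -> set Obs) : (forall t, measurable (B t)) ->
    measurable [set y : n.+1.-tuple Obs | forall t, B t (tnth y t)].
  move=> mB; rewrite measurable_tuple_rectangles; apply: sub_sigma_algebra.
  by exists B.
have E B : G B -> pushforward P (obs_tuple n.+1) B = dens_measure (@p n.+1) B.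
  move=> [C [mC ->]]; rewrite /pushforward.
  rewrite (_ : _ @^-1` _ = [set w | forall t : 'I_n.+1, C t (Yobs t w)]); last first.
    by apply/seteqP; split => w /= Cw t; have := Cw t; rewrite tnth_mktuple.
  rewrite HYlaw//; apply: eq_iint => y; congr ((_ * _)%:E).
  rewrite indicE; case: (boolP (y \in _)) => [|/negP]; rewrite inE /= => Cy.
    by rewrite big1// => t _; rewrite indicE mem_set.
  have [t Ct] : exists t, ~ C t (tnth y t) by apply/existsNP.
  by rewrite (bigD1 t)//= indicE memNset// mul0r.
apply: (measure_unique G (fun _ => setT) _ _ _ _
  (pushforward P (obs_tuple n.+1)) (densM (mp (n:=n.+1)) (p0 (n:=n.+1)))) => //.
- exact: measurable_tuple_rectangles.
- move=> _ _ [B [mB ->]] [C [mC ->]]; exists (fun t => B t `&` C t); split.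
    by move=> t; exact: measurableI.
  apply/seteqP; split => [y [By Cy] t|y BCy]; first by split.
  by split => t; have [] := BCy t.
- move=> _; exists (fun _ => setT); split => //.
  by apply/seteqP; split.
- by rewrite bigcup_const.
- move=> _; apply: le_lt_trans (ltry 1); apply: probability_le1.
  by rewrite -[X in measurable X]setTI; exact: mobs.
Qed.

End LawOfObservations.

(** * Borel-Cantelli and a dyadic sum *)

Section BorelCantelli.
Context {R : realType} {dO : measure_display} {Om : measurableType dO} (P : probability Om R).
Local Open Scope ereal_scope.

Lemma nneseries_bounded (u : nat -> \bar R) (C : R) : (forall n, 0 <= u n) ->
  (forall n, \sum_(0 <= i < n) u i <= C%:E) -> \sum_(i <oo) u i < +oo.
Proof.
move=> u0 uC; apply: (@le_lt_trans _ _ C%:E); last exact: ltry.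
apply: lime_le; first by apply: is_cvg_nneseries => *; exact: u0.
exact: nearW.
Qed.

Lemma borel_cantelli_ae (F : nat -> set Om) : (forall n, measurable (F n)) ->
  \sum_(n <oo) P (F n) < +oo ->
  {ae P, forall w, exists n0, forall n, (n0 <= n)%N -> ~ F n w}.
Proof.
move=> mF sF; exists (lim_sup_set F); split.
- by apply: bigcap_measurable => // n _; exact: bigcup_measurable.
- exact: lim_sup_set_cvg0.
- move=> w /= H n _; apply: contrapT => nF; apply: H; exists n => m nm Fm.
  by apply: nF; exists m.
Qed.

End BorelCantelli.

Section Dyadic.
Context {R : realType}.

(** Truncated second moments, summed over dyadic levels, cost only a first moment: levels above x
    contribute a geometric tail of order x, and so do the levels below x. *)
Lemma sum_dyadic_truncation (x : R) J : 0 <= x ->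
  \sum_(0 <= j < J) (Num.min x (2 ^+ j)) ^+ 2 / 2 ^+ j <= 4 * x.
Proof.
(* The induction on J halves x and needs a bound with min(x, 1)^2 + 2 B(x / 2) <= B(x); the linear
   bound 4 x itself fails this for every x > 0. *)
pose B (x : R) := if x <= 1 then 2 * x ^+ 2 else 4 * x - 1.
suff H : forall J (x : R), 0 <= x ->
    \sum_(0 <= j < J) (Num.min x (2 ^+ j)) ^+ 2 / 2 ^+ j <= B x.
  move=> x0; rewrite (le_trans (H J x x0))// /B; case: ifP => [x1|_]; nra.
move=> {x J}; elim=> [|J IH] x x0.
  rewrite big_geq// /B; case: (leP x 1) => x1; nra.
rewrite big_nat_recl//= expr0 divr1.
have -> : \sum_(0 <= i < J) Num.min x (2 ^+ i.+1) ^+ 2 / 2 ^+ i.+1 =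
  2 * \sum_(0 <= i < J) Num.min (x / 2) (2 ^+ i) ^+ 2 / 2 ^+ i.
  rewrite mulr_sumr; apply: eq_bigr => i _.
  have -> : Num.min x (2 ^+ i.+1) = 2 * Num.min (x / 2) (2 ^+ i).
    by rewrite minr_pMr// exprS mulrCA divff ?mulr1.
  have E (m c : R) : c != 0 -> (2 * m) ^+ 2 / (2 * c) = 2 * (m ^+ 2 / c) by move=> ?; field.
  by rewrite (exprS _ i) E// expf_neq0.
have x20 : 0 <= x / 2 by lra.
have := IH _ x20; set S := \sum_(_ <= _ < _) _; rewrite /B.
have -> : Num.min x 1 = if x <= 1 then x else 1 by rewrite minEle.
case: (leP x 1) => x1; case: (leP (x / 2) 1) => x2 HS; nra.
Qed.

End Dyadic.

(** * One-sided second moments along the chain *)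

Section LawOfLargeNumbers.
Context {R : realType} {d k : nat} (lam : {measure set (d.-tuple R) -> \bar R}).
Hypothesis hlam : sigma_finite setT lam.
Local Notation Obs := (d.-tuple R).
Variables (Q : 'M[R]_k) (f : 'I_k -> Obs -> R).
Hypotheses (HQ : is_trans Q) (Hf : forall j, is_density lam (f j)).
Implicit Types (v : 'rV[R]_k).

Let mf i : measurable_fun setT (f i). Proof. by have [] := Hf i. Qed.
Let f0 i y : 0 <= f i y. Proof. by have [_ []] := Hf i. Qed.
Let f1 i : (\int[lam]_y (f i y)%:E = 1)%E. Proof. by have [_ []] := Hf i. Qed.
Local Notation lik := (hmm_lik Q f).

(** Only upward deviations are measured, which suits increments whose conditional means are merely
    bounded above. *)
Definition possq (u : R) : R := (Num.max u 0) ^+ 2.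

Let measurable_possq dT (T : measurableType dT) (F : T -> R) :
  measurable_fun setT F -> measurable_fun setT (fun x => possq (F x)).
Proof. by move=> mF; apply: measurable_funX; apply: measurable_maxr. Qed.

Lemma smeas_sum (x : Obs -> R) : measurable_fun setT x ->
  smeas (fun s => \sum_(a <- s) x a).
Proof.
move=> mx n.
rewrite (_ : (fun y => _) = (fun y : n.-tuple Obs => \sum_(i < n) x (tnth y i))).
  apply: measurable_sum => i; apply: measurableT_comp => //; exact: measurable_tnth.
by apply/funext => y; rewrite big_tuple.
Qed.

(* One step of the chain: the drift [2 z (x - 1/2)] has nonpositive mean. *)
Lemma possq_step_mean (x : Obs -> R) (V z : R) i : measurable_fun setT x ->
  (forall y, 0 <= x y) ->
  (\int[lam]_y (f i y * x y)%:E <= (2^-1)%:E)%E ->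
  (\int[lam]_y (f i y * x y ^+ 2)%:E <= V%:E)%E ->
  (\int[lam]_y (f i y * possq (z + (x y - 2^-1)))%:E <= (possq z + (V + 4^-1))%:E)%E.
Proof.
move=> mx x0 xm xV; pose a := Num.max z 0.
have a0 : 0 <= a by rewrite /a le_max lexx orbT.
have pos y : 0 <= f i y * possq (z + (x y - 2^-1)) by rewrite mulr_ge0 ?sqr_ge0.
have mpos : measurable_fun setT (fun y => f i y * possq (z + (x y - 2^-1))).
  apply: measurable_funM => //; apply: measurable_possq.
  by apply: measurable_funD => //; apply: measurable_funB.
(* The pointwise bound is possq(z + x - 1/2) + a <= a^2 + 1/4 + 2 a x + x^2, with 1/4 from (x -
   1/2)^2. The drift - a is moved to the left so that every integrand is nonnegative; the mean of 2
   a x is at most a, which then cancels. *)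
have H : (\int[lam]_y (f i y * possq (z + (x y - 2^-1)))%:E + a%:E <=
   (possq z + (V + 4^-1))%:E + a%:E)%E.
  rewrite [X in (_ + X <= _)%E](_ : a%:E = (a%:E * \int[lam]_y (f i y)%:E)%E); last first.
    by rewrite f1 mule1.
  rewrite -ge0_integralZl//; first last.
  - by move=> y _; rewrite lee_fin.
  - exact/measurable_EFinP.
  rewrite -ge0_integralD//; first last.
  - by apply: measurable_funeM; apply/measurable_EFinP.
  - by move=> y _; rewrite -EFinM lee_fin mulr_ge0.
  - exact/measurable_EFinP.
  - by move=> y _; rewrite lee_fin.
  apply: (@le_trans _ _ (\int[lam]_y ((possq z + 4^-1)%:E * (f i y)%:E +
     ((2 * a)%:E * (f i y * x y)%:E + (f i y * x y ^+ 2)%:E)))%E).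
    apply: ge0_le_integral => //.
    - by move=> y _; rewrite -EFinM -EFinD lee_fin addr_ge0// mulr_ge0.
    - apply: emeasurable_funD; first exact/measurable_EFinP.
      by apply: measurable_funeM; apply/measurable_EFinP.
    - apply: emeasurable_funD; first by apply: measurable_funeM; apply/measurable_EFinP.
      apply: emeasurable_funD.
        by apply: measurable_funeM; apply/measurable_EFinP; apply: measurable_funM.
      by apply/measurable_EFinP; apply: measurable_funM => //; apply: measurable_funX.
    - move=> y _; rewrite -!EFinM -!EFinD lee_fin.
      have -> : (possq z + 4^-1) * f i y + (2 * a * (f i y * x y) + f i y * x y ^+ 2) =
                f i y * (a ^+ 2 + 4^-1 + 2 * a * x y + x y ^+ 2) by rewrite /possq -/a; ring.
      rewrite [a * _]mulrC -mulrDr ler_wpM2l//.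
      have xy := x0 y; rewrite /possq.
      have az : z <= a by rewrite /a le_max lexx.
      case: (leP (z + (x y - 2^-1)) 0) => h.
        by have := sqr_ge0 (a - 2^-1); nra.
      have : (z + (x y - 2^-1)) ^+ 2 <= (a + (x y - 2^-1)) ^+ 2.
        by rewrite ler_sqr ?nnegrE; lra.
      nra.
  rewrite ge0_integralD//; first last.
  - apply: emeasurable_funD.
      by apply: measurable_funeM; apply/measurable_EFinP; apply: measurable_funM.
    by apply/measurable_EFinP; apply: measurable_funM => //; apply: measurable_funX.
  - by move=> y _; rewrite -EFinM -EFinD lee_fin addr_ge0// mulr_ge0// ?mulr_ge0// sqr_ge0.
  - by apply: measurable_funeM; apply/measurable_EFinP.
  - by move=> y _; rewrite -EFinM lee_fin mulr_ge0// addr_ge0// sqr_ge0.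
  rewrite ge0_integralD//; first last.
  - by apply/measurable_EFinP; apply: measurable_funM => //; apply: measurable_funX.
  - by move=> y _; rewrite lee_fin mulr_ge0// sqr_ge0.
  - by apply: measurable_funeM; apply/measurable_EFinP; apply: measurable_funM.
  - by move=> y _; rewrite -EFinM lee_fin mulr_ge0// mulr_ge0.
  rewrite ge0_integralZl//; first last.
  - by rewrite lee_fin addr_ge0// sqr_ge0.
  - by move=> y _; rewrite lee_fin.
  - exact/measurable_EFinP.
  rewrite ge0_integralZl//; first last.
  - by rewrite lee_fin mulr_ge0.
  - by move=> y _; rewrite lee_fin mulr_ge0.
  - by apply/measurable_EFinP; apply: measurable_funM.
  rewrite f1 mule1 -EFinD.
  apply: (@le_trans _ _ ((possq z + 4^-1)%:E + ((2 * a)%:E * (2^-1)%:E + V%:E))%E).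
    apply: leeD => //; apply: leeD => //.
    by apply: lee_wpmul2l => //; rewrite lee_fin mulr_ge0.
  by rewrite -EFinM -!EFinD lee_fin; lra.
by rewrite leeD2rE in H.
Qed.

(** The first increment is absorbed into z, which stands for the sum already seen; each step adds at
    most V + 1/4 whatever the current hidden state. *)
Lemma possq_second_moment (x : Obs -> R) (V : R) : measurable_fun setT x ->
  (forall y, 0 <= x y) -> 0 <= V ->
  (forall i, \int[lam]_y (f i y * x y)%:E <= (2^-1)%:E)%E ->
  (forall i, \int[lam]_y (f i y * x y ^+ 2)%:E <= V%:E)%E ->
  forall n v z, nneg_row v ->
  (iint lam (fun s : n.-tuple Obs =>
      (possq (z + \sum_(a <- s) (x a - 2^-1)) * lik v s)%:E)
   <= ((possq z + n%:R * (V + 4^-1)) * \sum_i v 0 i)%:E)%E.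
Proof.
move=> mx x0 V0 xm xV; set W := V + 4^-1; have W0 : 0 <= W by rewrite /W; lra.
have mS n z v : measurable_fun setT (fun s : n.-tuple Obs =>
      (possq (z + \sum_(a <- s) (x a - 2^-1)) * lik v s)%:E).
  apply/measurable_EFinP; apply: measurable_funM; last exact: smeas_hmm_lik.
  apply: measurable_possq; apply: measurable_funD => //.
  by apply: (smeas_sum (x := fun a => x a - 2^-1)); apply: measurable_funB.
have S0 n z v (s : n.-tuple Obs) : nneg_row v ->
   (0 <= (possq (z + \sum_(a <- s) (x a - 2^-1)) * lik v s)%:E)%E.
  by move=> v0; rewrite lee_fin mulr_ge0 ?sqr_ge0// hmm_lik_ge0.
elim=> [|n IH] v z v0.
  by rewrite /= big_nil addr0 mul0r addr0.
rewrite /=.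
apply: (@le_trans _ _ (\int[lam]_y \sum_i (v 0 i)%:E *
    ((f i y * possq (z + (x y - 2^-1)))%:E + (n%:R * W)%:E * (f i y)%:E))%E).
  apply: ge0_le_integral => //.
  - by move=> y _; apply: iint_ge0 => t; exact: (S0 n.+1 z v [tuple of y :: t]).
  - by apply: (measurable_iint_cons hlam (mS n.+1 z v)) => y; exact: S0.
  - apply: emeasurable_sum => i; apply: measurable_funeM; apply: emeasurable_funD.
      apply/measurable_EFinP; apply: measurable_funM => //; apply: measurable_possq.
      by apply: measurable_funD => //; apply: measurable_funB.
    by apply: measurable_funeM; exact/measurable_EFinP.
  - move=> y _; under eq_iint do rewrite big_cons addrA.
    apply: le_trans (IH (hmm_step Q f v y) _ _) _; first exact: hmm_step_ge0.
    rewrite sum_hmm_step//.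
    have E i : ((v 0 i)%:E * ((f i y * possq (z + (x y - 2^-1)))%:E +
        (n%:R * W)%:E * (f i y)%:E))%E =
        (v 0 i * (f i y * possq (z + (x y - 2^-1)) + n%:R * W * f i y))%:E by [].
    under [X in (_ <= X)%E]eq_bigr do rewrite E.
    rewrite sumEFin lee_fin mulr_sumr le_eqVlt; apply/orP; left; apply/eqP.
    by apply: eq_bigr => i _; ring.
rewrite ge0_integral_sum//; first last.
- move=> i y _; apply: mule_ge0; first by rewrite lee_fin.
  by apply: adde_ge0; [rewrite lee_fin mulr_ge0 ?sqr_ge0|rewrite -EFinM lee_fin !mulr_ge0].
- move=> i; apply: measurable_funeM; apply: emeasurable_funD.
    apply/measurable_EFinP; apply: measurable_funM => //; apply: measurable_possq.
    by apply: measurable_funD => //; apply: measurable_funB.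
  by apply: measurable_funeM; exact/measurable_EFinP.
rewrite mulr_sumr -sumEFin; apply: lee_sum => i _.
have mp : measurable_fun setT (fun y => (f i y * possq (z + (x y - 2^-1)))%:E).
  apply/measurable_EFinP; apply: measurable_funM => //; apply: measurable_possq.
  by apply: measurable_funD => //; apply: measurable_funB.
have p0 y : (0 <= (f i y * possq (z + (x y - 2^-1)))%:E)%E.
  by rewrite lee_fin mulr_ge0 ?sqr_ge0.
rewrite ge0_integralZl//; first last.
- by rewrite lee_fin.
- by move=> y _; rewrite adde_ge0// -EFinM lee_fin !mulr_ge0.
- by apply: emeasurable_funD => //; apply: measurable_funeM; exact/measurable_EFinP.
rewrite [X in (_ <= X%:E)%E]mulrC [X in (_ <= X)%E]EFinM.
apply: lee_wpmul2l; first by rewrite lee_fin.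
rewrite ge0_integralD//; first last.
- by apply: measurable_funeM; exact/measurable_EFinP.
- by move=> y _; rewrite -EFinM lee_fin !mulr_ge0.
rewrite ge0_integralZl//; first last.
- by rewrite lee_fin mulr_ge0.
- by move=> y _; rewrite lee_fin.
- exact/measurable_EFinP.
rewrite f1 mule1.
apply: (@le_trans _ _ ((possq z + W)%:E + (n%:R * W)%:E)%E).
  by apply: leeD => //; exact: possq_step_mean.
by rewrite -EFinD lee_fin -natr1; lra.
Qed.

End LawOfLargeNumbers.

(** * Truncation of extended-real functions *)

Section Truncation.
Context {R : realType}.
Implicit Types (K : R) (e : \bar R).

(** Real-valued even where e is +oo, as a log-ratio is where f_j vanishes and f*_j does not. *)
Definition etrunc K e : R := fine (mine e K%:E).

Lemma etrunc_ge0 K e : 0 <= K -> (0 <= e)%E -> 0 <= etrunc K e.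
Proof. by move=> K0 e0; apply: fine_ge0; rewrite le_min e0 lee_fin. Qed.

Lemma etruncE K e : (0 <= e)%E -> (etrunc K e)%:E = mine e K%:E.
Proof.
case: e => [r| |] r0 //.
by rewrite /etrunc -EFin_min.
Qed.

Lemma etrunc_le K e : (0 <= e)%E -> ((etrunc K e)%:E <= e)%E.
Proof. by move=> e0; rewrite etruncE// ge_min lexx. Qed.

Lemma etrunc_leK K e : (0 <= e)%E -> etrunc K e <= K.
Proof. by move=> e0; rewrite -lee_fin etruncE// ge_min lexx orbT. Qed.

(** Either no term exceeds K and truncation changes nothing, or a single truncated term already
    reaches K. So the event that the sum reaches K survives truncation at the same level, without a
    separate bound for large terms. *)
Lemma etrunc_sum (T : Type) (s : seq T) (g : T -> \bar R) K : 0 <= K ->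
  (forall a, 0 <= g a)%E -> (K%:E <= \sum_(a <- s) g a)%E ->
  K <= \sum_(a <- s) etrunc K (g a).
Proof.
move=> K0 g0 Ks.
have H : (\sum_(a <- s) g a <= \sum_(a <- s) (etrunc K (g a))%:E)%E \/
    K <= \sum_(a <- s) etrunc K (g a).
  elim: s {Ks} => [|a s [IH|IH]]; first by left; rewrite !big_nil.
  - rewrite !big_cons; have [ga|ga] := leP (g a) K%:E.
      by left; apply: leeD => //; rewrite etruncE// min_l.
    right; rewrite -[K in K <= _]addr0; apply: lerD.
      by rewrite -lee_fin etruncE// min_r// ltW.
    by apply: sumr_ge0 => b _; exact: etrunc_ge0.
  - by right; rewrite big_cons (le_trans IH)// lerDr etrunc_ge0.
case: H => // H; rewrite -lee_fin (le_trans Ks)// (le_trans H)//.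
by rewrite sumEFin.
Qed.

Lemma sum_dyadic_etrunc e J : (0 <= e)%E ->
  (\sum_(0 <= j < J) ((etrunc (2 ^+ j) e) ^+ 2 / 2 ^+ j)%:E <= 4%:E * e)%E.
Proof.
case: e => [r| |] r0 //; last by rewrite gt0_muley ?leey// lte_fin.
under eq_bigr do rewrite /etrunc -EFin_min /=.
rewrite sumEFin -EFinM lee_fin; exact: sum_dyadic_truncation.
Qed.

Lemma measurable_etrunc dT (T : measurableType dT) K (g : T -> \bar R) :
  measurable_fun setT g -> measurable_fun setT (fun x => etrunc K (g x)).
Proof.
move=> mg; apply: (measurableT_comp (f := @fine R)) => //.
by apply: measurable_mine.
Qed.

End Truncation.

(** * An almost sure upper bound for sums of a function with small conditional means *)

Section LawOfLargeNumbers.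
Context {R : realType} {d k : nat} (lam : {measure set (d.-tuple R) -> \bar R}).
Hypothesis hlam : sigma_finite setT lam.
Local Notation Obs := (d.-tuple R).
Variables (Q : 'M[R]_k) (f : 'I_k -> Obs -> R).
Hypotheses (HQ : is_trans Q) (Hf : forall j, is_density lam (f j)).
Variable v : 'rV[R]_k.
Hypothesis Hv : is_dist v.

Let mf i : measurable_fun setT (f i). Proof. by have [] := Hf i. Qed.
Let f0 i y : 0 <= f i y. Proof. by have [_ []] := Hf i. Qed.
Let f1 i : (\int[lam]_y (f i y)%:E = 1)%E. Proof. by have [_ []] := Hf i. Qed.
Local Notation lik := (hmm_lik Q f).

Context {dO : measure_display} {Om : measurableType dO} (P : probability Om R).
Variable Yobs : nat -> Om -> Obs.
Hypothesis HYm : forall t, measurable_fun setT (Yobs t).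
Hypothesis Hlaw : forall n (A : set (n.-tuple Obs)), (0 < n)%N -> measurable A ->
  P (obs_tuple Yobs n @^-1` A) = iint lam (fun y => (\1_A y * lik v y)%:E).

Variable g : Obs -> \bar R.
Hypotheses (mg : measurable_fun setT g) (g0 : forall y, (0 <= g y)%E).
Hypothesis gmean : forall i, (\int[lam]_y ((f i y)%:E * g y) <= (2^-1)%:E)%E.

Let I i K : \bar R := (\int[lam]_y (f i y * etrunc K (g y) ^+ 2)%:E)%E.

Let mtr K : measurable_fun setT (fun y => etrunc K (g y)).
Proof. exact: measurable_etrunc. Qed.

Let mI i K : measurable_fun setT (fun y => (f i y * etrunc K (g y) ^+ 2)%:E).
Proof. by apply/measurable_EFinP; apply: measurable_funM => //; apply: measurable_funX. Qed.

Let I_ge0 i K : (0 <= I i K)%E.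
Proof. by apply: integral_ge0 => y _; rewrite lee_fin mulr_ge0// sqr_ge0. Qed.

Let I_fin i K : 0 <= K -> (I i K \is a fin_num).
Proof.
move=> K0; rewrite ge0_fin_numE//; apply: (@le_lt_trans _ _ ((K ^+ 2)%:E * \int[lam]_y (f i y)%:E)%E).
  rewrite -ge0_integralZl//; first last.
  - by rewrite lee_fin sqr_ge0.
  - by move=> y _; rewrite lee_fin.
  - exact/measurable_EFinP.
  apply: ge0_le_integral => //.
  - by move=> y _; rewrite lee_fin mulr_ge0// sqr_ge0.
  - by apply: measurable_funeM; exact/measurable_EFinP.
  - move=> y _; rewrite -EFinM lee_fin mulrC ler_wpM2r// ler_sqr ?nnegrE//.
      exact: etrunc_leK.
    exact: etrunc_ge0.
by rewrite f1 mule1 ltry.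
Qed.

Let bad j : set Om :=
  obs_tuple Yobs (2 ^ j) @^-1` [set y | ((2 ^+ j)%:E <= \sum_(a <- y) g a)%E].

Let mbadset j : measurable [set y : (2 ^ j).-tuple Obs | ((2 ^+ j)%:E <= \sum_(a <- y) g a)%E].
Proof.
apply: measurable_lee_set => //.
rewrite (_ : (fun y => _) = (fun y : (2 ^ j).-tuple Obs => \sum_(i < 2 ^ j) g (tnth y i))%E).
  apply: emeasurable_sum => i; apply: measurableT_comp => //; exact: measurable_tnth.
by apply/funext => y; rewrite big_tuple.
Qed.

(** With K = 2^j, the truncated sum centred at K / 2 is at least K / 2 on the event, so Chebyshev
    gives 4 / K^2 times the second moment K (V + 1/4), where V sums the truncated second moments
    over the states. *)
Let Pbad j : (P (bad j) <= \sum_i (4 / 2 ^+ j)%:E * I i (2 ^+ j) + (1 / 2 ^+ j)%:E)%E.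
Proof.
have [v0 v1] := Hv.
rewrite Hlaw ?expn_gt0//; last exact: mbadset.
set K : R := 2 ^+ j.
have K0 : 0 < K by rewrite exprn_gt0.
pose x y := etrunc K (g y); pose V : R := \sum_i fine (I i K).
have x0 y : 0 <= x y by apply: etrunc_ge0 => //; exact: ltW.
have V0 : 0 <= V by apply: sumr_ge0 => i _; apply: fine_ge0.
have xm i : (\int[lam]_y (f i y * x y)%:E <= (2^-1)%:E)%E.
  apply: le_trans (gmean i); apply: ge0_le_integral => //.
  - by move=> y _; rewrite lee_fin mulr_ge0.
  - by apply/measurable_EFinP; apply: measurable_funM => //; exact: mtr.
  - by apply: emeasurable_funM => //; exact/measurable_EFinP.
  - by move=> y _; rewrite EFinM; apply: lee_wpmul2l; [rewrite lee_fin|exact: etrunc_le].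
have xV i : (\int[lam]_y (f i y * x y ^+ 2)%:E <= V%:E)%E.
  rewrite -[X in (X <= _)%E](fineK (I_fin i (ltW K0))) lee_fin /V (bigD1 i)//= lerDl.
  by apply: sumr_ge0 => i' _; apply: fine_ge0.
have HM := @possq_second_moment _ _ _ _ hlam _ _ HQ Hf x V (mtr K) x0 V0 xm xV (2 ^ j) v 0 v0.
have mS : measurable_fun setT (fun s : (2 ^ j).-tuple Obs =>
    (possq (0 + \sum_(a <- s) (x a - 2^-1)) * lik v s)%:E).
  apply/measurable_EFinP; apply: measurable_funM; last exact: smeas_hmm_lik.
  apply: measurable_funX; apply: measurable_maxr => //; apply: measurable_funD => //.
  by apply: (smeas_sum (x := fun a => x a - 2^-1)); apply: measurable_funB => //; exact: mtr.
apply: (@le_trans _ _ ((4 / K ^+ 2)%:E * iint lam (fun s : (2 ^ j).-tuple Obs =>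
    (possq (0 + \sum_(a <- s) (x a - 2^-1)) * lik v s)%:E))%E).
  rewrite -iintZl//; first last.
  - by move=> y; rewrite lee_fin mulr_ge0 ?sqr_ge0// hmm_lik_ge0.
  - by rewrite lee_fin divr_ge0// exprn_ge0// ltW.
  apply: le_iint => //.
  - apply/measurable_EFinP; apply: measurable_funM; last exact: smeas_hmm_lik.
    by apply: measurable_indic; exact: mbadset.
  - exact: measurable_funeM.
  - by move=> y; rewrite lee_fin mulr_ge0// hmm_lik_ge0.
  - move=> y; rewrite -EFinM lee_fin mulrA; apply: ler_wpM2r; first exact: hmm_lik_ge0.
    rewrite indicE; case: (boolP (y \in _)) => [|_]; last first.
      by rewrite mulr_ge0 ?sqr_ge0// divr_ge0// exprn_ge0// ltW.
    rewrite inE /= => Ky; have := etrunc_sum (ltW K0) g0 Ky => Kx.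
    rewrite add0r big_split /= big_const_seq count_predT size_tuple iter_addr_0.
    have E : K = 2 ^+ j by [].
    rewrite -[- 2^-1 *+ _]mulr_natr natrX -/K.
    have h : K / 2 <= \sum_(a <- y) x a + - 2^-1 * K by rewrite /x; lra.
    rewrite /possq; have -> : Num.max (\sum_(a <- y) x a + - 2^-1 * K) 0 =
       \sum_(a <- y) x a + - 2^-1 * K by rewrite max_l//; lra.
    rewrite -(ler_pM2l (_ : 0 < K ^+ 2)) ?exprn_gt0// mulr1 mulrA.
    rewrite (_ : K ^+ 2 * (4 / K ^+ 2) = 4); last by field; rewrite gt_eqF.
    have : (K / 2) ^+ 2 <= (\sum_(a <- y) x a + - 2^-1 * K) ^+ 2.
      by rewrite ler_sqr ?nnegrE//; lra.
    lra.
apply: (@le_trans _ _ ((4 / K ^+ 2)%:E * ((possq 0 + (2 ^ j)%:R * (V + 4^-1)) * \sum_i v 0 i)%:E)%E).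
  by apply: lee_wpmul2l => //; rewrite lee_fin divr_ge0// exprn_ge0// ltW.
have -> : (\sum_i (4 / K)%:E * I i K)%E = ((4 / K) * V)%:E.
  rewrite /V mulr_sumr -sumEFin; apply: eq_bigr => i _.
  by rewrite [in RHS]EFinM fineK// I_fin// ltW.
rewrite -EFinM -EFinD lee_fin v1 mulr1 natrX -/K /possq maxxx expr0n /= add0r.
rewrite le_eqVlt; apply/orP; left; apply/eqP; field; by rewrite gt_eqF.
Qed.

Let sum_bad : (\sum_(j <oo) P (bad j) < +oo)%E.
Proof.
have c0 j : 0 <= 4 / 2 ^+ j :> R by rewrite divr_ge0// exprn_ge0.
(* For each state the weight 4, the factor 4 of the dyadic sum and the mean 1/2 give 8; the terms 1
   / 2^j sum to at most 2. *)
apply: (@nneseries_bounded _ _ (8 * k%:R + 2)) => // J.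
apply: (@le_trans _ _ (\sum_(0 <= j < J) (\sum_i (4 / 2 ^+ j)%:E * I i (2 ^+ j) + (1 / 2 ^+ j)%:E))%E).
  by apply: lee_sum => j _; exact: Pbad.
rewrite big_split /= EFinD; apply: leeD.
  rewrite exchange_big /=.
  apply: (@le_trans _ _ (\sum_(i < k) 8%:E)%E); last first.
    by rewrite sumEFin sumr_const card_ord mulr_natr.
  apply: lee_sum => i _.
  have -> : (\sum_(0 <= j < J) (4 / 2 ^+ j)%:E * I i (2 ^+ j) =
    \int[lam]_y \sum_(0 <= j < J) (4 / 2 ^+ j)%:E * (f i y * etrunc (2 ^+ j) (g y) ^+ 2)%:E)%E.
    rewrite ge0_integral_sum//; first last.
    - by move=> j y _; rewrite -EFinM lee_fin mulr_ge0// mulr_ge0// sqr_ge0.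
    - by move=> j; apply: measurable_funeM.
    apply: eq_bigr => j _; rewrite ge0_integralZl//.
    by move=> y _; rewrite lee_fin mulr_ge0 ?sqr_ge0.
  apply: (@le_trans _ _ (16%:E * \int[lam]_y ((f i y)%:E * g y))%E); last first.
    apply: (@le_trans _ _ (16%:E * (2^-1)%:E)%E); first exact: lee_wpmul2l.
    by rewrite -EFinM lee_fin; lra.
  rewrite -ge0_integralZl//; first last.
  - by move=> y _; rewrite mule_ge0// lee_fin.
  - by apply: emeasurable_funM => //; exact/measurable_EFinP.
  apply: ge0_le_integral => //.
  - by move=> y _; apply: sume_ge0 => j _; rewrite -EFinM lee_fin mulr_ge0// mulr_ge0// sqr_ge0.
  - by apply: emeasurable_sum => j; apply: measurable_funeM.
  - by apply: measurable_funeM; apply: emeasurable_funM => //; exact/measurable_EFinP.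
  - move=> y _.
    have -> : (\sum_(0 <= j < J) (4 / 2 ^+ j)%:E * (f i y * etrunc (2 ^+ j) (g y) ^+ 2)%:E =
      (4 * f i y)%:E * \sum_(0 <= j < J) ((etrunc (2 ^+ j) (g y)) ^+ 2 / 2 ^+ j)%:E)%E.
      rewrite !sumEFin -EFinM mulr_sumr; congr EFin; apply: eq_bigr => j _.
      by field; rewrite expf_neq0.
    apply: (@le_trans _ _ ((4 * f i y)%:E * (4%:E * g y))%E).
      by apply: lee_wpmul2l; [rewrite lee_fin mulr_ge0|exact: sum_dyadic_etrunc].
    by rewrite !muleA -!EFinM mulrAC -natrM.
rewrite sumEFin lee_fin.
have H : forall J, \sum_(0 <= j < J) (1 / 2 ^+ j : R) = 2 - 2 / 2 ^+ J.
  elim=> [|n IH]; first by rewrite big_geq// expr0; lra.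
  by rewrite big_nat_recr//= IH exprS; field; rewrite expf_neq0.
by rewrite H lerBlDr lerDl divr_ge0// exprn_ge0.
Qed.

(** The terms are nonnegative, so dyadic times suffice: for n <= 2^j <= 2 n the sum up to n is at
    most the sum up to 2^j, which is eventually below 2^j. *)
Lemma lln_upper_bound : {ae P, forall w, exists n0, forall n, (n0 <= n)%N ->
  (\sum_(t < n) g (Yobs t w) <= (2 * n%:R)%:E)%E}.
Proof.
have mbad j : measurable (bad j).
  rewrite -[bad j]setTI; by apply: (measurable_obs_tuple HYm (n:=2 ^ j)) => //; exact: mbadset.
have [N [mN N0 HN]] := borel_cantelli_ae mbad sum_bad.
exists N; split => // w /= H; apply: HN => -[j0 Hj]; apply: H.
exists (2 ^ j0)%N => n jn.
have n0 : (0 < n)%N by rewrite (leq_trans _ jn)// expn_gt0.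
pose j := up_log 2 n.
have nj : (n <= 2 ^ j)%N by exact: up_logP.
have jn2 : (2 ^ j <= 2 * n)%N.
  have [n1|n1] := eqVneq n 1%N; first by rewrite /j n1.
  have := @up_log_bounds 2 n; rewrite -/j => /(_ isT) H.
  have {H} : (2 ^ j.-1 < n <= 2 ^ j)%N by apply: H; lia.
  have j0' : (0 < j)%N by rewrite up_log_gt0; lia.
  by move=> /andP[h _]; rewrite -(prednK j0') expnS leq_mul2l ltnW.
have j0j : (j0 <= j)%N by rewrite -(leq_exp2l (m:=2))// (leq_trans jn nj).
have /negP := Hj j j0j; rewrite /bad /= -ltNge => hj.
apply: (@le_trans _ _ (\sum_(t < 2 ^ j) g (Yobs t w))%E).
  rewrite -(big_mkord predT (fun t => g (Yobs t w))) -(big_mkord predT (fun t => g (Yobs t w))).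
  by apply: lee_sum_nneg_natr => // i _ _; exact: g0.
have -> : (\sum_(t < 2 ^ j) g (Yobs t w) = \sum_(a <- obs_tuple Yobs (2 ^ j) w) g a)%E.
  by rewrite big_tuple; apply: eq_bigr => i _; rewrite tnth_mktuple.
rewrite (le_trans (ltW hj))// lee_fin -natrX -natrM ler_nat//.
Qed.

End LawOfLargeNumbers.

(** * Log-ratios and the mean of their positive part *)

Section LogRatio.
Context {R : realType} {d k : nat} (lam : {measure set (d.-tuple R) -> \bar R}).
Local Notation Obs := (d.-tuple R).
Implicit Types (fs f : 'I_k -> Obs -> R).

Definition max_logratio fs f (y : Obs) : \bar R :=
  (\big[maxe/-oo]_(j < k) elogratio (fs j y) (f j y))%E.

(** It does not depend on the state, so one exponential factor per observation dominates every
    hidden path at once. *)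
Definition pos_logratio fs f (y : Obs) : \bar R := maxe 0%E (max_logratio fs f y).

Lemma elogratio_le_max fs f y j : (elogratio (fs j y) (f j y) <= max_logratio fs f y)%E.
Proof. exact: (le_bigmax _ (fun j => elogratio (fs j y) (f j y))). Qed.

Lemma pos_logratio_ge0 fs f y : (0 <= pos_logratio fs f y)%E.
Proof. by rewrite le_max lexx. Qed.

Lemma measurable_elogratio dT (T : measurableType dT) (a b : T -> R) :
  measurable_fun setT a -> measurable_fun setT b ->
  (forall x, 0 <= a x) -> (forall x, 0 <= b x) ->
  measurable_fun setT (fun x => elogratio (a x) (b x)).
Proof.
move=> ma mb a0 b0.
rewrite (_ : (fun x => _) = fun x => if a x == 0 then -oo%E
   else if b x == 0 then +oo%E else (ln (a x) - ln (b x))%:E).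
  apply: measurable_fun_ifT => //; first exact: measurable_fun_eqr.
  apply: measurable_fun_ifT => //; first exact: measurable_fun_eqr.
  apply/measurable_EFinP; apply: measurable_funB; exact: measurableT_comp.
apply/funext => x; rewrite /elogratio; case: eqVneq => // ax; case: eqVneq => // bx.
by rewrite ln_div// posrE lt_neqAle eq_sym ?ax ?bx ?a0 ?b0.
Qed.

Lemma measurable_max_logratio dT (T : measurableType dT) fs (f : T -> 'I_k -> Obs -> R) :
  (forall j, measurable_fun setT (fs j)) -> (forall j y, 0 <= fs j y) ->
  (forall j, measurable_fun setT (fun p : T * Obs => f p.1 j p.2)) ->
  (forall t j y, 0 <= f t j y) ->
  measurable_fun setT (fun p : T * Obs => max_logratio fs (f p.1) p.2).
Proof.
move=> mfs fs0 mf f0; rewrite /max_logratio.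
elim: (index_enum _) => [|j r IH].
  under eq_fun do rewrite big_nil.
  exact: measurable_cst.
under eq_fun do rewrite big_cons.
apply: measurable_maxe => //; apply: measurable_elogratio => //.
exact: (measurableT_comp (mfs j)).
Qed.

Lemma expR_ge_quad (s : R) : 0 <= s -> 1 + s + s ^+ 2 / 4 <= expR s.
Proof.
move=> s0; have -> : 1 + s + s ^+ 2 / 4 = (1 + s / 2) ^+ 2 by field.
have -> : expR s = expR (s / 2) ^+ 2 by rewrite -expRM_natl; congr expR; field.
rewrite ler_sqr ?nnegrE ?expR_ge0//; first exact: expR_ge1Dx.
lra.
Qed.

(** Here a = f*_i(y), b = f_i(y) and r is the maximal log-ratio, so a exp(- r) <= b. The first claim
    follows from 1 - r <= exp(- r). For r < 0 the second uses 1 - r + r^2 / 4 <= exp(- r) and (eta +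
    r / 2)^2 >= 0; integrated, it bounds 1 + eta times the negative part by eta^2 plus the positive
    part. *)
Lemma logratio_pointwise (a b eta : R) (r : \bar R) : 0 <= a -> 0 <= b -> 0 < eta ->
  (elogratio a b <= r)%E ->
  [/\ (maxe (- (a%:E * r)) 0 <= b%:E)%E,
      ((1 + eta)%:E * maxe (- (a%:E * r)) 0 + a%:E <=
        (a * eta ^+ 2)%:E + (a%:E * maxe 0 r) + b%:E)%E &
      (maxe (a%:E * r) 0 = a%:E * maxe 0 r)%E].
Proof.
move=> a0 b0 eta0; rewrite /elogratio; case: eqVneq => [->|an].
  by rewrite !mul0e oppe0 maxxx mule0 mul0r !adde0 add0e lee_fin b0.
have {an}a0 : 0 < a by rewrite lt_neqAle eq_sym an.
case: eqVneq => [->|bn].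
  rewrite leye_eq => /eqP ->.
  rewrite maxey gt0_muley ?lte_fin// max_r// ?leNye// mule0 add0e maxye.
  by split; rewrite ?lee_fin//; rewrite addey// ?leey.
have {bn}b0 : 0 < b by rewrite lt_neqAle eq_sym bn.
case: r => [r| |]; [|move=> H|by rewrite leeNy_eq]; last first.
  rewrite maxey gt0_muley ?lte_fin// max_r// ?leNye// mule0 add0e maxye.
  by split; rewrite ?lee_fin ?(ltW b0)//; rewrite addey// ?leey.
rewrite lee_fin => Lr.
have ab : a <= b * expR r.
  by rewrite -ler_pdivrMl// mulrC -ler_ln ?posrE ?divr_gt0 ?expR_gt0// expRK.
rewrite -EFinM -EFinN -!EFin_max -EFinM; split; last first.
- congr EFin; rewrite maxC; case: (leP r 0) => h.
    by rewrite mulr0 max_l// pmulr_rle0.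
  by rewrite max_r// mulr_ge0 ?ltW.
- rewrite -EFinM -!EFinD lee_fin; case: (leP 0 r) => h.
    rewrite (_ : Num.max (- (a * r)) 0 = 0); last by rewrite max_r// oppr_le0 mulr_ge0// ltW.
    have : a * (1 - r) <= b.
      rewrite (le_trans _ (_ : a * expR (- r) <= b))//.
        by apply: ler_wpM2l; [exact: ltW|exact: expR_ge1Dx].
      by rewrite expRN ler_pdivrMr ?expR_gt0.
    by have := sqr_ge0 eta; nra.
  rewrite (_ : Num.max (- (a * r)) 0 = - (a * r)); last first.
    by rewrite max_l// oppr_ge0 pmulr_rle0// ltW.
  have : a * (1 - r + r ^+ 2 / 4) <= b.
    rewrite (le_trans _ (_ : a * expR (- r) <= b))//.
      apply: ler_wpM2l; first exact: ltW.
      by rewrite -sqrrN; apply: expR_ge_quad; lra.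
    by rewrite expRN ler_pdivrMr ?expR_gt0.
  by have := sqr_ge0 (eta + r / 2); nra.
- rewrite lee_fin ge_max (ltW b0) andbT.
  have : a * (1 - r) <= b.
    rewrite (le_trans _ (_ : a * expR (- r) <= b))//.
      by apply: ler_wpM2l; [exact: ltW|exact: expR_ge1Dx].
    by rewrite expRN ler_pdivrMr ?expR_gt0.
  nra.
Qed.

(* Bounds the positive part of the log-ratio although (A1b) only controls its
   signed integral: Jensen-type cancellation makes the negative part small too. *)
Lemma pos_logratio_mean fs f (eta : R) i :
  (forall j, is_density lam (fs j)) -> (forall j, is_density lam (f j)) ->
  0 < eta <= 1 ->
  (\int[lam]_y ((fs i y)%:E * max_logratio fs f y) < (eta ^+ 2)%:E)%E ->
  (\int[lam]_y ((fs i y)%:E * pos_logratio fs f y) <= (3 * eta)%:E)%E.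
Proof.
move=> Hfs Hf /andP[eta0 eta1] HF.
have mfs j : measurable_fun setT (fs j) by have [] := Hfs j.
have mf j : measurable_fun setT (f j) by have [] := Hf j.
have fs0 j y : 0 <= fs j y by have [_ []] := Hfs j.
have f0 j y : 0 <= f j y by have [_ []] := Hf j.
pose F y := ((fs i y)%:E * max_logratio fs f y)%E.
have mlr : measurable_fun setT (max_logratio fs f).
  have H := @measurable_max_logratio _ unit fs (fun _ => f) mfs fs0 _ (fun _ => f0).
  have {}H := H (fun j => measurableT_comp (mf j) measurable_snd).
  exact: (measurableT_comp H (measurable_pair1 tt)).
have mF : measurable_fun setT F.
  by apply: emeasurable_funM => //; exact/measurable_EFinP.
have pw y := logratio_pointwise (fs0 i y) (f0 i y) eta0 (elogratio_le_max fs f y i).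
have FpE : (\int[lam]_y ((fs i y)%:E * pos_logratio fs f y) = \int[lam]_y (F^\+ y))%E.
  by apply: eq_integral => y _; rewrite funeposE; have [_ _ ->] := pw y.
have f1 : (\int[lam]_y (f i y)%:E = 1)%E by have [_ []] := Hf i.
have fs1 : (\int[lam]_y (fs i y)%:E = 1)%E by have [_ []] := Hfs i.
have mFp : measurable_fun setT (F^\+)%E by exact: measurable_funepos.
have mFn : measurable_fun setT (F^\-)%E by exact: measurable_funeneg.
(* Finiteness of the negative part allows [HF], a bound on a difference of two integrals, to be
   rearranged. *)
have Fn1 : (\int[lam]_y (F^\- y) <= 1)%E.
  rewrite -f1; apply: ge0_le_integral => //.
  - exact/measurable_EFinP.
  - by move=> y _; rewrite funenegE; have [] := pw y.
have Fn0 : (0 <= \int[lam]_y (F^\- y))%E by exact: integral_ge0.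
have Fp0 : (0 <= \int[lam]_y (F^\+ y))%E by exact: integral_ge0.
(* Let m and p be the integrals of the negative and positive parts. The unit masses cancel, leaving
   (1 + eta) m <= eta^2 + p. With p < eta^2 + m from [HF] this yields m <= 2 eta, hence p <= 3 eta
   as eta <= 1. *)
have I1 : ((1 + eta)%:E * \int[lam]_y (F^\- y) + \int[lam]_y (fs i y)%:E <=
   (eta ^+ 2)%:E * \int[lam]_y (fs i y)%:E + \int[lam]_y (F^\+ y) + \int[lam]_y (f i y)%:E)%E.
  have efs : measurable_fun setT (fun y => (fs i y)%:E) by exact/measurable_EFinP.
  have ef : measurable_fun setT (fun y => (f i y)%:E) by exact/measurable_EFinP.
  have efs0 y : (0 <= (fs i y)%:E)%E by rewrite lee_fin.
  have ef0 y : (0 <= (f i y)%:E)%E by rewrite lee_fin.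
  have c1 : (0 <= (1 + eta)%:E)%E by rewrite lee_fin; lra.
  have c2 : (0 <= (eta ^+ 2)%:E)%E by rewrite lee_fin sqr_ge0.
  have n0 y : (0 <= (1 + eta)%:E * F^\- y)%E by exact: mule_ge0.
  have p0 y : (0 <= (eta ^+ 2)%:E * (fs i y)%:E)%E by exact: mule_ge0.
  have mn : measurable_fun setT (fun y => ((1 + eta)%:E * F^\- y)%E) by exact: measurable_funeM.
  have mp : measurable_fun setT (fun y => ((eta ^+ 2)%:E * (fs i y)%:E)%E) by exact: measurable_funeM.
  rewrite -ge0_integralZl// -[X in (_ <= X + _ + _)%E]ge0_integralZl//.
  rewrite -ge0_integralD// -[X in (_ <= X + _)%E]ge0_integralD//.
  have q0 y : (0 <= (eta ^+ 2)%:E * (fs i y)%:E + F^\+ y)%E by exact: adde_ge0.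
  have mq : measurable_fun setT (fun y => ((eta ^+ 2)%:E * (fs i y)%:E + F^\+ y)%E) by exact: emeasurable_funD.
  rewrite -[X in (_ <= X)%E]ge0_integralD//.
  apply: ge0_le_integral => //.
  - by move=> y _; apply: adde_ge0.
  - exact: emeasurable_funD.
  - exact: emeasurable_funD.
  move=> y _; rewrite funenegE funeposE; have [_ + ->] := pw y.
  by rewrite -EFinM [fs i y * _]mulrC.
move: I1; rewrite f1 fs1 mule1 => I1.
rewrite FpE; move: HF; rewrite integralE.
have Fnfin : (\int[lam]_y (F^\- y) \is a fin_num)%E.
  by rewrite ge0_fin_numE// (le_lt_trans Fn1)// ltry.
rewrite lteBlDr// => HF.
have Fpfin : (\int[lam]_y (F^\+ y) \is a fin_num)%E.
  by rewrite ge0_fin_numE// (lt_trans HF)// ltey_eq fin_numD Fnfin.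
move: I1 HF Fn0; rewrite -(fineK Fnfin) -(fineK Fpfin).
move: (fine _) (fine _) => X Y; rewrite -!EFinM -!EFinD !lee_fin lte_fin => I1 HF X0.
nra.
Qed.

End LogRatio.

(** * Likelihood comparison and the lower bound on the evidence *)

Section LikelihoodComparison.
Context {R : realType} {d k : nat}.
Local Notation Obs := (d.-tuple R).
Implicit Types (fs f : 'I_k -> Obs -> R).

Lemma pos_logratio_le fs f y (x : R) j : (forall y, 0 <= f j y) -> (forall y, 0 <= fs j y) ->
  (pos_logratio fs f y <= x%:E)%E -> fs j y <= expR x * f j y.
Proof.
move=> f0 fs0; rewrite /pos_logratio ge_max => /andP[_ Hx].
have := le_trans (elogratio_le_max fs f y j) Hx; rewrite /elogratio.
case: eqVneq => [->|an]; first by rewrite mulr_ge0 ?expR_ge0.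
case: eqVneq => [_|bn]; first by rewrite leye_eq.
have a0 : 0 < fs j y by rewrite lt_def an ?f0 ?fs0.
have b0 : 0 < f j y by rewrite lt_def bn ?f0 ?fs0.
rewrite lee_fin -{1}(expRK x) ler_ln ?posrE ?divr_gt0 ?expR_gt0//.
by rewrite ler_pdivrMr.
Qed.

(** Forward rows are compared entrywise, C being the factor accumulated so far. A transition costs 1
    + e / q because Qs <= Q + e and Q >= q; an emission costs the exponential of [pos_logratio]. *)
Lemma hmm_lik_compare (Qs Q : 'M[R]_k) fs f (e q : R) : is_trans Qs -> trans_lb q Q ->
  0 < q -> 0 <= e -> (forall i j, Qs i j <= Q i j + e) ->
  (forall j y, 0 <= f j y) -> (forall j y, 0 <= fs j y) ->
  forall s (u u' : 'rV[R]_k) (C X : R), 0 <= C -> nneg_row u -> nneg_row u' ->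
  (forall i, u 0 i <= C * u' 0 i) ->
  (\sum_(a <- s) pos_logratio fs f a <= X%:E)%E ->
  hmm_lik Qs fs u s <= C * (1 + e / q) ^+ size s * expR X * hmm_lik Q f u' s.
Proof.
move=> HQs [HQ Hq] q0 e0 HQe f0 fs0; elim=> [|z s IH] u u' C X C0 hu hu' huu.
  rewrite big_nil lee_fin => X0; rewrite expr0 mulr1 /hmm_lik /=.
  rewrite (le_trans (ler_sum _ (fun i _ => huu i)))// -mulr_sumr.
  rewrite -mulrA ler_wpM2l// ler_peMl ?sumr_ge0//.
  by rewrite (le_trans _ (expR_ge1Dx X))// lerDl.
rewrite big_cons => HX.
have Gz := pos_logratio_ge0 fs f z.
have Gs : (0 <= \sum_(a <- s) pos_logratio fs f a)%E.
  by apply: sume_ge0 => a _; exact: pos_logratio_ge0.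
(* The real bound X excludes infinite log-ratios, so the first term can be moved across the
   inequality. *)
have zfin : pos_logratio fs f z \is a fin_num.
  rewrite ge0_fin_numE// (le_lt_trans _ (ltry X))// (le_trans _ HX)//.
  by rewrite leeDl.
set x := fine (pos_logratio fs f z).
have xE : pos_logratio fs f z = x%:E by rewrite /x fineK.
have HX' : (\sum_(a <- s) pos_logratio fs f a <= (X - x)%:E)%E.
  by rewrite EFinB leeBrDl// -xE.
have c0 : 0 <= 1 + e / q by rewrite addr_ge0// divr_ge0// ltW.
have step : forall i, hmm_step Qs fs u z 0 i <= (C * (1 + e / q) * expR x) * hmm_step Q f u' z 0 i.
  move=> j; rewrite !mxE mulr_sumr; apply: ler_sum => i _.
  have h1 : Qs i j <= (1 + e / q) * Q i j.
    rewrite (le_trans (HQe i j))// mulrDl mul1r lerD2l.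
    by rewrite -mulrAC ler_pdivlMr// ler_wpM2l.
  have h2 : fs i z <= expR x * f i z.
    by apply: pos_logratio_le => //; rewrite xE.
  rewrite (_ : _ * (u' 0 i * f i z * Q i j) =
     (C * u' 0 i) * (expR x * f i z) * ((1 + e / q) * Q i j)); last by ring.
  apply: ler_pM => //; first by rewrite mulr_ge0.
    exact: trans_ge0.
  by apply: ler_pM.
have := IH _ _ _ _ _ _ _ step HX'.
move=> /(_ _ _ _)/le_trans; apply.
- by rewrite !mulr_ge0// expR_ge0.
- exact: hmm_step_ge0.
- exact: hmm_step_ge0.
rewrite hmm_lik_cons expRD expRN /=.
rewrite le_eqVlt; apply/orP; left; apply/eqP; rewrite exprS; field.
by rewrite !gt_eqF ?expR_gt0.
Qed.

End LikelihoodComparison.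

Section EvidenceLowerBound.
Context {R : realType} {d k : nat} (lam : {measure set (d.-tuple R) -> \bar R}).
Hypothesis hlam : sigma_finite setT lam.
Local Notation Obs := (d.-tuple R).
Variables (Qs : 'M[R]_k) (fs : 'I_k -> Obs -> R).
Hypotheses (HQs : is_trans Qs) (Hfs : forall j, is_density lam (fs j)).
Variable vs : 'rV[R]_k.
Hypothesis Hvs : is_dist vs.
Local Notation slik := (hmm_lik Qs fs vs).

Context {dO : measure_display} {Om : measurableType dO} (P : probability Om R).
Variable Yobs : nat -> Om -> Obs.
Hypothesis HYm : forall t, measurable_fun setT (Yobs t).
Hypothesis Hlaw : forall n (A : set (n.-tuple Obs)), (0 < n)%N -> measurable A ->
  P (obs_tuple Yobs n @^-1` A) = iint lam (fun y => (\1_A y * slik y)%:E).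

Context {dT : measure_display} {T : measurableType dT}
  (Pi : {sigma_finite_measure set T -> \bar R}).
Variables (Qof : T -> 'M[R]_k) (fof : T -> 'I_k -> Obs -> R).
Hypotheses (HQof : forall s, is_trans (Qof s))
  (HQm : forall i j, measurable_fun setT (fun s => Qof s i j))
  (Hfof : forall t j, is_density lam (fof t j))
  (Hfm : forall j, measurable_fun setT (fun ty : T * Obs => fof ty.1 j ty.2)).
Variables (mu : 'rV[R]_k) (q : R).
Hypotheses (Hmu : is_dist mu) (q0 : 0 < q) (Hmuq : forall i, q <= mu 0 i).

Let fs0 j y : 0 <= fs j y. Proof. by have [_ []] := Hfs j. Qed.
Let f0 t j y : 0 <= fof t j y. Proof. by have [_ []] := Hfof t j. Qed.
Let mfs j : measurable_fun setT (fs j). Proof. by have [] := Hfs j. Qed.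

Definition evidence n (y : n.-tuple Obs) : \bar R :=
  (\int[Pi]_th (hmm_lik (Qof th) (fof th) mu y)%:E)%E.

Let G th y := pos_logratio fs (fof th) y.
Let G0 th y : (0 <= G th y)%E. Proof. exact: pos_logratio_ge0. Qed.
Let mG : measurable_fun setT (fun p : T * Obs => G p.1 p.2).
Proof. by apply: measurable_maxe => //; apply: measurable_max_logratio. Qed.

Variables (S : set T) (eta : R).
Hypotheses (mS : measurable S) (S0 : (0 < Pi S)%E) (Sfin : (Pi S < +oo)%E).
Hypothesis eta01 : 0 < eta <= 1.
Hypothesis SQ : forall th, S th -> trans_lb q (Qof th).
Hypothesis SQe : forall th i j, S th -> Qs i j <= Qof th i j + eta ^+ 2.
Hypothesis SG : forall th i, S th ->
  (\int[lam]_y ((fs i y)%:E * max_logratio fs (fof th) y) < (eta ^+ 2)%:E)%E.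

Let rS : R := fine (Pi S).
Let rSE : Pi S = rS%:E. Proof. by rewrite fineK// ge0_fin_numE. Qed.
Let rS0 : 0 < rS. Proof. by rewrite -lte_fin -rSE. Qed.
Let eta0 : 0 < eta. Proof. by case/andP: eta01. Qed.

Let GS th y : \bar R := ((\1_S th : R)%:E * G th y)%E.
Let GS0 th y : (0 <= GS th y)%E. Proof. by rewrite mule_ge0// lee_fin. Qed.
Let mGS : measurable_fun setT (fun p : T * Obs => GS p.1 p.2).
Proof.
apply: emeasurable_funM => //; apply/measurable_EFinP.
apply: (measurableT_comp (f := (\1_S : T -> R))) => //; exact: measurable_indic.
Qed.
Let mGSth y : measurable_fun setT (fun th => GS th y).
Proof. exact: (measurableT_comp mGS (measurable_pair2 y)). Qed.

Let Gbar y : \bar R := (\int[Pi]_th GS th y)%E.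

Let Gbar0 y : (0 <= Gbar y)%E. Proof. exact: integral_ge0. Qed.

Let mGbar : measurable_fun setT Gbar.
Proof. exact: (@measurable_fun_fubini_tonelli_G _ _ _ _ _ Pi (fun p => GS p.1 p.2)). Qed.

Let Gbar_mean i : (\int[lam]_y ((fs i y)%:E * Gbar y) <= (3 * eta * rS)%:E)%E.
Proof.
have mfG : measurable_fun setT (fun p : T * Obs => ((fs i p.2)%:E * GS p.1 p.2)%E).
  apply: emeasurable_funM => //; apply/measurable_EFinP.
  exact: (measurableT_comp (mfs i)).
have -> : (\int[lam]_y ((fs i y)%:E * Gbar y) =
   \int[lam]_y \int[Pi]_th ((fs i y)%:E * GS th y))%E.
  apply: eq_integral => y _; rewrite ge0_integralZl//; last by rewrite lee_fin.
rewrite -(integral_exchange hlam Pi (F := fun th y => ((fs i y)%:E * GS th y)%E))//; last first.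
  by move=> th y; rewrite mule_ge0// lee_fin.
apply: (@le_trans _ _ (\int[Pi]_th ((3 * eta)%:E * (\1_S th : R)%:E))%E); last first.
  rewrite ge0_integralZl//; first last.
  - by rewrite lee_fin mulr_ge0// ltW.
  - by apply/measurable_EFinP; exact: measurable_indic.
  by rewrite integral_indic// setIT [X in (_ * X <= _)%E]rSE -EFinM.
have mI : measurable_fun setT (fun th => (\1_S th : R)%:E).
  by apply/measurable_EFinP; exact: measurable_indic.
apply: ge0_le_integral => //.
- by move=> th _; apply: integral_ge0 => y _; rewrite mule_ge0// lee_fin.
- apply: (measurable_integral_param hlam (F := fun th y => ((fs i y)%:E * GS th y)%E)) => //.
  by move=> th y; rewrite mule_ge0// lee_fin.
- exact: measurable_funeM.
move=> th _; rewrite /GS indicE; case: (boolP (th \in S)) => [|_].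
  rewrite inE => Sth; under eq_integral do rewrite mul1e.
  by rewrite mule1; apply: pos_logratio_mean => //; exact: SG.
under eq_integral do rewrite mul0e mule0.
by rewrite integral0 mule0.
Qed.

(** The threshold X = 24 eta n is twice the average over S allowed by the hypothesis, so by Markov
    at least half of S stays below it. The factor q comes from vs <= 1 <= mu / q, and (1 + eta^2 /
    q)^n <= exp(n eta^2 / q). *)
Lemma evidence_at_point n (y : n.-tuple Obs) : (0 < n)%N ->
  (\sum_(a <- y) Gbar a <= (12 * eta * rS * n%:R)%:E)%E ->
  ((q * rS / 2 * expR (- (n%:R * (24 * eta + eta ^+ 2 / q))) * slik y)%:E <= evidence y)%E.
Proof.
move=> n0 Hy; set X := 24 * eta * n%:R.
have X0 : 0 < X by rewrite !mulr_gt0// ltr0n.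
pose Sy th := (\sum_(a <- y) G th a)%E.
have mSy : measurable_fun setT Sy.
  apply: emeasurable_sum => a; exact: (measurableT_comp mG (measurable_pair2 a)).
pose A := S `&` [set th | (Sy th <= X%:E)%E].
have mA : measurable A by apply: measurableI => //; exact: measurable_lee_set.
have mB : measurable (S `\` A) by exact: measurableD.
have PB : (X%:E * Pi (S `\` A) <= (12 * eta * rS * n%:R)%:E)%E.
  apply: le_trans Hy.
  have -> : (\sum_(a <- y) Gbar a = \int[Pi]_th \sum_(a <- y) GS th a)%E.
    by rewrite ge0_integral_sum.
  rewrite -(setIT (S `\` A)) -integral_indic// -ge0_integralZl//; first last.
  - by rewrite lee_fin ltW.
  - by apply/measurable_EFinP; exact: measurable_indic.
  apply: ge0_le_integral => //.
  - by move=> th _; rewrite mule_ge0// lee_fin// ltW.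
  - by apply: measurable_funeM; apply/measurable_EFinP; exact: measurable_indic.
  - exact: emeasurable_sum.
  move=> th _; rewrite indicE; case: (boolP (th \in _)) => [|_]; last first.
    by rewrite mule0 sume_ge0.
  rewrite inE mule1 => -[Sth nA].
  under eq_bigr do rewrite /GS indicE mem_set// mul1e.
  by rewrite leNgt; apply/negP => h; apply: nA; split => //=; exact: ltW.
have PA : ((rS / 2)%:E <= Pi A)%E.
  have AS : A `<=` S by move=> th [].
  have PAfin : Pi A \is a fin_num.
    by rewrite ge0_fin_numE// (le_lt_trans _ Sfin)// le_measure// inE.
  have PBE : Pi (S `\` A) = (rS - fine (Pi A))%:E.
    by rewrite measureD// setIidr// [X in (X - _)%E]rSE EFinB (fineK PAfin).
  move: PB; rewrite PBE -EFinM lee_fin -(fineK PAfin) lee_fin => h.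
  have : X * (rS - fine (Pi A)) <= X * (rS / 2) by rewrite (le_trans h)// /X; lra.
  by rewrite ler_pM2l//; lra.
have lb th : A th -> q * expR (- (n%:R * (24 * eta + eta ^+ 2 / q))) * slik y <=
    hmm_lik (Qof th) (fof th) mu y.
  move=> [Sth Sth2].
  have vmu i : vs 0 i <= q^-1 * mu 0 i.
    have [v0 v1] := Hvs; rewrite (@le_trans _ _ 1)//.
      rewrite -v1 (bigD1 i)//= lerDl; by apply: sumr_ge0.
    by rewrite mulrC ler_pdivlMr// mul1r.
  have q'0 : 0 <= q^-1 by rewrite invr_ge0 ltW.
  have H := @hmm_lik_compare _ _ _ Qs (Qof th) fs (fof th) (eta ^+ 2) q HQs (SQ Sth) q0
     (sqr_ge0 _) (fun i j => @SQe th i j Sth) (f0 th) fs0 y vs mu q^-1 X q'0 Hvs.1 Hmu.1 vmu Sth2.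
  have L0 : 0 <= hmm_lik (Qof th) (fof th) mu y by apply: hmm_lik_ge0 => //; exact: Hmu.1.
  set E := n%:R * _; have E0 := expR_gt0 E.
  have h : (1 + eta ^+ 2 / q) ^+ n * expR X <= expR E.
    have e0 : 0 <= eta ^+ 2 / q by rewrite divr_ge0 ?sqr_ge0// ltW.
    rewrite /E mulrDr [X in _ <= expR X]addrC expRD ler_pM ?expR_ge0 ?exprn_ge0//.
    - by rewrite addr_ge0.
    - by rewrite expRM_natl lerXn2r ?nnegrE ?expR_ge0 ?addr_ge0// expR_ge1Dx.
    - by rewrite /X mulrC.
  rewrite size_tuple in H.
  apply: (@le_trans _ _ (q * expR (- E) * (q^-1 * (1 + eta ^+ 2 / q) ^+ n * expR X *
      hmm_lik (Qof th) (fof th) mu y))).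
    by apply: ler_wpM2l => //; rewrite mulr_ge0 ?expR_ge0// ltW.
  have -> : q * expR (- E) * (q^-1 * (1 + eta ^+ 2 / q) ^+ n * expR X * hmm_lik (Qof th) (fof th) mu y)
    = (expR E)^-1 * ((1 + eta ^+ 2 / q) ^+ n * expR X) * hmm_lik (Qof th) (fof th) mu y.
    have qn : q != 0 by rewrite gt_eqF.
    have En : expR E != 0 by rewrite gt_eqF.
    rewrite expRN; move: (hmm_lik _ _ _ _) ((1 + _) ^+ n) (expR X) => a b c.
    by move: (expR E) En => e En; field; rewrite En.
  by rewrite ler_piMl// ler_pdivrMl// mulr1.
set c := q * expR _ * slik y in lb.
have c0 : 0 <= c.
  rewrite mulr_ge0//; last by apply: hmm_lik_ge0 => //; exact: Hvs.1.
  by rewrite mulr_ge0 ?expR_ge0// ltW.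
have -> : q * rS / 2 * expR (- (n%:R * (24 * eta + eta ^+ 2 / q))) * slik y = c * (rS / 2).
  by rewrite /c; field.
apply: (@le_trans _ _ (c%:E * Pi A)%E).
  by rewrite EFinM; apply: lee_wpmul2l.
rewrite -(setIT A) -integral_indic// -ge0_integralZl//; last first.
  by apply/measurable_EFinP; exact: measurable_indic.
apply: ge0_le_integral => //.
- by move=> th _; rewrite mule_ge0// lee_fin.
- by apply: measurable_funeM; apply/measurable_EFinP; exact: measurable_indic.
- apply/measurable_EFinP.
  have H := @measurable_hmm_lik _ _ _ _ T n Qof fof (fun _ => mu) HQm Hfm (fun i => measurable_cst _).
  exact: (measurableT_comp H (measurable_pair2 y)).
move=> th _; rewrite indicE; case: (boolP (th \in _)) => [|_].
  by rewrite inE mule1 lee_fin => /lb.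
by rewrite mule0 lee_fin; apply: hmm_lik_ge0 => //; exact: Hmu.1.
Qed.

Lemma evidence_lower_bound : {ae P, forall w, exists n0, forall n, (n0 <= n)%N ->
  ((q * rS / 2 * expR (- (n%:R * (24 * eta + eta ^+ 2 / q))) * slik (obs_tuple Yobs n w))%:E
    <= evidence (obs_tuple Yobs n w))%E}.
Proof.
(* Scales the mean bound 3 eta rS of [Gbar] to the 1/2 required by [lln_upper_bound], whose
   conclusion 2 n then reads 12 eta rS n. *)
pose c := (6 * eta * rS)^-1.
have c0 : 0 < c by rewrite invr_gt0 !mulr_gt0.
pose g y := (c%:E * Gbar y)%E.
have mg : measurable_fun setT g by exact: measurable_funeM.
have g0 y : (0 <= g y)%E by rewrite mule_ge0// lee_fin ltW.
have gm i : (\int[lam]_y ((fs i y)%:E * g y) <= (2^-1)%:E)%E.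
  under eq_integral do rewrite /g muleCA.
  rewrite ge0_integralZl//; first last.
  - by rewrite lee_fin ltW.
  - by move=> y _; rewrite mule_ge0// lee_fin.
  - by apply: emeasurable_funM => //; exact/measurable_EFinP.
  apply: (@le_trans _ _ (c%:E * (3 * eta * rS)%:E)%E).
    by apply: lee_wpmul2l => //; rewrite lee_fin ltW.
  rewrite -EFinM lee_fin le_eqVlt /c; apply/orP; left; apply/eqP; field.
  by rewrite !gt_eqF.
have [N [mN N0 HN]] := lln_upper_bound hlam HQs Hfs Hvs HYm Hlaw mg g0 gm.
exists N; split => // w /= H; apply: HN => -[n0 Hn0]; apply: H.
exists (maxn n0 1) => n; rewrite geq_max => /andP[nn0 n1].
apply: evidence_at_point => //.
have := Hn0 n nn0; rewrite /g.
have -> : (\sum_(t < n) c%:E * Gbar (Yobs t w) = c%:E * \sum_(a <- obs_tuple Yobs n w) Gbar a)%E.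
  by rewrite big_tuple ge0_sume_distrr//; apply: eq_bigr => i _; rewrite tnth_mktuple.
rewrite -lee_pdivlMl// -EFinM => /le_trans; apply; rewrite lee_fin /c invrK.
by rewrite le_eqVlt; apply/orP; left; apply/eqP; ring.
Qed.

End EvidenceLowerBound.

(** * Monotonicity of integrals for arbitrary nonnegative functions, and geometric sums *)

Section NonmeasurableIntegral.
Context {R : realType} {dT : measure_display} {T : measurableType dT}
  (m : {measure set T -> \bar R}).

(* For nonnegative functions the integral is a supremum over simple minorants,
   hence monotone without any measurability. *)
Lemma ge0_le_integral_nonmeas (f g : T -> \bar R) : (forall x, 0 <= f x)%E ->
  (forall x, f x <= g x)%E -> (\int[m]_x f x <= \int[m]_x g x)%E.
Proof.
move=> f0 fg; have g0 x : (0 <= g x)%E by exact: le_trans (f0 x) (fg x).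
rewrite !ge0_integralTE//; apply: ge_ereal_sup => _ [h hf <-].
by apply: ereal_sup_ubound; exists h => // x; exact: le_trans (hf x) (fg x).
Qed.

(** Serves the posterior numerator over the set in the theorem, which is not assumed measurable. *)
Lemma le_integral_subset_nonmeas (A : set T) (f : T -> \bar R) (C : set T) :
  (forall x, 0 <= f x)%E -> A `<=` C ->
  (\int[m]_(x in A) f x <= \int[m]_(x in C) f x)%E.
Proof.
move=> f0 AC; rewrite !(integral_mkcond _ f).
apply: ge0_le_integral_nonmeas => x; rewrite /patch; first by case: ifP.
case: ifP => [|_]; last by case: ifP.
by rewrite inE => /AC Cx; rewrite mem_set.
Qed.

End NonmeasurableIntegral.

Lemma measurable_integral_fst {R : realType} {dT dY : measure_display}
    {T : measurableType dT} {Y : measurableType dY}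
    (m : {sigma_finite_measure set T -> \bar R}) (F : T -> Y -> \bar R) :
  measurable_fun setT (fun p : T * Y => F p.1 p.2) -> (forall t y, 0 <= F t y)%E ->
  measurable_fun setT (fun y => \int[m]_t F t y)%E.
Proof.
move=> mF F0; exact: (@measurable_fun_fubini_tonelli_G _ _ _ _ _ m (fun p => F p.1 p.2)).
Qed.

Section GeometricSums.
Context {R : realType}.

Lemma sum_expR_bounded (C c : R) : 0 <= C -> 0 < c ->
  exists M : R, forall n, \sum_(0 <= i < n) C * expR (- (i%:R * c)) <= M.
Proof.
move=> C0 c0; exists (C * (1 - expR (- c))^-1) => n.
have e1 : expR (- c) < 1 by rewrite expR_lt1 oppr_lt0.
have := @geometric_le_lim R n C (expR (- c)) C0 (expR_gt0 _).
rewrite ger0_norm ?expR_ge0// => /(_ e1); apply: le_trans.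
rewrite le_eqVlt; apply/orP; left; apply/eqP; rewrite /series /=.
by apply: eq_bigr => i _; rewrite -expRM_natl mulrN.
Qed.

Lemma expR_natM_cvg0 (c : R) : 0 < c -> expR (- (n%:R * c)) @[n --> \oo] --> (0 : R).
Proof.
move=> c0; rewrite (_ : (fun n => _) = GRing.exp (expR (- c))).
  by apply: cvg_expr; rewrite ger0_norm ?expR_ge0// expR_lt1 oppr_lt0.
by apply/funext => n; rewrite -expRM_natl mulrN.
Qed.

End GeometricSums.

(** * Posterior consistency from summable tests *)

Section PosteriorFromTests.
Context {R : realType} {d k : nat} (lam : {measure set (d.-tuple R) -> \bar R}).
Hypothesis hlam : sigma_finite setT lam.
Local Notation Obs := (d.-tuple R).
Variables (Qs : 'M[R]_k) (fs : 'I_k -> Obs -> R).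
Hypotheses (HQs : is_trans Qs) (Hfs : forall j, is_density lam (fs j)).
Variable vs : 'rV[R]_k.
Hypothesis Hvs : is_dist vs.
Local Notation slik := (hmm_lik Qs fs vs).

Context {dO : measure_display} {Om : measurableType dO} (P : probability Om R).
Variable Yobs : nat -> Om -> Obs.
Hypothesis HYm : forall t, measurable_fun setT (Yobs t).
Hypothesis Hlaw : forall n (A : set (n.-tuple Obs)), (0 < n)%N -> measurable A ->
  P (obs_tuple Yobs n @^-1` A) = iint lam (fun y => (\1_A y * slik y)%:E).

Context {dT : measure_display} {T : measurableType dT}
  (Pi : {sigma_finite_measure set T -> \bar R}).
Hypothesis Pi1 : Pi setT = 1%E.
Variables (Qof : T -> 'M[R]_k) (fof : T -> 'I_k -> Obs -> R).
Hypotheses (HQof : forall s, is_trans (Qof s))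
  (HQm : forall i j, measurable_fun setT (fun s => Qof s i j))
  (Hfof : forall t j, is_density lam (fof t j))
  (Hfm : forall j, measurable_fun setT (fun ty : T * Obs => fof ty.1 j ty.2)).
Variables (mu : 'rV[R]_k).
Hypotheses (Hmu : is_dist mu).

Let fs0 j y : 0 <= fs j y. Proof. by have [_ []] := Hfs j. Qed.
Let f0 t j y : 0 <= fof t j y. Proof. by have [_ []] := Hfof t j. Qed.
Let mfs j : measurable_fun setT (fs j). Proof. by have [] := Hfs j. Qed.
Local Notation lik th y := (hmm_lik (Qof th) (fof th) mu y).
Local Notation ev y := (evidence Pi Qof fof mu y).
Local Notation obs n w := (obs_tuple Yobs n w).

Let lik0 th y : 0 <= lik th y.
Proof. by apply: hmm_lik_ge0 => //; exact: Hmu.1. Qed.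
Let slik0 y : 0 <= slik y.
Proof. by apply: hmm_lik_ge0 => //; exact: Hvs.1. Qed.
Let mslik n : measurable_fun setT (fun y : n.-tuple Obs => slik y).
Proof. exact: smeas_hmm_lik. Qed.
Let mlik n : measurable_fun setT (fun p : T * n.-tuple Obs => lik p.1 p.2).
Proof. exact: (@measurable_hmm_lik _ _ _ _ T n Qof fof (fun _ => mu)). Qed.
Let mlikth n (y : n.-tuple Obs) : measurable_fun setT (fun th => lik th y).
Proof. exact: (measurableT_comp (@mlik n) (measurable_pair2 y)). Qed.

Definition post_mass (A : set T) n (y : n.-tuple Obs) : R :=
  fine (\int[Pi]_(th in A) (lik th y)%:E)%E / fine (ev y).

Let mev n : measurable_fun setT (fun y : n.-tuple Obs => ev y).
Proof.
apply: (@measurable_integral_fst _ _ _ _ _ Pi (fun th (y : n.-tuple Obs) => (lik th y)%:E)).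
  by apply/measurable_EFinP; exact: mlik.
by move=> th y; rewrite lee_fin.
Qed.

Let ev0 n (y : n.-tuple Obs) : (0 <= ev y)%E.
Proof. by apply: integral_ge0 => th _; rewrite lee_fin. Qed.

Let ev_finite : {ae P, forall w, exists n0, forall n, (n0 <= n)%N -> (ev (obs n w) < +oo)%E}.
Proof.
pose D n := [set y : n.-tuple Obs | (+oo <= ev y)%E].
have mD n : measurable (D n) by apply: measurable_lee_set => //; exact: mev.
pose F n := obs_tuple Yobs n.+1 @^-1` D n.+1.
have mF n : measurable (F n).
  by rewrite -[F n]setTI; apply: (measurable_obs_tuple HYm (n:=n.+1)) => //; exact: mD.
have PF n : P (F n) = 0%E.
  (* The value +oo must be excluded because [post_mass] divides by [fine] of the evidence. Where the
     evidence is +oo, the true likelihood is below e times it; the evidence integrates to 1, so the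
     probability is at most e. *)
  apply/eqP; rewrite eq_le measure_ge0 andbT; apply/lee_addgt0Pr => e e0; rewrite add0e.
  rewrite Hlaw//.
  apply: (@le_trans _ _ (iint lam (fun y : n.+1.-tuple Obs => e%:E * ev y)%E)).
    apply: le_iint => //.
    - by apply/measurable_EFinP; apply: measurable_funM; [apply: measurable_indic; exact: mD|exact: mslik].
    - by apply: measurable_funeM; exact: mev.
    - by move=> y; rewrite lee_fin mulr_ge0.
    - move=> y; rewrite indicE; case: (boolP (y \in _)) => [|_].
        rewrite inE /D /= leye_eq => /eqP ->.
        by rewrite gt0_muley ?leey// lte_fin.
      by rewrite mul0r mule_ge0// lee_fin ltW.
  rewrite iintZl//; last by rewrite lee_fin ltW.
  rewrite -(iint_exchange hlam Pi (F := fun th y => (lik th y)%:E))//; first last.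
  - by move=> t y; rewrite lee_fin.
  - by apply/measurable_EFinP; exact: mlik.
  have E th : iint lam (fun y : n.+1.-tuple Obs => (lik th y)%:E) = 1%E.
    by rewrite iint_hmm_lik// ?(Hmu.2)//; exact: Hmu.1.
  under eq_integral do rewrite E.
  rewrite integral_cst// mul1e -[X in (_ * X <= _)%E]/(Pi setT) Pi1 mule1//.
have sF : (\sum_(n <oo) P (F n) < +oo)%E by rewrite eseries0 ?ltry.
apply: filterS (borel_cantelli_ae mF sF) => w [n0 H].
exists n0.+1 => -[|n]; first by rewrite ltn0.
rewrite ltnS => /H; rewrite /F /D /= => /negP; rewrite -ltNge //.
Qed.

Variables (B : set T) (Phi : forall n, set (n.-tuple Obs)) (C c : R).
Hypotheses (mB : measurable B) (mPhi : forall n, measurable (@Phi n)).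
Hypotheses (C0 : 0 <= C) (c0 : 0 < c).
Hypothesis typeI : (\sum_(n <oo) P (obs_tuple Yobs n @^-1` (@Phi n)) < +oo)%E.
Hypothesis typeII : forall n, (0 < n)%N ->
  (\int[Pi]_th ((\1_(~` B) th : R)%:E *
     iint lam (fun y : n.-tuple Obs => (\1_(~` @Phi n) y * lik th y)%:E))
   <= (C * expR (- (n%:R * c)))%:E)%E.
Hypothesis lower : {ae P, forall w, exists n0, forall n, (n0 <= n)%N ->
  ((expR (- (n%:R * (c / 4))) * slik (obs n w))%:E <= ev (obs n w))%E}.

Let bm n (y : n.-tuple Obs) : \bar R := (\int[Pi]_th ((\1_(~` B) th : R) * lik th y)%:E)%E.

Let mind (A : set T) : measurable A -> forall n,
  measurable_fun setT (fun p : T * n.-tuple Obs => (\1_A p.1 : R) * lik p.1 p.2).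
Proof.
move=> mA n; apply: measurable_funM; last exact: mlik.
apply: (measurableT_comp (f := (\1_A : T -> R))) => //; exact: measurable_indic.
Qed.

Let mbm n : measurable_fun setT (fun y : n.-tuple Obs => bm y).
Proof.
apply: (@measurable_integral_fst _ _ _ _ _ Pi (fun th (y : n.-tuple Obs) => ((\1_(~` B) th : R) * lik th y)%:E)).
  by apply/measurable_EFinP; apply: mind; exact: measurableC.
by move=> th y; rewrite lee_fin mulr_ge0.
Qed.

(** A change of measure: on the bad event slik <= exp(n c / 2) bm, and off Phi the integral of bm is
    the type II error, at most C exp(- n c). Half of the rate is left for Borel-Cantelli. *)
Let bm_small : {ae P, forall w, exists n0, forall n, (n0 <= n)%N ->
  (bm (obs n w) < (expR (- (n%:R * (c / 2))) * slik (obs n w))%:E)%E}.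
Proof.
pose E n := ~` @Phi n `&` [set y : n.-tuple Obs | ((expR (- (n%:R * (c / 2))) * slik y)%:E <= bm y)%E].
have mE n : measurable (E n).
  apply: measurableI; first by apply: measurableC; exact: mPhi.
  apply: measurable_lee_set; last exact: mbm.
  by apply/measurable_EFinP; apply: measurable_funM => //; exact: mslik.
have mPhi' n : measurable (obs_tuple Yobs n @^-1` (@Phi n)).
  by rewrite -[X in measurable X]setTI; apply: (measurable_obs_tuple HYm (n:=n)) => //; exact: mPhi.
have mE' n : measurable (obs_tuple Yobs n @^-1` (E n)).
  by rewrite -[X in measurable X]setTI; apply: (measurable_obs_tuple HYm (n:=n)) => //; exact: mE.
(* The added 1 covers n = 0, where [typeII] says nothing and the probability is bounded by 1. *)
have PE n : (P (obs_tuple Yobs n @^-1` (E n)) <= ((C + 1) * expR (- (n%:R * (c / 2))))%:E)%E.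
  have [->|n0] := posnP n.
    rewrite mul0r oppr0 expR0 mulr1 (le_trans (probability_le1 _ _))//.
    by rewrite lee_fin lerDr.
  rewrite Hlaw//; set x := expR (n%:R * (c / 2)).
  have x0 : 0 < x by exact: expR_gt0.
  have mIb : measurable_fun setT (fun y : n.-tuple Obs => ((\1_(~` @Phi n) y : R)%:E * bm y)%E).
    apply: emeasurable_funM; last exact: mbm.
    apply/measurable_EFinP; apply: measurable_indic; apply: measurableC; exact: mPhi.
  have bm0 (y : n.-tuple Obs) : (0 <= bm y)%E.
    by apply: integral_ge0 => th _; rewrite lee_fin mulr_ge0.
  apply: (@le_trans _ _ (iint lam (fun y : n.-tuple Obs => x%:E * ((\1_(~` @Phi n) y : R)%:E * bm y))%E)).
    apply: le_iint => //.
    - by apply/measurable_EFinP; apply: measurable_funM; [apply: measurable_indic; exact: mE|exact: mslik].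
    - exact: measurable_funeM.
    - by move=> y; rewrite lee_fin mulr_ge0.
    - move=> y; rewrite indicE; case: (boolP (y \in _)) => [|_]; last first.
        by rewrite mul0r mule_ge0 ?lee_fin ?(ltW x0)// mule_ge0// lee_fin.
      rewrite inE => -[nPhi hE]; rewrite indicE mem_set// mul1e mul1r.
      move: hE; rewrite /= expRN -/x EFinM muleC lee_pdivrMr// muleC //.
  rewrite iintZl//; first last.
  - by move=> y; rewrite mule_ge0// lee_fin.
  - by rewrite lee_fin ltW.
  have -> : iint lam (fun y : n.-tuple Obs => (\1_(~` @Phi n) y : R)%:E * bm y)%E =
    (\int[Pi]_th ((\1_(~` B) th : R)%:E *
     iint lam (fun y : n.-tuple Obs => (\1_(~` @Phi n) y * lik th y)%:E)))%E.
    under eq_integral => th _.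
      rewrite -iintZl//; first last.
      - by move=> y; rewrite lee_fin mulr_ge0.
      - apply/measurable_EFinP; apply: measurable_funM.
          by apply: measurable_indic; apply: measurableC; exact: mPhi.
        exact: (measurableT_comp (@mlik n) (measurable_pair1 th)).
      over.
    rewrite (iint_exchange hlam Pi (F := fun th (y : n.-tuple Obs) =>
        ((\1_(~` B) th : R)%:E * (\1_(~` @Phi n) y * lik th y)%:E)%E))//; first last.
    - by move=> th y; rewrite mule_ge0 ?lee_fin// mulr_ge0.
    - under eq_fun do rewrite -EFinM mulrCA.
      apply/measurable_EFinP; apply: measurable_funM; last by apply: mind; exact: measurableC.
      apply: (measurableT_comp (f := (\1_(~` @Phi n) : n.-tuple Obs -> R))) => //.
      by apply: measurable_indic; apply: measurableC; exact: mPhi.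
    apply: eq_iint => y; rewrite /bm -ge0_integralZl//.
    - by apply: eq_integral => th _; rewrite -!EFinM mulrCA.
    - apply/measurable_EFinP; apply: measurable_funM; last exact: mlikth.
      by apply: measurable_indic; exact: measurableC.
    - by move=> th _; rewrite lee_fin mulr_ge0.
  apply: (@le_trans _ _ (x%:E * (C * expR (- (n%:R * c)))%:E)%E).
    by apply: lee_wpmul2l; [rewrite lee_fin ltW|exact: typeII].
  rewrite -EFinM lee_fin mulrCA /x -expRD ler_pM ?expR_ge0//; first by rewrite lerDl.
  by rewrite ler_expR; lra.
have sE : (\sum_(n <oo) P (obs_tuple Yobs n @^-1` (E n)) < +oo)%E.
  have [M HM] := @sum_expR_bounded R (C + 1) (c / 2) (addr_ge0 C0 ler01) (divr_gt0 c0 (ltr0n _ 2)).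
  apply: (@nneseries_bounded _ _ M) => // n.
  apply: (@le_trans _ _ (\sum_(0 <= i < n) ((C + 1) * expR (- (i%:R * (c / 2))))%:E)%E).
    by apply: lee_sum => i _.
  by rewrite sumEFin lee_fin.
have H1 := borel_cantelli_ae mPhi' typeI.
have H2 := borel_cantelli_ae mE' sE.
apply: filterS2 H1 H2 => w [n1 H1] [n2 H2]; exists (maxn n1 n2) => n.
rewrite geq_max => /andP[/H1 nPhi /H2 nE]; rewrite ltNge; apply/negP => h.
by apply: nE; split.
Qed.

(** Numerator exp(- n c / 2) slik against evidence exp(- n c / 4) slik leaves exp(- n c / 4). The
    measurable B carries the additive splitting of the evidence; A enters by monotonicity. *)
Lemma posterior_consistent_from_tests (A : set T) : B `<=` A ->
  {ae P, forall w, post_mass A (obs n w) @[n --> \oo] --> (1 : R)}.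
Proof.
move=> BA; apply: filterS3 ev_finite bm_small lower => w [n1 H1] [n2 H2] [n3 H3].
pose N := maxn n1 (maxn n2 n3).
apply: (@squeeze_cvgr _ _ _ _ (fun n => 1 - expR (- (n%:R * (c / 4)))) (fun=> 1)).
- near=> n.
  have : (N <= n)%N by near: n; exact: nbhs_infty_ge.
  rewrite !geq_max => /andP[/H1 evfin /andP[/H2 hb /H3 hl]] {H1 H2 H3}.
  set y := obs n w in evfin hb hl *.
  have efin : ev y \is a fin_num by rewrite ge0_fin_numE.
  have bm0 : (0 <= bm y)%E by apply: integral_ge0 => th _; rewrite lee_fin mulr_ge0.
  (* The strict inequality in [bm_small] makes the true likelihood, and with it the evidence,
     positive. *)
  have sl0 : 0 < slik y.
    have := le_lt_trans bm0 hb; rewrite lte_fin pmulr_rgt0// expR_gt0//.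
  have e0 : 0 < fine (ev y).
    rewrite -lte_fin fineK// (lt_le_trans _ hl)// lte_fin mulr_gt0// expR_gt0//.
  have Afin C' : (\int[Pi]_(th in C') (lik th y)%:E <= ev y)%E.
    by apply: le_integral_subset_nonmeas => // th; rewrite lee_fin.
  have A0 C' : (0 <= \int[Pi]_(th in C') (lik th y)%:E)%E.
    by apply: integral_ge0 => th _; rewrite lee_fin.
  have Afn C' : (\int[Pi]_(th in C') (lik th y)%:E)%E \is a fin_num.
    by rewrite ge0_fin_numE// (le_lt_trans (Afin C')).
  apply/andP; split; last first.
    rewrite ler_pdivrMr// mul1r -lee_fin !fineK//.
  have hB : (ev y = \int[Pi]_(th in B) (lik th y)%:E + bm y)%E.
    have -> : bm y = (\int[Pi]_(th in ~` B) (lik th y)%:E)%E.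
      rewrite [RHS]integral_mkcond; apply: eq_integral => th _.
      by rewrite /patch indicE; case: ifP => _; rewrite ?mul1r ?mul0r.
    rewrite -ge0_integral_setU//.
    - by rewrite setUv.
    - exact: measurableC.
    - by rewrite setUv; apply/measurable_EFinP.
    - by move=> th _; rewrite lee_fin.
    - by apply/disj_setPS => th [].
  have bfin : bm y \is a fin_num by rewrite ge0_fin_numE// (lt_trans hb)// ltry.
  rewrite ler_pdivlMr// mulrBl mul1r.
  have h1 : fine (\int[Pi]_(th in B) (lik th y)%:E)%E <= fine (\int[Pi]_(th in A) (lik th y)%:E)%E.
    by rewrite -lee_fin !fineK//; apply: le_integral_subset_nonmeas => // th; rewrite lee_fin.
  have h2 : fine (ev y) = fine (\int[Pi]_(th in B) (lik th y)%:E)%E + fine (bm y).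
    by rewrite {1}hB fineD.
  have h3 : fine (bm y) <= expR (- (n%:R * (c / 4))) * fine (ev y).
    rewrite -lee_fin EFinM !fineK// (le_trans (ltW hb))//.
    apply: (@le_trans _ _ ((expR (- (n%:R * (c / 4))))%:E * (expR (- (n%:R * (c / 4))) * slik y)%:E)%E).
      rewrite -EFinM lee_fin [X in _ <= X]mulrA -expRD le_eqVlt; apply/orP; left; apply/eqP.
      by congr (expR _ * _); lra.
    by apply: lee_wpmul2l => //; rewrite lee_fin expR_ge0.
  lra.
- rewrite -[X in _ --> X]subr0; apply: cvgB; first exact: cvg_cst.
  by apply: expR_natM_cvg0; rewrite divr_gt0.
- exact: cvg_cst.
Unshelve. all: by end_near.
Qed.

End PosteriorFromTests.

(** * Block tests and their two error bounds *)

Section BlockMeans.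
Context {R : realType} {d k : nat} (lam : {measure set (d.-tuple R) -> \bar R}).
Hypothesis hlam : sigma_finite setT lam.
Local Notation Obs := (d.-tuple R).
Variables (Q : 'M[R]_k) (f : 'I_k -> Obs -> R).
Hypotheses (HQ : is_trans Q) (Hf : forall j, is_density lam (f j)).
Implicit Types (u v : 'rV[R]_k) (g : seq Obs -> R).
Variables (g : seq Obs -> R) (l : nat).
Hypotheses (mg : smeas g) (g01 : forall s, 0 <= g s <= 1).

Let mf i : measurable_fun setT (f i). Proof. by have [] := Hf i. Qed.
Let f0 i y : 0 <= f i y. Proof. by have [_ []] := Hf i. Qed.

Definition mean_from v : R := \sum_x v 0 x * block_mean lam Q f g l x.

Lemma smeas_compl : smeas (fun s => 1 - g s).
Proof. by move=> n; apply: measurable_funB => //; exact: mg. Qed.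

Lemma compl01 s : 0 <= 1 - g s <= 1.
Proof. by have /andP[? ?] := g01 s; lra. Qed.

Lemma block_mean_compl x :
  block_mean lam Q f (fun s => 1 - g s) l x = 1 - block_mean lam Q f g l x.
Proof.
apply/eqP; rewrite eq_sym subr_eq eq_sym addrC; apply/eqP.
apply: (@EFin_inj R); rewrite EFinD.
rewrite -(block_meanE hlam HQ Hf _ _ mg g01) -(block_meanE hlam HQ Hf _ _ smeas_compl compl01).
have d0 := nneg_delta x.
have l0 s : 0 <= hmm_lik Q f (delta_mx 0 x) s by exact: hmm_lik_ge0.
rewrite -iintD//.
- under eq_iint do rewrite -EFinD -mulrDl addrC subrK mul1r.
  by rewrite iint_hmm_lik// sum_delta.
- by apply/measurable_EFinP; apply: measurable_funM; [exact: mg|exact: smeas_hmm_lik].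
- by apply/measurable_EFinP; apply: measurable_funM; [exact: smeas_compl|exact: smeas_hmm_lik].
- by move=> y; rewrite lee_fin mulr_ge0//; have /andP[] := g01 y.
- by move=> y; rewrite lee_fin mulr_ge0//; have /andP[] := compl01 y.
Qed.

Lemma block_mean01 x : 0 <= block_mean lam Q f g l x <= 1.
Proof.
rewrite block_mean_ge0//=; last by move=> s; have /andP[] := g01 s.
rewrite -subr_ge0 -block_mean_compl block_mean_ge0// => s.
by have /andP[] := compl01 s.
Qed.

Lemma mean_from_lip u v : `|mean_from u - mean_from v| <= l1norm (u - v).
Proof.
rewrite /mean_from -sumrB (le_trans (ler_norm_sum _ _ _))//; apply: ler_sum => x _.
rewrite -mulrBl normrM !mxE ler_piMr// ger0_norm; by have /andP[] := block_mean01 x.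
Qed.

Lemma mean_from01 v : is_dist v -> 0 <= mean_from v <= 1.
Proof.
move=> [v0 v1]; apply/andP; split.
  by apply: sumr_ge0 => x _; rewrite mulr_ge0//; have /andP[] := block_mean01 x.
rewrite -v1; apply: ler_sum => x _; rewrite ler_piMr//.
by have /andP[] := block_mean01 x.
Qed.

(** Mixing is stated for laws, so v is normalised and the zero row treated apart. The bounds scale
    with the mass of v, as [block_exp_moment] requires. *)
Lemma mean_after_gap q w (tau : R) u v : (0 < k)%N -> trans_lb q Q -> is_dist u ->
  2 * (1 - k%:R * q) ^+ w <= tau -> nneg_row v ->
  (mean_from (chain_law w Q u) - tau) * \sum_i v 0 i <= mean_from (chain_law w Q v) <=
  (mean_from (chain_law w Q u) + tau) * \sum_i v 0 i.
Proof.
move=> k0 Hq Hu Ht v0; set V := \sum_i v 0 i.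
have V0 : 0 <= V by exact: sumr_ge0.
have [V1|V1] := eqVneq V 0.
  have v00 : v = 0.
    apply/rowP => i; rewrite mxE; apply/eqP.
    by move/eqP: V1; rewrite psumr_eq0// => /allP/(_ i); rewrite mem_index_enum => /(_ isT).
  have -> : chain_law w Q v = 0.
    by rewrite v00; elim: (w) => //= n ->; rewrite mul0mx.
  rewrite V1 !mulr0 /mean_from big1 ?lexx// => x _; by rewrite mxE mul0r.
have VV : 0 < V by rewrite lt_def V1.
pose v1 := V^-1 *: v.
have Hv1 : is_dist v1.
  split; first by move=> i; rewrite mxE mulr_ge0// invr_ge0.
  under eq_bigr do rewrite mxE.
  by rewrite -mulr_sumr mulVf.
have -> : mean_from (chain_law w Q v) = V * mean_from (chain_law w Q v1).
  have -> : chain_law w Q v = V *: chain_law w Q v1.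
    elim: (w) => [|n IH] /=; first by rewrite /v1 scalerA mulfV ?scale1r.
    by rewrite IH -scalemxAl.
  rewrite /mean_from mulr_sumr; apply: eq_bigr => x _; by rewrite mxE mulrA.
have := mean_from_lip (chain_law w Q v1) (chain_law w Q u).
move=> /le_trans/(_ (chain_law_mixing w k0 Hq Hv1 Hu))/le_trans/(_ Ht).
rewrite ler_distl => /andP[h1 h2].
by rewrite ![_ * V]mulrC !ler_pM2l// h1 h2.
Qed.

End BlockMeans.

(** Uses as many complete gap-plus-block periods as n allows; trailing observations are ignored. *)
Definition block_reject {R : realType} {d : nat} (w l : nat) (g : seq (d.-tuple R) -> R)
    (c : R) (n : nat) : set (n.-tuple (d.-tuple R)) :=
  [set s | (n %/ (w + l))%:R * c <= block_sum g w l (n %/ (w + l)) s].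
Arguments block_reject {R d} w l g c n.

Section BlockTests.
Context {R : realType} {d k : nat} (lam : {measure set (d.-tuple R) -> \bar R}).
Hypothesis hlam : sigma_finite setT lam.
Local Notation Obs := (d.-tuple R).
Hypothesis k0 : (0 < k)%N.
Variables (q tau : R) (w l : nat).
Hypotheses (ht : 0 < tau <= 1) (Hw : 2 * (1 - k%:R * q) ^+ w <= tau / 2).
Implicit Types (g : seq Obs -> R).
Local Notation reject_set := (block_reject w l).
Local Notation kappa := (1 - tau ^+ 2 / 128).

Lemma measurable_reject_set g c n : smeas g -> measurable (reject_set g c n).
Proof. by move=> mg; apply: measurable_ler_set => //; exact: smeas_block_sum. Qed.

(** The threshold exceeds the stationary mean by tau and mixing costs tau / 2, which leaves the
    margin tau / 2 asked by [block_tail]. *)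
Lemma reject_type1 (Q : 'M[R]_k) (f : 'I_k -> Obs -> R) v g n : trans_lb q Q ->
  (forall j, is_density lam (f j)) -> is_stationary Q v ->
  smeas g -> (forall s, 0 <= g s <= 1) ->
  (iint lam (fun s : n.-tuple Obs =>
     (\1_(reject_set g (mean_from lam Q f g l v + tau) n) s * hmm_lik Q f v s)%:E)
   <= (kappa ^+ (n %/ (w + l)))%:E)%E.
Proof.
move=> HQ Hf Hv mg g01; have HQ' := HQ.1; have [Hvd _] := Hv.
have /andP[m0 m1] := mean_from01 hlam HQ' Hf l mg g01 Hvd.
have /andP[t0 t1] := ht.
apply: (block_tail hlam HQ' Hf mg g01) => //.
- by apply/andP; split; lra.
- move=> u u0; have := mean_after_gap hlam HQ' Hf l mg g01 k0 HQ Hvd Hw u0.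
  move=> /andP[_]; rewrite (chain_law_stat w Hv) => /le_trans; apply.
  by rewrite ler_wpM2r ?sumr_ge0//; lra.
- exact: leq_divM.
Qed.

Lemma block_sum_compl g N (s : seq Obs) :
  block_sum (fun s => 1 - g s) w l N s = N%:R - block_sum g w l N s.
Proof.
elim: N s => [|N IH] s /=; first by rewrite subr0.
by rewrite IH -natr1; ring.
Qed.

(** The upper tail bound is applied to 1 - g with threshold 1 - (m + tau). The mean after a gap is
    at least m + 2 tau - tau / 2, which again leaves tau / 2. *)
Lemma reject_type2 (Q : 'M[R]_k) (f : 'I_k -> Obs -> R) v u g (m : R) n : trans_lb q Q ->
  (forall j, is_density lam (f j)) -> is_dist v -> is_dist u -> 0 <= m <= 1 ->
  smeas g -> (forall s, 0 <= g s <= 1) ->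
  m + 2 * tau <= mean_from lam Q f g l (chain_law w Q u) ->
  (iint lam (fun s : n.-tuple Obs =>
     (\1_(~` reject_set g (m + tau) n) s * hmm_lik Q f v s)%:E)
   <= (kappa ^+ (n %/ (w + l)))%:E)%E.
Proof.
move=> HQ Hf Hv Hu /andP[m0 m1] mg g01 Hm; have HQ' := HQ.1.
have /andP[t0 t1] := ht; set N := (n %/ (w + l))%N.
have mg' := smeas_compl mg; have g01' := compl01 g01.
have mf i : measurable_fun setT (f i) by have [] := Hf i.
have f0 i y : 0 <= f i y by have [_ []] := Hf i.
have l0 s : 0 <= hmm_lik Q f v s by apply: hmm_lik_ge0 => //; exact: Hv.1.
have H := @block_tail R d k lam hlam Q f HQ' Hf _ w l (1 - (m + tau)) tau mg' g01' _ ht _ N n v _ Hv.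
apply: le_trans (H _ _ _).
- apply: le_iint => //.
  + apply/measurable_EFinP; apply: measurable_funM; last exact: smeas_hmm_lik.
    by apply: measurable_indic; apply: measurableC; exact: measurable_reject_set.
  + apply/measurable_EFinP; apply: measurable_funM; last exact: smeas_hmm_lik.
    by apply: measurable_indic; apply: measurable_ler_set => //; exact: smeas_block_sum.
  + by move=> s; rewrite lee_fin mulr_ge0.
  + move=> s; rewrite lee_fin ler_wpM2r// !indicE.
    case: (boolP (s \in ~` _)) => [|_]; last by rewrite ler0n.
    rewrite inE /block_reject /= => /negP; rewrite -ltNge -/N => hs.
    by rewrite mem_set// /= block_sum_compl mulrBr mulr1 lerD2l lerN2 ltW.
- by apply/andP; split; lra.
- move=> y y0; under eq_bigr do rewrite block_mean_compl//.
  have /andP[h _] := mean_after_gap hlam HQ' Hf l mg g01 k0 HQ Hu Hw y0.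
  have -> : \sum_x chain_law w Q y 0 x * (1 - block_mean lam Q f g l x) =
     \sum_x y 0 x - mean_from lam Q f g l (chain_law w Q y).
    rewrite -(sum_chain_law w y HQ') -sumrB.
    by apply: eq_bigr => x _; rewrite mulrBr mulr1.
  have Y0 : 0 <= \sum_x y 0 x by exact: sumr_ge0.
  apply: (@le_trans _ _ (\sum_x y 0 x - (m + 2 * tau - tau / 2) * \sum_x y 0 x)).
    by rewrite lerD2l lerN2 (le_trans _ h)//; apply: ler_wpM2r => //; lra.
  by rewrite le_eqVlt; apply/orP; left; apply/eqP; field.
- exact: leq_divM.
Qed.

(** The factor kappa^-1 pays for rounding n / (w + l) down. *)
Lemma kappa_decay n : (0 < w + l)%N ->
  kappa ^+ (n %/ (w + l)) <= kappa^-1 * expR (- (n%:R * (- ln kappa / (w + l)%:R))).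
Proof.
move=> L0; have /andP[t0 t1] := ht.
have t2 : tau ^+ 2 <= 1 by rewrite expr_le1// ltW.
have kp : 0 < kappa by lra.
have kl1 : kappa < 1 by have := exprn_gt0 2 t0; lra.
rewrite [X in _ <= X]mulrC ler_pdivlMr// -exprSr -{1}(lnK kp) -expRM_natl ler_expR.
have lk : ln kappa < 0 by rewrite ln_lt0// kp kl1.
have Lp : 0 < (w + l)%:R :> R by rewrite ltr0n.
have h : n%:R / (w + l)%:R <= (n %/ (w + l)).+1%:R :> R.
  by rewrite ler_pdivrMr// -natrM ler_nat; rewrite ltnW// -ltn_divLR// ltnSn.
have := ler_wnM2r (ltW lk) h; move/le_trans; apply.
by rewrite le_eqVlt; apply/orP; left; apply/eqP; field; rewrite -natrD gt_eqF.
Qed.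

Lemma kappa_rate_gt0 : (0 < w + l)%N -> 0 < - ln kappa / (w + l)%:R.
Proof.
move=> L0; have /andP[t0 t1] := ht.
have t2 : tau ^+ 2 <= 1 by rewrite expr_le1// ltW.
have := exprn_gt0 2 t0 => ht2.
by rewrite divr_gt0 ?ltr0n// oppr_gt0 ln_lt0//; apply/andP; split; lra.
Qed.

End BlockTests.

(** * A consistency criterion with finitely many block tests per sample size *)

Section ConsistencyFromBlocks.
Context {R : realType} {d k : nat} (lam : {measure set (d.-tuple R) -> \bar R}).
Hypothesis hlam : sigma_finite setT lam.
Local Notation Obs := (d.-tuple R).
Variables (Qs : 'M[R]_k) (fs : 'I_k -> Obs -> R).
Hypotheses (Hfs : forall j, is_density lam (fs j)).
Variable vs : 'rV[R]_k.
Local Notation slik := (hmm_lik Qs fs vs).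

Context {dO : measure_display} {Om : measurableType dO} (P : probability Om R).
Variable Yobs : nat -> Om -> Obs.
Hypothesis HYm : forall t, measurable_fun setT (Yobs t).
Hypothesis Hlaw : forall n (A : set (n.-tuple Obs)), (0 < n)%N -> measurable A ->
  P (obs_tuple Yobs n @^-1` A) = iint lam (fun y => (\1_A y * slik y)%:E).

Context {dT : measure_display} {T : measurableType dT}
  (Pi : {sigma_finite_measure set T -> \bar R}).
Hypothesis Pi1 : Pi setT = 1%E.
Variables (Qof : T -> 'M[R]_k) (fof : T -> 'I_k -> Obs -> R).
Hypotheses (HQof : forall s, is_trans (Qof s))
  (HQm : forall i j, measurable_fun setT (fun s => Qof s i j))
  (Hfof : forall t j, is_density lam (fof t j))
  (Hfm : forall j, measurable_fun setT (fun ty : T * Obs => fof ty.1 j ty.2)).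
Variables (mu : 'rV[R]_k).
Hypotheses (Hmu : is_dist mu).
Local Notation lik th y := (hmm_lik (Qof th) (fof th) mu y).
Local Notation obs n w := (obs_tuple Yobs n w).

Variables (q tau : R) (w l : nat).
Hypothesis k0 : (0 < k)%N.
Hypotheses (HQs : trans_lb q Qs) (Hvs : is_stationary Qs vs).
Hypotheses (ht : 0 < tau <= 1) (Hw : 2 * (1 - k%:R * q) ^+ w <= tau / 2).
Hypothesis L0 : (0 < w + l)%N.
Local Notation kappa := (1 - tau ^+ 2 / 128).
Let b : R := - ln kappa / (w + l)%:R.

Variables (M : nat -> nat) (g : nat -> nat -> seq Obs -> R) (K : R).
Hypotheses (mg : forall n i, smeas (g n i)) (g01 : forall n i s, 0 <= g n i s <= 1).
Hypothesis HM : forall n, \sum_(0 <= i < n) (M i)%:R * expR (- (i%:R * b)) <= K.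
Variables (W : nat -> set T) (C r : R).
Hypotheses (C0 : 0 <= C) (r0 : 0 < r) (mW : forall n, measurable (W n)).
Hypothesis PW : forall n, (0 < n)%N -> (Pi (W n) <= (C * expR (- (n%:R * r)))%:E)%E.
Variables (Z B : set T).
Hypotheses (mZ : measurable Z) (PZ : Pi Z = 0%E) (HZ : forall th, ~ Z th -> trans_lb q (Qof th)).
Hypothesis mB : measurable B.
Hypothesis HB : forall n th, (0 < n)%N -> ~ B th -> ~ W n th -> ~ Z th ->
  exists2 i, (i < M n)%N & mean_from lam Qs fs (g n i) l vs + 2 * tau <=
    mean_from lam (Qof th) (fof th) (g n i) l (chain_law w (Qof th) mu).
Hypothesis lower : forall c : R, 0 < c ->
  {ae P, forall w, exists n0, forall n, (n0 <= n)%N ->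
  ((expR (- (n%:R * c)) * slik (obs n w))%:E <= evidence Pi Qof fof mu (obs n w))%E}.

Let HQs' := HQs.1.
Let Hvd : is_dist vs := Hvs.1.
Let f0 t j y : 0 <= fof t j y. Proof. by have [_ []] := Hfof t j. Qed.
Let mf t j : measurable_fun setT (fof t j). Proof. by have [] := Hfof t j. Qed.
Let lik0 th y : 0 <= lik th y.
Proof. by apply: hmm_lik_ge0 => //; exact: Hmu.1. Qed.

Let b0 : 0 < b. Proof. exact: kappa_rate_gt0. Qed.

Let kap0 : 0 < kappa.
Proof.
have /andP[t0 t1] := ht; have : tau ^+ 2 <= 1 by rewrite expr_le1// ltW.
lra.
Qed.

Let cm n i := mean_from lam Qs fs (g n i) l vs.
Let rj n i : set (n.-tuple Obs) := block_reject w l (g n i) (cm n i + tau) n.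
Let Phi n : set (n.-tuple Obs) := \big[setU/set0]_(i < M n) @rj n i.

Let mrj n i : measurable (@rj n i).
Proof. exact: measurable_reject_set. Qed.

Let mPhi n : measurable (@Phi n).
Proof. by apply: bigsetU_measurable => i _; exact: mrj. Qed.

Let typeI : (\sum_(n <oo) P (obs_tuple Yobs n @^-1` (@Phi n)) < +oo)%E.
Proof.
have mobs n (A : set (n.-tuple Obs)) : measurable A -> measurable (obs_tuple Yobs n @^-1` A).
  by move=> mA; rewrite -[X in measurable X]setTI; exact: (measurable_obs_tuple HYm (n:=n)).
have PP n : (0 < n)%N -> (P (obs_tuple Yobs n @^-1` (@Phi n)) <=
    (kappa^-1 * ((M n)%:R * expR (- (n%:R * b))))%:E)%E.
  move=> n0.
  have -> : obs_tuple Yobs n @^-1` (@Phi n) =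
      \big[setU/set0]_(i < M n) (obs_tuple Yobs n @^-1` (@rj n i)).
    by rewrite /Phi (big_morph _ (preimage_setU _) (preimage_set0 _)).
  have H := @Boole_inequality _ _ _ P (fun i => obs_tuple Yobs n @^-1` (@rj n i)) (M n).
  apply: (le_trans (H _)) => [i _|]; first by apply: mobs; exact: mrj.
  apply: (@le_trans _ _ (\sum_(i < M n) (kappa^-1 * expR (- (n%:R * b)))%:E)%E).
    apply: lee_sum => i _; rewrite [X in (X <= _)%E](Hlaw n0 (@mrj n i)).
    apply: (@le_trans _ _ (kappa ^+ (n %/ (w + l)))%:E).
      exact: (reject_type1 hlam k0 l ht Hw n HQs Hfs Hvs (mg n i) (g01 n i)).
    by rewrite lee_fin kappa_decay.
  rewrite sumEFin sumr_const card_ord lee_fin -mulr_natl.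
  by rewrite le_eqVlt; apply/orP; left; apply/eqP; ring.
apply: (@nneseries_bounded _ _ (1 + kappa^-1 * K)) => // n.
(* The indicator of i = 0 bounds the first probability by 1, since [Hlaw] starts at one
   observation. *)
apply: (@le_trans _ _ (\sum_(0 <= i < n) ((i == 0)%:R + kappa^-1 * ((M i)%:R * expR (- (i%:R * b))))%:E)%E).
  apply: lee_sum => i _; case: i => [|i].
    rewrite eqxx (le_trans (probability_le1 _ _))//; first exact: mobs.
    by rewrite lee_fin lerDl mulr_ge0 ?invr_ge0 ?(ltW kap0)// mulr_ge0// expR_ge0.
  by rewrite add0r; exact: PP.
rewrite sumEFin lee_fin big_split /= -mulr_sumr lerD//; last first.
  by rewrite ler_wpM2l// invr_ge0 ltW.
case: n => [|n]; first by rewrite big_geq.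
by rewrite big_nat_recl//= big1 ?addr0.
Qed.

Let rr := Num.min r b.
Let rr0 : 0 < rr. Proof. by rewrite lt_min r0 b0. Qed.

Let typeII n : (0 < n)%N ->
  (\int[Pi]_th ((\1_(~` B) th : R)%:E *
     iint lam (fun y : n.-tuple Obs => (\1_(~` @Phi n) y * lik th y)%:E))
   <= ((C + kappa^-1) * expR (- (n%:R * rr)))%:E)%E.
Proof.
move=> n0; set D := kappa^-1 * expR (- (n%:R * b)).
have D0 : 0 <= D by rewrite mulr_ge0 ?expR_ge0// invr_ge0 ltW.
have mlik th : measurable_fun setT (fun y : n.-tuple Obs => lik th y).
  exact: smeas_hmm_lik.
have mI th (A : set (n.-tuple Obs)) : measurable A ->
    measurable_fun setT (fun y : n.-tuple Obs => (\1_A y * lik th y)%:E).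
  by move=> mA; apply/measurable_EFinP; apply: measurable_funM => //; exact: measurable_indic.
have mIP : measurable_fun setT (fun th => iint lam (fun y : n.-tuple Obs => (\1_(~` @Phi n) y * lik th y)%:E)).
  apply: (measurable_iint_param hlam (F := fun th (y : n.-tuple Obs) => (\1_(~` @Phi n) y * lik th y)%:E)).
    apply/measurable_EFinP; apply: measurable_funM.
      apply: (measurableT_comp (f := (\1_(~` @Phi n) : n.-tuple Obs -> R))) => //.
      by apply: measurable_indic; apply: measurableC; exact: mPhi.
    exact: (@measurable_hmm_lik _ _ _ _ T n Qof fof (fun _ => mu)).
  by move=> th y; rewrite lee_fin mulr_ge0.
have I1 th : (iint lam (fun y : n.-tuple Obs => (\1_(~` @Phi n) y * lik th y)%:E) <= 1)%E.
  have <- : iint lam (fun y : n.-tuple Obs => (lik th y)%:E) = 1%E.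
    by rewrite iint_hmm_lik//; [rewrite Hmu.2|exact: Hmu.1].
  apply: le_iint => //.
  - by apply: mI; apply: measurableC; exact: mPhi.
  - by apply/measurable_EFinP.
  - by move=> y; rewrite lee_fin mulr_ge0.
  - by move=> y; rewrite lee_fin ler_piMl// indicE lern1 leq_b1.
have J1 th : ((\1_(~` B) th : R)%:E *
     iint lam (fun y : n.-tuple Obs => (\1_(~` @Phi n) y * lik th y)%:E) <= 1)%E.
  rewrite -[X in (_ <= X)%E]mule1; apply: lee_pmul => //.
  - by apply: iint_ge0 => y; rewrite lee_fin mulr_ge0.
  - by rewrite lee_fin indicE lern1 leq_b1.
(* Outside W, Z and B some single test detects th, and not rejecting with the union implies not
   rejecting with that test. *)
have pw th : ((\1_(~` B) th : R)%:E *
     iint lam (fun y : n.-tuple Obs => (\1_(~` @Phi n) y * lik th y)%:E) <=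
     (\1_(W n) th : R)%:E + ((\1_Z th : R)%:E + D%:E))%E.
  have [Wth|Wth] := pselect (W n th).
    apply: (@le_trans _ _ 1%E); last first.
      by rewrite indicE mem_set// leeDl// adde_ge0// lee_fin.
    exact: J1.
  have [Zth|Zth] := pselect (Z th).
    apply: (@le_trans _ _ 1%E); last first.
      have -> : (\1_Z th : R) = 1 by rewrite indicE mem_set.
      by rewrite addeCA leeDl// adde_ge0// lee_fin.
    exact: J1.
  have [Bth|Bth] := pselect (B th).
    by rewrite indicE memNset ?mul0e; [rewrite !adde_ge0// lee_fin|exact].
  have [i iM Hi] := HB n0 Bth Wth Zth.
  rewrite indicE mem_set// mul1e !indicE !memNset// !add0e.
  have Hmd := chain_law_dist w (HQof th) Hmu.
  apply: (@le_trans _ _ (iint lam (fun y : n.-tuple Obs => (\1_(~` @rj n i) y * lik th y)%:E))).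
    apply: le_iint => //.
    - by apply: mI; apply: measurableC; exact: mPhi.
    - by apply: mI; apply: measurableC; exact: mrj.
    - by move=> y; rewrite lee_fin mulr_ge0.
    - move=> y; rewrite lee_fin ler_wpM2r// !indicE.
      case: (boolP (y \in ~` @Phi n)) => [|_]; last by rewrite ler0n.
      rewrite inE => hy; rewrite mem_set// => hr; apply: hy.
      by rewrite /Phi -bigcup_mkord; exists i.
  have m01 := mean_from01 hlam HQs' Hfs l (mg n i) (g01 n i) Hvd.
  apply: (@le_trans _ _ (kappa ^+ (n %/ (w + l)))%:E).
    exact: (reject_type2 hlam k0 ht Hw n (HZ Zth) (Hfof th) Hmu Hmu m01 (mg n i) (g01 n i) Hi).
  by rewrite lee_fin kappa_decay.
have mind (A : set T) : measurable A -> measurable_fun setT (fun th => (\1_A th : R)%:E).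
  by move=> mA; apply/measurable_EFinP; exact: measurable_indic.
apply: (@le_trans _ _ (\int[Pi]_th ((\1_(W n) th : R)%:E + ((\1_Z th : R)%:E + D%:E)))%E).
  apply: ge0_le_integral => //.
  - move=> th _; rewrite mule_ge0 ?lee_fin//; apply: iint_ge0 => y; by rewrite lee_fin mulr_ge0.
  - by apply: emeasurable_funM => //; apply: mind; exact: measurableC.
  - apply: emeasurable_funD; first exact: mind.
    by apply: emeasurable_funD => //; exact: mind.
rewrite ge0_integralD//; first last.
- by apply: emeasurable_funD => //; exact: mind.
- by move=> th _; rewrite adde_ge0// lee_fin.
- exact: mind.
rewrite ge0_integralD//; last exact: mind.
rewrite integral_indic// integral_indic// integral_cst// !setIT.
rewrite [X in (_ + (X + _))%E](_ : _ = 0%E)//.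
rewrite [X in (_ + (_ + _ * X))%E](_ : _ = 1%E)// mule1 add0e.
apply: (@le_trans _ _ ((C * expR (- (n%:R * r)))%:E + D%:E)%E).
  by apply: leeD => //; exact: PW.
rewrite -EFinD lee_fin mulrDl; apply: lerD.
- apply: ler_wpM2l => //; rewrite ler_expR lerN2; apply: ler_wpM2l => //.
  by rewrite ge_min lexx.
- apply: ler_wpM2l; first by rewrite invr_ge0 ltW.
  rewrite ler_expR lerN2; apply: ler_wpM2l => //.
  by rewrite ge_min lexx orbT.
Qed.

(** [W n] holds the parameters outside a sieve, of exponentially small prior mass, and [Z] is the
    null set outside which Q >= q. Every other parameter outside B is separated by 2 tau from the
    truth by a test of the family; [HM] makes the union of the tests summable. *)
Lemma consistency_from_blocks (A : set T) : B `<=` A ->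
  {ae P, forall w, post_mass Pi Qof fof mu A (obs n w) @[n --> \oo] --> (1 : R)}.
Proof.
move=> BA.
apply: (posterior_consistent_from_tests hlam HQs' Hfs Hvd HYm Hlaw Pi1 HQof HQm Hfof
  Hfm Hmu mB mPhi _ rr0 typeI typeII) => //.
- by rewrite addr_ge0// invr_ge0 ltW.
- by apply: lower; rewrite divr_gt0.
Qed.

End ConsistencyFromBlocks.

(** * Measurability of continuous test functions *)

Section ContinuousMeasurable.
Context {R : realType} {d n : nat}.
Local Notation Obs := (d.-tuple R).

Let disc m (y : n.-tuple Obs) : n.-tuple (d.-tuple int) :=
  [tuple [tuple Num.floor (m.+1%:R * tnth (tnth y t) i) | i < d] | t < n].
Let undisc m (c : n.-tuple (d.-tuple int)) : n.-tuple Obs :=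
  [tuple [tuple (tnth (tnth c t) i)%:~R / m.+1%:R | i < d] | t < n].

Let disc_err m y t i :
  `|tnth (tnth (undisc m (disc m y)) t) i - tnth (tnth y t) i| <= m.+1%:R^-1.
Proof.
rewrite !tnth_mktuple; set x := tnth (tnth y t) i.
have m0 : 0 < m.+1%:R :> R by rewrite ltr0n.
have h1 := floor_le_tmp (m.+1%:R * x); have h2 := floorD1_gt (m.+1%:R * x).
have -> : (Num.floor (m.+1%:R * x))%:~R / m.+1%:R - x =
   ((Num.floor (m.+1%:R * x))%:~R - m.+1%:R * x) / m.+1%:R by field; rewrite gt_eqF.
rewrite normrM [`|_^-1|]ger0_norm ?invr_ge0 ?ler0n//.
rewrite -[X in _ <= X]mul1r ler_wpM2r ?invr_ge0 ?ler0n//.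
rewrite ler_norml; move: h2; rewrite intrD; move: h1.
by move: (Num.floor _)%:~R => z; lra.
Qed.

(** g is the pointwise limit of its values at points rounded down to the grid of mesh 1 / (m + 1).
    Each approximation is constant on countably many cells, which are finite intersections of
    coordinate strips. *)
Lemma tcont_measurable (g : n.-tuple Obs -> R) : tcont g -> measurable_fun setT g.
Proof.
move=> cg; apply: (@measurable_fun_cvg _ _ _ _ (fun m y => g (undisc m (disc m y)))).
- move=> m _ Y mY; rewrite setTI.
  rewrite (_ : _ @^-1` Y = \bigcup_(c in [set: n.-tuple (d.-tuple int)])
     ([set y | disc m y = c /\ Y (g (undisc m c))])); last first.
    apply/seteqP; split => [y Yy|y [c _ [<- //]]].
    by exists (disc m y).
  apply: countable_bigcupT_measurable; first exact: countableP.
  move=> c; have [Yc|Yc] := pselect (Y (g (undisc m c))); last first.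
    rewrite (_ : mkset _ = set0)//; apply/seteqP; split => // y [_ //].
  rewrite (_ : mkset _ = \bigcap_(t in [set: 'I_n]) \bigcap_(i in [set: 'I_d])
    ([set y : n.-tuple Obs | (tnth (tnth c t) i)%:~R <= m.+1%:R * tnth (tnth y t) i] `&`
     [set y : n.-tuple Obs | m.+1%:R * tnth (tnth y t) i < (tnth (tnth c t) i)%:~R + 1])).
    apply: fin_bigcap_measurable => // t _; apply: fin_bigcap_measurable => // i _.
    have mty : measurable_fun setT (fun y : n.-tuple Obs => m.+1%:R * tnth (tnth y t) i).
      apply: measurable_funM => //.
      apply: (measurableT_comp (f := fun z : Obs => tnth z i)); first exact: measurable_tnth.
      exact: measurable_tnth.
    by apply: measurableI; [apply: measurable_ler_set|apply: measurable_ltr_set].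
  apply/seteqP; split => [y [<- _] t _ i _|y Hy] /=.
    rewrite !tnth_mktuple floor_le_tmp; split => //.
    by have := floorD1_gt (m.+1%:R * tnth (tnth y t) i); rewrite intrD.
  split => //; apply: eq_from_tnth => t; apply: eq_from_tnth => i.
  rewrite !tnth_mktuple; have [/= h1 h2] := Hy t I i I.
  by apply: floor_def; rewrite h1 intrD h2.
- move=> y _; apply/cvgrPdist_lt => e e0.
  have [del del0 Hdel] := cg y e e0.
  near=> m; rewrite distrC; apply: Hdel => t i.
  apply: (le_lt_trans (disc_err m y t i)).
  near: m; exact: near_infty_natSinv_lt (PosNum del0).
Unshelve. all: by end_near.
Qed.

End ContinuousMeasurable.

(** * A finite grid of transition matrices *)

Section Grid.
Context {R : realType} {k : nat}.

(** Entries are rounded down to multiples of 1 / m, so two matrices in one cell differ by at most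
    eta. A cell is represented by one of its own members with entries at least q, so the grid
    consists of genuine transition matrices; [Q0] fills empty cells and surplus indices. *)
Lemma transition_grid (q eta : R) (Q0 : 'M[R]_k) : 0 < eta -> trans_lb q Q0 ->
  exists (G : nat) (Qg : nat -> 'M[R]_k), (0 < G)%N /\ (forall i, trans_lb q (Qg i)) /\
    forall Q, trans_lb q Q -> exists2 i, (i < G)%N & forall a b, `|Q a b - Qg i a b| <= eta.
Proof.
move=> eta0 H0; pose m := (Num.trunc eta^-1).+1.
have m0 : 0 < m%:R :> R by rewrite ltr0n.
have hm : m%:R^-1 <= eta.
  rewrite -[eta]invrK lef_pV2 ?posrE ?invr_gt0// ltW//.
  by rewrite truncnS_gt.
pose cell (Q : 'M[R]_k) : {ffun 'I_k * 'I_k -> 'I_m.+1} :=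
  [ffun p => inord (Num.trunc (m%:R * Q p.1 p.2))].
pose F := {ffun 'I_k * 'I_k -> 'I_m.+1}.
pose rep (c : F) : 'M[R]_k := xget Q0 [set Q | trans_lb q Q /\ cell Q = c].
have rep_lb c : trans_lb q (rep c).
  by rewrite /rep; case: xgetP => [Q -> []|].
exists #|{: F}|, (fun i => if insub i is Some j then rep (enum_val (j : 'I_#|{: F}|)) else Q0).
split; [|split].
- by apply/card_gt0P; exists [ffun => ord0].
- by move=> i; case: insubP.
move=> Q HQ; exists (enum_rank (cell Q)); first exact: ltn_ord.
move=> a b; rewrite valK enum_rankK.
have [HR Rc] : trans_lb q (rep (cell Q)) /\ cell (rep (cell Q)) = cell Q.
  by apply: (xgetPex Q0 (P := [set Q' | trans_lb q Q' /\ cell Q' = cell Q])); exists Q.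
move: (rep (cell Q)) HR Rc => Q' HR Rc.
have tr (Q1 : 'M[R]_k) : trans_lb q Q1 -> (Num.trunc (m%:R * Q1 a b))%:R <= m%:R * Q1 a b < (Num.trunc (m%:R * Q1 a b))%:R + 1 /\ (Num.trunc (m%:R * Q1 a b) < m.+1)%N.
  move=> [HQ1 _]; have Qp : 0 <= m%:R * Q1 a b by rewrite mulr_ge0 ?ler0n// trans_ge0.
  have h : (Num.trunc (m%:R * Q1 a b))%:R <= m%:R * Q1 a b < (Num.trunc (m%:R * Q1 a b))%:R + 1.
    by rewrite natr1; exact: truncn_itv.
  split => //; rewrite ltnS -(ler_nat R); case/andP: h => h _; apply: (le_trans h).
  by rewrite ler_piMr ?ler0n// trans_le1.
have [/andP[h1 h2] h3] := tr Q HQ; have [/andP[h4 h5] h6] := tr Q' HR.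
have : cell Q' (a, b) = cell Q (a, b) by rewrite Rc.
rewrite !ffunE /= => /(congr1 val); rewrite /= !inordK// => E.
rewrite E in h4 h5.
apply: le_trans hm; rewrite -(ler_pM2l m0) mulfV ?gt_eqF//.
rewrite -{1}(ger0_norm (ltW m0)) -normrM mulrBr ler_norml.
move: (m%:R * Q a b) (m%:R * Q' a b) (_%:R) h1 h2 h4 h5 => x y t; lra.
Qed.

End Grid.

(** * L1 continuity of the likelihood in all parameters *)

Section Perturbation.
Context {R : realType} {d k : nat} (lam : {measure set (d.-tuple R) -> \bar R}).
Hypothesis hlam : sigma_finite setT lam.
Local Notation Obs := (d.-tuple R).
Variables (Q Q' : 'M[R]_k) (f f' : 'I_k -> Obs -> R).
Hypotheses (HQ : is_trans Q) (Hf : forall j, is_density lam (f j)).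
Hypotheses (HQ' : is_trans Q') (Hf' : forall j, is_density lam (f' j)).

Let mf i : measurable_fun setT (f i). Proof. by have [] := Hf i. Qed.
Let f0 i y : 0 <= f i y. Proof. by have [_ []] := Hf i. Qed.
Let f1 i : (\int[lam]_y (f i y)%:E = 1)%E. Proof. by have [_ []] := Hf i. Qed.
Let mf' i : measurable_fun setT (f' i). Proof. by have [] := Hf' i. Qed.
Let f0' i y : 0 <= f' i y. Proof. by have [_ []] := Hf' i. Qed.
Let f1' i : (\int[lam]_y (f' i y)%:E = 1)%E. Proof. by have [_ []] := Hf' i. Qed.

Variables (dd eta : R).
Hypotheses (dd0 : 0 <= dd) (eta0 : 0 <= eta).
Hypothesis Hdd : forall i, (\int[lam]_y (`|f i y - f' i y|)%:E <= dd%:E)%E.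
Hypothesis Heta : forall i j, `|Q i j - Q' i j| <= eta.

Implicit Types (u v : 'rV[R]_k).
Let W := dd + k%:R * eta.

Let smeas_l1 u u' : smeas (fun s => l1norm (hmm_fwd Q f u s - hmm_fwd Q' f' u' s)).
Proof.
move=> n; apply: measurable_sum => j; apply: measurableT_comp => //.
under eq_fun do rewrite !mxE.
by apply: measurable_funB; apply: smeas_hmm_fwd.
Qed.

(** The product u f Q is telescoped one factor at a time; the errors in f and Q are weighted by u',
    the row assumed nonnegative. *)
Let step_pert u u' z : nneg_row u' ->
  l1norm (hmm_step Q f u z - hmm_step Q' f' u' z) <=
  \sum_i (`|u 0 i - u' 0 i| * f i z + u' 0 i * (`|f i z - f' i z| + k%:R * eta * f' i z)).
Proof.
move=> u0'; rewrite /l1norm.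
apply: (@le_trans _ _ (\sum_j \sum_i (`|u 0 i - u' 0 i| * f i z * Q i j +
    u' 0 i * (`|f i z - f' i z| * Q i j + f' i z * eta)))).
  apply: ler_sum => j _; rewrite !mxE -sumrB.
  rewrite (le_trans (ler_norm_sum _ _ _))//; apply: ler_sum => i _.
  have -> : u 0 i * f i z * Q i j - u' 0 i * f' i z * Q' i j =
     (u 0 i - u' 0 i) * f i z * Q i j + u' 0 i * ((f i z - f' i z) * Q i j + f' i z * (Q i j - Q' i j)) by ring.
  have Q0 : 0 <= Q i j by exact: trans_ge0.
  rewrite (le_trans (ler_normD _ _))//; apply: lerD.
    by rewrite !normrM (ger0_norm (f0 i z)) (ger0_norm Q0).
  rewrite normrM (ger0_norm (u0' i)) ler_wpM2l// (le_trans (ler_normD _ _))//.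
  rewrite !normrM (ger0_norm Q0) (ger0_norm (f0' i z)) lerD2l ler_wpM2l//.
rewrite exchange_big /=; apply: ler_sum => i _.
rewrite big_split /= -mulr_sumr -mulr_sumr big_split /= -mulr_sumr !trans_sum1// !mulr1.
rewrite sumr_const card_ord lerD2l ler_wpM2l// lerD2l -mulr_natl.
by rewrite le_eqVlt; apply/orP; left; apply/eqP; ring.
Qed.

Let step_int u u' : nneg_row u' ->
  (\int[lam]_z (\sum_i (`|u 0 i - u' 0 i| * f i z + u' 0 i * (`|f i z - f' i z| + k%:R * eta * f' i z)))%:E
   <= (l1norm (u - u') + W * \sum_i u' 0 i)%:E)%E.
Proof.
move=> u0'.
have E : l1norm (u - u') + W * \sum_i u' 0 i = \sum_i (`|u 0 i - u' 0 i| + u' 0 i * W).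
  rewrite big_split /= mulr_sumr; congr (_ + _); apply: eq_bigr => i _; first by rewrite !mxE.
  by rewrite mulrC.
have c0 : 0 <= k%:R * eta by rewrite mulr_ge0.
have mdf i : measurable_fun setT (fun z => (`|f i z - f' i z|)%:E).
  by apply/measurable_EFinP; apply: measurableT_comp => //; apply: measurable_funB.
rewrite E; under eq_integral do rewrite -sumEFin.
rewrite ge0_integral_sum//; first last.
- move=> i z _; rewrite lee_fin addr_ge0// ?mulr_ge0// ?addr_ge0// mulr_ge0//.
- move=> i; apply/measurable_EFinP; apply: measurable_funD; first exact: measurable_funM.
  apply: measurable_funM => //; apply: measurable_funD; last exact: measurable_funM.
  by apply: measurableT_comp => //; apply: measurable_funB.
rewrite -sumEFin; apply: lee_sum => i _.
have E2 z : (`|u 0 i - u' 0 i| * f i z + u' 0 i * (`|f i z - f' i z| + k%:R * eta * f' i z))%:E =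
   ((`|u 0 i - u' 0 i|)%:E * (f i z)%:E + ((u' 0 i)%:E * (`|f i z - f' i z|)%:E +
     (u' 0 i * (k%:R * eta))%:E * (f' i z)%:E))%E.
  by rewrite -!EFinM -!EFinD; congr EFin; ring.
under eq_integral do rewrite E2.
have ef : measurable_fun setT (fun z => (f i z)%:E) by exact/measurable_EFinP.
have ef' : measurable_fun setT (fun z => (f' i z)%:E) by exact/measurable_EFinP.
have p1 : (0 <= (`|u 0 i - u' 0 i|)%:E)%E by rewrite lee_fin.
have p2 : (0 <= (u' 0 i)%:E)%E by rewrite lee_fin.
have p3 : (0 <= (u' 0 i * (k%:R * eta))%:E)%E by rewrite lee_fin mulr_ge0.
have q1 z : (0 <= (f i z)%:E)%E by rewrite lee_fin.
have q2 z : (0 <= (`|f i z - f' i z|)%:E)%E by rewrite lee_fin.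
have q3 z : (0 <= (f' i z)%:E)%E by rewrite lee_fin.
rewrite ge0_integralD//; first last.
- by apply: emeasurable_funD; apply: measurable_funeM.
- by move=> z _; apply: adde_ge0; apply: mule_ge0.
- exact: measurable_funeM.
- by move=> z _; apply: mule_ge0.
rewrite ge0_integralD//; first last.
- exact: measurable_funeM.
- by move=> z _; apply: mule_ge0.
- exact: measurable_funeM.
- by move=> z _; apply: mule_ge0.
rewrite !ge0_integralZl// f1 f1' !mule1.
rewrite EFinD; apply: leeD => //.
rewrite /W mulrDr EFinD; apply: leeD => //.
by rewrite EFinM; apply: lee_wpmul2l.
Qed.

(** Each observation costs W times the mass of u', and integration under the primed model preserves
    that mass, so the errors add up linearly in n. *)
Lemma hmm_fwd_perturb n u u' : nneg_row u' ->
  (iint lam (fun s : n.-tuple Obs => (l1norm (hmm_fwd Q f u s - hmm_fwd Q' f' u' s))%:E)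
   <= (l1norm (u - u') + n%:R * W * \sum_i u' 0 i)%:E)%E.
Proof.
have W0 : 0 <= W by rewrite addr_ge0// mulr_ge0.
elim: n u u' => [|n IH] u u' u0'; first by rewrite /= mul0r mul0r addr0.
rewrite /=.
have mX : measurable_fun setT (fun z => \sum_i (`|u 0 i - u' 0 i| * f i z +
    u' 0 i * (`|f i z - f' i z| + k%:R * eta * f' i z))).
  apply: measurable_sum => i; apply: measurable_funD; first exact: measurable_funM.
  apply: measurable_funM => //; apply: measurable_funD; last exact: measurable_funM.
  by apply: measurableT_comp => //; apply: measurable_funB.
have X0 z : 0 <= \sum_i (`|u 0 i - u' 0 i| * f i z +
    u' 0 i * (`|f i z - f' i z| + k%:R * eta * f' i z)).
  apply: sumr_ge0 => i _.
  by rewrite addr_ge0// ?mulr_ge0// ?addr_ge0// mulr_ge0// mulr_ge0.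
have mY : measurable_fun setT (fun z => \sum_i (u' 0 i * f' i z)).
  by apply: measurable_sum => i; exact: measurable_funM.
have Y0 z : 0 <= \sum_i (u' 0 i * f' i z) by apply: sumr_ge0 => i _; rewrite mulr_ge0.
have nW : (0 <= (n%:R * W)%:E)%E by rewrite lee_fin mulr_ge0.
apply: (@le_trans _ _ (\int[lam]_z ((\sum_i (`|u 0 i - u' 0 i| * f i z +
    u' 0 i * (`|f i z - f' i z| + k%:R * eta * f' i z)))%:E +
    (n%:R * W)%:E * (\sum_i (u' 0 i * f' i z))%:E))%E).
  apply: ge0_le_integral => //.
  - by move=> z _; apply: iint_ge0 => s; rewrite lee_fin l1norm_ge0.
  - have H := @smeas_l1 u u' n.+1.
    apply: (@measurable_iint_cons _ _ _ hlam _ (fun s : n.+1.-tuple Obs => (l1norm (hmm_fwd Q f u s - hmm_fwd Q' f' u' s))%:E)).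
      exact/measurable_EFinP.
    by move=> y; rewrite lee_fin l1norm_ge0.
  - by apply: emeasurable_funD; [|apply: measurable_funeM]; exact/measurable_EFinP.
  - move=> z _; apply: (le_trans (IH _ _ _)); first exact: hmm_step_ge0.
    by rewrite -EFinM -EFinD lee_fin sum_hmm_step// lerD2r step_pert.
rewrite ge0_integralD//; first last.
- by apply: measurable_funeM; exact/measurable_EFinP.
- by move=> z _; rewrite mule_ge0// lee_fin.
- exact/measurable_EFinP.
- by move=> z _; rewrite lee_fin.
rewrite ge0_integralZl//; first last.
- by move=> z _; rewrite lee_fin.
- exact/measurable_EFinP.
have -> : (\int[lam]_z (\sum_i (u' 0 i * f' i z))%:E = (\sum_i u' 0 i)%:E)%E.
  have := integral_hmm_step HQ' Hf' (c := fun=> 1) u0' (fun=> ler01).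
  under [in X in X -> _]eq_bigr do rewrite mulr1.
  rewrite sum_mulmx_trans// => <-; apply: eq_integral => z _; congr EFin.
  by under [RHS]eq_bigr do rewrite mulr1; rewrite sum_hmm_step.
rewrite -EFinM; apply: (@le_trans _ _ ((l1norm (u - u') + W * \sum_i u' 0 i)%:E +
   (n%:R * W * \sum_i u' 0 i)%:E)%E).
  by apply: leeD => //; exact: step_int.
rewrite -EFinD lee_fin -natr1 le_eqVlt; apply/orP; left; apply/eqP; ring.
Qed.

Lemma hmm_lik_perturb n u u' : nneg_row u' ->
  (iint lam (fun s : n.-tuple Obs => (`|hmm_lik Q f u s - hmm_lik Q' f' u' s|)%:E)
   <= (l1norm (u - u') + n%:R * W * \sum_i u' 0 i)%:E)%E.
Proof.
move=> u0'; apply: le_trans (hmm_fwd_perturb n u u0'); apply: le_iint => //.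
- apply/measurable_EFinP; apply: measurableT_comp => //.
  by apply: measurable_funB; exact: smeas_hmm_lik.
- by apply/measurable_EFinP; exact: smeas_l1.
- move=> s; rewrite lee_fin /hmm_lik -sumrB (le_trans (ler_norm_sum _ _ _))//.
  by apply: ler_sum => j _; rewrite !mxE.
Qed.

End Perturbation.

(** * Signed bounded functions turned into [0, 1]-valued tests *)

Section SignedBlocks.
Context {R : realType} {d k : nat} (lam : {measure set (d.-tuple R) -> \bar R}).
Hypothesis hlam : sigma_finite setT lam.
Local Notation Obs := (d.-tuple R).
Variables (Q : 'M[R]_k) (f : 'I_k -> Obs -> R).
Hypotheses (HQ : is_trans Q) (Hf : forall j, is_density lam (f j)).
Local Notation lik := (hmm_lik Q f).

Let mf i : measurable_fun setT (f i). Proof. by have [] := Hf i. Qed.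
Let f0 i y : 0 <= f i y. Proof. by have [_ []] := Hf i. Qed.

Lemma smeas_cons (G : seq Obs -> R) z : smeas G -> smeas (fun s => G (z :: s)).
Proof.
move=> mG n; apply: (measurableT_comp (f := fun y : n.+1.-tuple Obs => G y)
  (g := fun t : n.-tuple Obs => [tuple of z :: t])); first exact: mG.
exact: measurable_cons_section.
Qed.

(** The linearity lemmas for [iint] concern nonnegative integrands, whereas weak neighborhoods
    involve signed functions. The shift by M is subtracted one coordinate at a time, where both
    parts are integrable. *)
Lemma iint_signed (G : seq Obs -> R) (M : R) n v : smeas G -> (forall s, `|G s| <= M) ->
  nneg_row v ->
  (iint lam (fun s : n.-tuple Obs => (G s * lik v s)%:E) =
   iint lam (fun s : n.-tuple Obs => ((G s + M) * lik v s)%:E) - (M * \sum_i v 0 i)%:E)%E.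
Proof.
elim: n G v => [|n IH] G v mG GM v0.
  by rewrite /= -EFinB; congr EFin; rewrite mulrDl addrK.
have M0 : 0 <= M by apply: le_trans (GM [::]).
have GM0 s : 0 <= G s + M <= 2 * M by have := GM s; rewrite ler_norml => /andP[? ?]; lra.
rewrite /=; pose A z := iint lam (fun t : n.-tuple Obs => ((G (z :: t) + M) * lik v (z :: t))%:E).
pose D z := (M * \sum_i hmm_step Q f v z 0 i)%:E.
have mA : measurable_fun setT A.
  apply: (@measurable_iint_cons _ _ _ hlam _ (fun s : n.+1.-tuple Obs => ((G s + M) * lik v s)%:E)).
    apply/measurable_EFinP; apply: measurable_funM; last exact: smeas_hmm_lik.
    by apply: measurable_funD => //; exact: mG.
  move=> s; rewrite lee_fin mulr_ge0//; last by apply: hmm_lik_ge0.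
  by have /andP[] := GM0 s.
have A0 z : (0 <= A z)%E.
  apply: iint_ge0 => s; rewrite lee_fin mulr_ge0//; last by apply: hmm_lik_ge0.
  by have /andP[] := GM0 (z :: s).
have mD : measurable_fun setT D.
  apply/measurable_EFinP; apply: measurable_funM => //.
  under eq_fun do rewrite sum_hmm_step//.
  by apply: measurable_sum => i; exact: measurable_funM.
have D0 z : (0 <= D z)%E.
  by rewrite lee_fin mulr_ge0// sumr_ge0// => i _; apply: hmm_step_ge0.
have ID : (\int[lam]_z D z = (M * \sum_i v 0 i)%:E)%E.
  have := integral_hmm_step HQ Hf (c := fun=> M) v0 (fun=> M0).
  rewrite -mulr_suml mulrC sum_mulmx_trans// => <-; apply: eq_integral => z _.
  by rewrite /D -mulr_suml mulrC.
have IA : (\int[lam]_z A z < +oo)%E.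
  apply: (@le_lt_trans _ _ ((2 * M)%:E * iint lam (fun s : n.+1.-tuple Obs => (lik v s)%:E))%E); last first.
    by rewrite iint_hmm_lik// -EFinM ltry.
  rewrite -iintZl//; first last.
  - by move=> s; rewrite lee_fin hmm_lik_ge0.
  - by apply/measurable_EFinP; exact: smeas_hmm_lik.
  - by rewrite lee_fin mulr_ge0.
  apply: (@le_iint _ _ _ hlam n.+1 (fun s => ((G s + M) * lik v s)%:E)).
  - apply/measurable_EFinP; apply: measurable_funM; last exact: smeas_hmm_lik.
    by apply: measurable_funD => //; exact: mG.
  - by apply: measurable_funeM; apply/measurable_EFinP; exact: smeas_hmm_lik.
  - move=> s; rewrite lee_fin mulr_ge0//; last by apply: hmm_lik_ge0.
    by have /andP[] := GM0 s.
  - move=> s; rewrite -EFinM lee_fin ler_wpM2r//; first by apply: hmm_lik_ge0.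
    by have /andP[] := GM0 s.
have -> : (\int[lam]_z iint lam (fun t : n.-tuple Obs => (G (z :: t) * lik v (z :: t))%:E) =
           \int[lam]_z (A \- D) z)%E.
  apply: eq_integral => z _; rewrite /= /A /D.
  by rewrite -(IH (fun s => G (z :: s)))//; [exact: smeas_cons|exact: hmm_step_ge0].
rewrite integralB//; first by rewrite ID.
- apply/integrableP; split => //; under eq_integral do rewrite gee0_abs//.
  exact: IA.
- apply/integrableP; split => //; under eq_integral do rewrite gee0_abs//.
  by rewrite ID ltry.
Qed.

(** The value 0 off length l makes a function of l-tuples a function of sequences, as the block
    machinery expects. *)
Definition seq_ext l (g : l.-tuple Obs -> R) (s : seq Obs) : R :=
  if insub s is Some t then g t else 0.

Lemma seq_extE l (g : l.-tuple Obs -> R) (y : l.-tuple Obs) : seq_ext g y = g y.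
Proof. by rewrite /seq_ext valK. Qed.

Lemma smeas_seq_ext l (g : l.-tuple Obs -> R) : measurable_fun setT g -> smeas (seq_ext g).
Proof.
move=> mg n; have [<-|nl] := eqVneq l n.
  by under eq_fun do rewrite seq_extE.
rewrite (_ : (fun y => _) = cst 0)//; apply/funext => y.
by rewrite /seq_ext insubF// size_tuple eq_sym (negbTE nl).
Qed.

Lemma iint_bounded_test l (g : l.-tuple Obs -> R) (M : R) v : measurable_fun setT g ->
  0 < M -> (forall y, `|g y| <= M) -> is_dist v ->
  let h s := (seq_ext g s + M) / (2 * M) in
  [/\ smeas h, (forall s, 0 <= h s <= 1) &
   iint lam (fun y : l.-tuple Obs => (g y * lik v y)%:E) =
   (2 * M * mean_from lam Q f h l v - M)%:E].
Proof.
move=> mg M0 gM [v0 v1] h.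
have mG := smeas_seq_ext mg.
have GM s : `|seq_ext g s| <= M.
  by rewrite /seq_ext; case: insubP => [t _ _|_]; [exact: gM|rewrite normr0 ltW].
have mh : smeas h.
  move=> n; apply: measurable_funM => //; apply: measurable_funD => //; exact: mG.
have h01 s : 0 <= h s <= 1.
  have := GM s; rewrite ler_norml => /andP[? ?]; apply/andP; split.
    by rewrite divr_ge0//; lra.
  by rewrite ler_pdivrMr//; lra.
split => //.
under eq_iint do rewrite -seq_extE.
rewrite (iint_signed _ mG GM v0) v1 mulr1 EFinB; congr (_ - _)%E.
rewrite EFinM /mean_from -(block_mean_linear hlam HQ Hf _ mh h01 v0) -iintZl//.
- apply: eq_iint => y; rewrite -EFinM /h; congr EFin.
  by field; rewrite gt_eqF.
- by rewrite lee_fin mulr_ge0// ltW.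
- apply/measurable_EFinP; apply: measurable_funM; first exact: mh.
  exact: smeas_hmm_lik.
- by move=> y; rewrite lee_fin mulr_ge0 ?hmm_lik_ge0//; have /andP[] := h01 y.
Qed.

Lemma mean_from_compl g l v : smeas g -> (forall s, 0 <= g s <= 1) -> is_dist v ->
  mean_from lam Q f (fun s => 1 - g s) l v = 1 - mean_from lam Q f g l v.
Proof.
move=> mg g01 [_ v1]; rewrite /mean_from -[in RHS]v1 -sumrB; apply: eq_bigr => x _.
by rewrite block_mean_compl// mulrBr mulr1.
Qed.

End SignedBlocks.

(** * Scheffe's identity *)

Section L1Separation.
Context {R : realType} {d k : nat} (lam : {measure set (d.-tuple R) -> \bar R}).
Hypothesis hlam : sigma_finite setT lam.
Local Notation Obs := (d.-tuple R).
Variables (Q1 Q2 : 'M[R]_k) (f1 f2 : 'I_k -> Obs -> R) (u1 u2 : 'rV[R]_k).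
Hypotheses (HQ1 : is_trans Q1) (Hf1 : forall j, is_density lam (f1 j)) (Hu1 : is_dist u1).
Hypotheses (HQ2 : is_trans Q2) (Hf2 : forall j, is_density lam (f2 j)) (Hu2 : is_dist u2).
Local Notation p1 := (hmm_lik Q1 f1 u1).
Local Notation p2 := (hmm_lik Q2 f2 u2).

Definition larger_on (s : seq Obs) : R := if p2 s < p1 s then 1 else 0.

Let mf1 i : measurable_fun setT (f1 i). Proof. by have [] := Hf1 i. Qed.
Let mf2 i : measurable_fun setT (f2 i). Proof. by have [] := Hf2 i. Qed.
Let p10 s : 0 <= p1 s.
Proof. by apply: hmm_lik_ge0 => //; [move=> j y; have [_ []] := Hf1 j|exact: Hu1.1]. Qed.
Let p20 s : 0 <= p2 s.
Proof. by apply: hmm_lik_ge0 => //; [move=> j y; have [_ []] := Hf2 j|exact: Hu2.1]. Qed.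
Let mp1 n : measurable_fun setT (fun y : n.-tuple Obs => p1 y).
Proof. exact: smeas_hmm_lik. Qed.
Let mp2 n : measurable_fun setT (fun y : n.-tuple Obs => p2 y).
Proof. exact: smeas_hmm_lik. Qed.

Lemma smeas_larger_on : smeas larger_on.
Proof.
move=> n; apply: measurable_fun_ifT => //.
by apply: measurable_fun_ltr; [exact: mp2|exact: mp1].
Qed.

Lemma larger_on01 s : 0 <= larger_on s <= 1.
Proof. by rewrite /larger_on; case: ifP => _; rewrite ?lexx ?ler01. Qed.

(** Proved as D + 2 m2 + 1 = 2 m1 + 1, from |p1 - p2| + 2 g p2 + p1 = 2 g p1 + p2 with g the
    indicator of p2 < p1. No infinite integrals are subtracted, and finiteness of D comes out of the
    equation. *)
Lemma iint_L1_larger l :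
  iint lam (fun y : l.-tuple Obs => (`|p1 y - p2 y|)%:E) =
  (2 * (mean_from lam Q1 f1 larger_on l u1 - mean_from lam Q2 f2 larger_on l u2))%:E.
Proof.
set m1 := mean_from _ Q1 _ _ _ _; set m2 := mean_from _ Q2 _ _ _ _.
set D := iint _ _.
have mg := smeas_larger_on; have g01 := larger_on01.
have g0 s : 0 <= larger_on s by have /andP[] := g01 s.
have E1 : iint lam (fun y : l.-tuple Obs => (larger_on y * p1 y)%:E) = m1%:E.
  exact: (block_mean_linear hlam HQ1 Hf1 _ mg g01 Hu1.1).
have E2 : iint lam (fun y : l.-tuple Obs => (larger_on y * p2 y)%:E) = m2%:E.
  exact: (block_mean_linear hlam HQ2 Hf2 _ mg g01 Hu2.1).
have E3 : iint lam (fun y : l.-tuple Obs => (p1 y)%:E) = 1%E.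
  by rewrite iint_hmm_lik//; [rewrite Hu1.2|exact: Hu1.1].
have E4 : iint lam (fun y : l.-tuple Obs => (p2 y)%:E) = 1%E.
  by rewrite iint_hmm_lik//; [rewrite Hu2.2|exact: Hu2.1].
have M1 : measurable_fun setT (fun y : l.-tuple Obs => (larger_on y * p1 y)%:E).
  by apply/measurable_EFinP; apply: measurable_funM; [exact: mg|exact: mp1].
have M2 : measurable_fun setT (fun y : l.-tuple Obs => (larger_on y * p2 y)%:E).
  by apply/measurable_EFinP; apply: measurable_funM; [exact: mg|exact: mp2].
have M3 : measurable_fun setT (fun y : l.-tuple Obs => (p1 y)%:E) by apply/measurable_EFinP; exact: mp1.
have M4 : measurable_fun setT (fun y : l.-tuple Obs => (p2 y)%:E) by apply/measurable_EFinP; exact: mp2.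
have M5 : measurable_fun setT (fun y : l.-tuple Obs => (`|p1 y - p2 y|)%:E).
  apply/measurable_EFinP; apply: measurableT_comp => //; apply: measurable_funB; [exact: mp1|exact: mp2].
have N1 (y : l.-tuple Obs) : (0 <= (larger_on y * p1 y)%:E)%E by rewrite lee_fin mulr_ge0.
have N2 (y : l.-tuple Obs) : (0 <= (larger_on y * p2 y)%:E)%E by rewrite lee_fin mulr_ge0.
have N3 (y : l.-tuple Obs) : (0 <= (p1 y)%:E)%E by rewrite lee_fin.
have N4 (y : l.-tuple Obs) : (0 <= (p2 y)%:E)%E by rewrite lee_fin.
have N5 (y : l.-tuple Obs) : (0 <= (`|p1 y - p2 y|)%:E)%E by rewrite lee_fin.
have H : (D + (2%:E * m2%:E + 1) = 2%:E * m1%:E + 1)%E.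
  rewrite -E1 -E2 -{1}E3 -E4 /D -!iintZl// -!iintD//.
  - apply: eq_iint => y; rewrite -!EFinM -!EFinD; congr EFin; rewrite /larger_on.
    case: (ltP (p2 y) (p1 y)) => h.
      by rewrite ger0_norm ?subr_ge0 ?ltW//; lra.
    by rewrite ler0_norm ?subr_le0//; lra.
  - exact: measurable_funeM.
  - by move=> y; apply: mule_ge0 => //; rewrite lee_fin.
  - by apply: emeasurable_funD => //; exact: measurable_funeM.
  - by move=> y; apply: adde_ge0 => //; apply: mule_ge0 => //; rewrite lee_fin.
  - exact: measurable_funeM.
  - by move=> y; apply: mule_ge0 => //; rewrite lee_fin.
have D0 : (0 <= D)%E by exact: iint_ge0.
move: H; rewrite -!EFinM -!EFinD; move: D0; case: D => [r| |] // _.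
by rewrite -EFinD => -[H]; congr EFin; lra.
Qed.

End L1Separation.

(** * Measurability in the parameter of means and distances started from mu Q^w *)

Section ParamMeasurability.
Context {R : realType} {d k : nat} (lam : {measure set (d.-tuple R) -> \bar R}).
Hypothesis hlam : sigma_finite setT lam.
Local Notation Obs := (d.-tuple R).
Context {dT : measure_display} {T : measurableType dT}.
Variables (Qof : T -> 'M[R]_k) (fof : T -> 'I_k -> Obs -> R).
Hypotheses (HQof : forall s, is_trans (Qof s))
  (HQm : forall i j, measurable_fun setT (fun s => Qof s i j))
  (Hfof : forall t j, is_density lam (fof t j))
  (Hfm : forall j, measurable_fun setT (fun ty : T * Obs => fof ty.1 j ty.2)).
Variable mu : 'rV[R]_k.
Hypothesis Hmu : is_dist mu.

Lemma measurable_chain_law w j : measurable_fun setT (fun th => chain_law w (Qof th) mu 0 j).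
Proof.
elim: w j => [|w IH] j; first exact: measurable_cst.
rewrite /=; under eq_fun do rewrite mxE.
by apply: measurable_sum => i; exact: measurable_funM.
Qed.

Let mlik w l : measurable_fun setT (fun p : T * l.-tuple Obs =>
   hmm_lik (Qof p.1) (fof p.1) (chain_law w (Qof p.1) mu) p.2).
Proof.
apply: (@measurable_hmm_lik _ _ _ _ T l Qof fof (fun th => chain_law w (Qof th) mu)) => //.
exact: measurable_chain_law.
Qed.

Let nn w th : nneg_row (chain_law w (Qof th) mu).
Proof. by apply: chain_law_ge0 => //; exact: Hmu.1. Qed.

Let lik0 w th s : 0 <= hmm_lik (Qof th) (fof th) (chain_law w (Qof th) mu) s.
Proof. by apply: hmm_lik_ge0 => // j y; have [_ []] := Hfof th j. Qed.

Lemma measurable_mean_from w l g : smeas g -> (forall s, 0 <= g s <= 1) ->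
  measurable_fun setT (fun th =>
    mean_from lam (Qof th) (fof th) g l (chain_law w (Qof th) mu)).
Proof.
move=> mg g01.
pose F th := iint lam (fun t : l.-tuple Obs =>
  (g t * hmm_lik (Qof th) (fof th) (chain_law w (Qof th) mu) t)%:E).
have mF : measurable_fun setT F.
  apply: (measurable_iint_param hlam (F := fun th (t : l.-tuple Obs) =>
    (g t * hmm_lik (Qof th) (fof th) (chain_law w (Qof th) mu) t)%:E)).
    apply/measurable_EFinP; apply: measurable_funM; last exact: mlik.
    by apply: (measurableT_comp (f := fun t : l.-tuple Obs => g t)) => //; exact: mg.
  move=> th t; rewrite lee_fin mulr_ge0//; by have /andP[] := g01 t.
rewrite (_ : (fun th => _) = @fine R \o F); first exact: measurableT_comp.
apply/funext => th /=; rewrite /F.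
by rewrite (block_mean_linear hlam (HQof th) (Hfof th) _ mg g01).
Qed.

Lemma measurable_L1dist w l (p : seq Obs -> R) : smeas p ->
  measurable_fun setT (fun th => iint lam (fun t : l.-tuple Obs =>
    (`|hmm_lik (Qof th) (fof th) (chain_law w (Qof th) mu) t - p t|)%:E)).
Proof.
move=> mp; apply: (measurable_iint_param hlam (F := fun th (t : l.-tuple Obs) =>
    (`|hmm_lik (Qof th) (fof th) (chain_law w (Qof th) mu) t - p t|)%:E)) => //.
apply/measurable_EFinP; apply: measurableT_comp => //; apply: measurable_funB; first exact: mlik.
by apply: (measurableT_comp (f := fun t : l.-tuple Obs => p t)) => //; exact: mp.
Qed.

End ParamMeasurability.

Lemma gap_exists {R : realType} (k : nat) (q tau : R) (Q : 'M[R]_k) : (0 < k)%N -> 0 < q ->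
  trans_lb q Q -> 0 < tau -> exists w, 2 * (1 - k%:R * q) ^+ w <= tau.
Proof.
move=> k0 q0 HQ t0; set rho := 1 - k%:R * q.
have r0 : 0 <= rho by rewrite subr_ge0 (trans_lb_kq k0 HQ).
have r1 : rho < 1 by rewrite ltrBlDr ltrDl mulr_gt0// ltr0n.
have : rho ^+ n @[n --> \oo] --> (0 : R) by apply: cvg_expr; rewrite ger0_norm.
move=> /cvgrPdist_lt/(_ (tau / 2)) H.
have /H [w _ Hw] : 0 < tau / 2 by rewrite divr_gt0.
exists w; have := Hw w (leqnn w); rewrite /= sub0r normrN ger0_norm ?exprn_ge0// => h.
lra.
Qed.

Section L1Triangle.
Context {R : realType} {d : nat} (lam : {measure set (d.-tuple R) -> \bar R}).
Hypothesis hlam : sigma_finite setT lam.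
Local Notation Obs := (d.-tuple R).
Implicit Types p g : seq Obs -> R.

Let mdist n p p' : smeas p -> smeas p' ->
  measurable_fun setT (fun y : n.-tuple Obs => (`|p y - p' y|)%:E).
Proof.
move=> mp mp'; apply/measurable_EFinP; apply: measurableT_comp => //.
by apply: measurable_funB; [exact: mp|exact: mp'].
Qed.

Lemma iint_L1_triangle n p1 p2 p3 : smeas p1 -> smeas p2 -> smeas p3 ->
  (iint lam (fun y : n.-tuple Obs => (`|p1 y - p3 y|)%:E) <=
   iint lam (fun y : n.-tuple Obs => (`|p1 y - p2 y|)%:E) +
   iint lam (fun y : n.-tuple Obs => (`|p2 y - p3 y|)%:E))%E.
Proof.
move=> m1 m2 m3; rewrite -iintD//; [|exact: mdist|exact: mdist].
apply: le_iint => //.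
- exact: mdist.
- by apply: emeasurable_funD; exact: mdist.
- by move=> y; rewrite -EFinD lee_fin (_ : p1 y - p3 y = (p1 y - p2 y) + (p2 y - p3 y)) ?ler_normD//; ring.
Qed.

Lemma iint_test_L1 n g p1 p2 : smeas g -> (forall s, 0 <= g s <= 1) ->
  smeas p1 -> smeas p2 -> (forall s, 0 <= p1 s) -> (forall s, 0 <= p2 s) ->
  (iint lam (fun y : n.-tuple Obs => (g y * p1 y)%:E) <=
   iint lam (fun y : n.-tuple Obs => (g y * p2 y)%:E) +
   iint lam (fun y : n.-tuple Obs => (`|p2 y - p1 y|)%:E))%E.
Proof.
move=> mg g01 m1 m2 p10 p20.
have g0 s : 0 <= g s by have /andP[] := g01 s.
have mgp p : smeas p -> measurable_fun setT (fun y : n.-tuple Obs => (g y * p y)%:E).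
  by move=> mp; apply/measurable_EFinP; apply: measurable_funM; [exact: mg|exact: mp].
rewrite -iintD//; first last.
- by move=> y; rewrite lee_fin mulr_ge0.
- exact: mdist.
- exact: mgp.
apply: le_iint => //.
- exact: mgp.
- by apply: emeasurable_funD; [exact: mgp|exact: mdist].
- by move=> y; rewrite lee_fin mulr_ge0.
- move=> y; rewrite -EFinD lee_fin -lerBlDl -mulrBr distrC.
  apply: (le_trans (ler_norm _)); rewrite normrM (ger0_norm (g0 y)) ler_piMl//.
  by have /andP[] := g01 y.
Qed.

End L1Triangle.

(** * Assembly: consequences of (A1), then the two consistency statements *)

Section Consistency.
Context {R : realType} {d k : nat} (hk : (0 < k)%N).
Context (lam : {measure set (d.-tuple R) -> \bar R}) (hlam : sigma_finite setT lam).
Context {dQ dF : measure_display} {TQ : measurableType dQ} {TF : measurableType dF}.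
Context (piQ : probability TQ R) (piF : probability TF R).
Context (Qof : TQ -> 'M[R]_k) (fof : TF -> 'I_k -> d.-tuple R -> R).
Context (HQof : forall s, is_trans (Qof s))
  (HQm : forall i j, measurable_fun setT (fun s => Qof s i j))
  (Hfof : forall t j, is_density lam (fof t j))
  (Hfm : forall j, measurable_fun setT (fun ty : TF * d.-tuple R => fof ty.1 j ty.2)).
Context (mu : 'rV[R]_k) (Hmu : is_dist mu).
Context (Qs : 'M[R]_k) (fs : 'I_k -> d.-tuple R -> R).
Context (HQs : is_trans Qs) (Hfs : forall j, is_density lam (fs j)).
Context {dO : measure_display} {Om : measurableType dO} (P : probability Om R).
Context (Yobs : nat -> Om -> d.-tuple R).
Context (HYm : forall t, measurable_fun setT (Yobs t)).
Context (HYlaw : forall (n : nat) (B : 'I_n.+1 -> set (d.-tuple R)),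
      (forall t, measurable (B t)) ->
      P [set w | forall t : 'I_n.+1, B t (Yobs t w)] =
      iint lam (fun y : n.+1.-tuple (d.-tuple R) =>
        ((\prod_(t < n.+1) (\1_(B t) (tnth y t) : R)) *
         hmm_dens Qs (stat_dist Qs) fs y)%:E)).
Context (q : R) (l : nat) (hq : 0 < q) (hl : (3 <= l)%N).
Context (Hsupp : piQ [set s | ~ trans_lb q (Qof s)] = 0%E).
Context (Hmu_lb : forall i, q <= mu 0 i).
Local Notation Obs := (d.-tuple R).

Let vs := stat_dist Qs.
Let Hvs : is_stationary Qs vs. Proof. exact: stat_distP. Qed.
Let Hvd : is_dist vs. Proof. exact: Hvs.1. Qed.
Let fs0 j y : 0 <= fs j y. Proof. by have [_ []] := Hfs j. Qed.
Let mfs j : measurable_fun setT (fs j). Proof. by have [] := Hfs j. Qed.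

Let Hlaw n (A : set (n.-tuple Obs)) : (0 < n)%N -> measurable A ->
  P (obs_tuple Yobs n @^-1` A) = iint lam (fun y => (\1_A y * hmm_lik Qs fs vs y)%:E).
Proof.
apply: (@obs_lawE _ _ _ hlam _ _ P Yobs HYm (fun n (y : n.-tuple Obs) => hmm_lik Qs fs vs y)).
- by move=> m; exact: smeas_hmm_lik.
- by move=> m y; apply: hmm_lik_ge0 => //; exact: Hvd.1.
- by move=> m B mB; rewrite HYlaw//; apply: eq_iint => y; rewrite hmm_densE.
Qed.

Let PiP : probability (TQ * TF)%type R := (piQ \x piF)%E.
Let Pi : {sigma_finite_measure set (TQ * TF)%type -> \bar R} := PiP.
Let Pi1 : Pi setT = 1%E.
Proof. exact: (probability_setT PiP). Qed.

Let Qth (th : TQ * TF) := Qof th.1.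
Let fth (th : TQ * TF) := fof th.2.
Let HQth th : is_trans (Qth th). Proof. exact: HQof. Qed.
Let Hfth th j : is_density lam (fth th j). Proof. exact: Hfof. Qed.
Let HQmth i j : measurable_fun setT (fun th => Qth th i j).
Proof. exact: (measurableT_comp (HQm i j)). Qed.
Let Hfmth j : measurable_fun setT (fun ty : (TQ * TF) * Obs => fth ty.1 j ty.2).
Proof.
apply: (measurableT_comp (f := fun ty : TF * Obs => fof ty.1 j ty.2)
  (g := fun ty : (TQ * TF) * Obs => (ty.1.2, ty.2))); first exact: Hfm.
by apply: measurable_fun_pair => //; exact: measurableT_comp.
Qed.

Let Zq : set TQ := [set s | ~ trans_lb q (Qof s)].
Let mZq : measurable Zq.
Proof.
rewrite (_ : Zq = ~` \bigcap_(i in [set: 'I_k]) \bigcap_(j in [set: 'I_k]) [set s | q <= Qof s i j]).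
  apply: measurableC; apply: fin_bigcap_measurable => // i _.
  by apply: fin_bigcap_measurable => // j _; exact: measurable_ler_set.
congr (~` _); apply/seteqP; split => [s [_ h] i _ j _|s h] /=; first exact: h.
by split => // i j; exact: h.
Qed.
Let Z : set (TQ * TF) := Zq `*` setT.
Let mZ : measurable Z. Proof. exact: measurableX. Qed.
Let PZ : Pi Z = 0%E.
Proof. by rewrite [LHS]product_measure1E// [X in (X * _)%E]Hsupp mul0e. Qed.
Let HZ th : ~ Z th -> trans_lb q (Qth th).
Proof. by move=> h; apply: contrapT => h'; apply: h; split. Qed.

Lemma posteriorE A n (y : n.-tuple Obs) :
  posterior piQ piF Qof fof mu A y = post_mass Pi Qth fth mu A y.
Proof.
rewrite /posterior /post_mass /evidence.
by congr (fine _ / fine _); apply: eq_integral => th _; rewrite hmm_densE.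
Qed.

Hypothesis hA1 : A1 lam piQ piF Qof fof q Qs fs.

Let A1_entries e Q f i j : A1_cond lam Qs fs e Q f -> `|Q i j - Qs i j| < e.
Proof.
move=> [+ _ _ _ _]; apply: le_lt_trans.
rewrite (le_trans _ (le_bigmax _ (fun i => \big[Num.max/0]_(j < k) `|Q i j - Qs i j|) i))//.
exact: (le_bigmax _ (fun j => `|Q i j - Qs i j|) j).
Qed.

(** An entry Qs i j < q would keep distance at least q - Qs i j from all matrices with entries at
    least q, whereas (A1) provides such matrices arbitrarily close, a set of positive prior mass
    being nonempty. *)
Lemma A1_trans_lb : trans_lb q Qs.
Proof.
split => // i j; rewrite leNgt; apply/negP => hQ.
have [e0 e00 H] := hA1; pose e := Num.min (e0 / 2) (q - Qs i j).
have e1 : 0 < e < e0.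
  rewrite /e lt_min subr_gt0 hQ andbT divr_gt0//= gt_min; apply/orP; left; lra.
have [S [mS S0 SQ Sc]] := H e e1.
have [th Sth] : S !=set0.
  by apply/set0P/eqP => S00; move: S0; rewrite S00 /prior measure0 ltxx.
have := A1_entries i j (Sc th Sth); have [_ /(_ i j)] := SQ th Sth.
have : e <= q - Qs i j by rewrite ge_min lexx orbT.
by rewrite ltr_norml => ? ? /andP[? ?]; lra.
Qed.

Let HQlb := A1_trans_lb.

Lemma A1_evidence (c : R) : 0 < c ->
  {ae P, forall w, exists n0, forall n, (n0 <= n)%N ->
  ((expR (- (n%:R * c)) * hmm_lik Qs fs vs (obs_tuple Yobs n w))%:E <=
    evidence Pi Qth fth mu (obs_tuple Yobs n w))%E}.
Proof.
move=> c0; have [e0 e00 H] := hA1.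
(* (A1) is used with epsilon = eta^2. Since eta^2 <= eta, the last bound makes the rate 24 eta +
   eta^2 / q at most c / 2; the other half of c absorbs the constant q rS / 2 for large n. *)
pose eta := Num.min 1 (Num.min (e0 / 2) (c / 2 / (24 + q^-1))).
have K0 : 0 < 24 + q^-1 by rewrite addr_gt0// invr_gt0.
have eta0 : 0 < eta by rewrite !lt_min ltr01 !divr_gt0.
have eta1 : eta <= 1 by rewrite ge_min lexx.
have etae : eta <= e0 / 2 by rewrite /eta !ge_min lexx orbT.
have etac : eta <= c / 2 / (24 + q^-1) by rewrite /eta !ge_min lexx !orbT.
have eta2 : eta ^+ 2 <= eta by rewrite expr2 ler_piMl// ltW.
have e2 : 0 < eta ^+ 2 < e0 by rewrite exprn_gt0//=; lra.
have [S [mS S0 SQ Sc]] := H _ e2.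
have Sfin : (Pi S < +oo)%E.
  apply: (@le_lt_trans _ _ (Pi setT)); last by rewrite Pi1 ltry.
  by apply: le_measure; rewrite ?inE.
have SQe th i j : S th -> Qs i j <= Qth th i j + eta ^+ 2.
  by move=> /Sc/(A1_entries i j); rewrite ltr_norml => /andP[? ?]; rewrite /Qth; lra.
have SG th i : S th -> (\int[lam]_y ((fs i y)%:E * max_logratio fs (fth th) y) < (eta ^+ 2)%:E)%E.
  move=> /Sc[_ + _ _ _]; apply: le_lt_trans.
  exact: (le_bigmax _ (fun i => \int[lam]_y ((fs i y)%:E * max_logratio fs (fth th) y))%E i).
have eta01 : 0 < eta <= 1 by rewrite eta0.
have LB := @evidence_lower_bound _ _ _ _ hlam Qs fs HQs Hfs vs Hvd _ _ P Yobs HYm Hlaw _ _ Pi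
  Qth fth HQth HQmth Hfth Hfmth mu q Hmu hq Hmu_lb S eta mS S0 Sfin eta01 SQ SQe SG.
set rS := fine (Pi S) in LB.
have rS0 : 0 < rS by rewrite -lte_fin fineK// ge0_fin_numE.
have d0 : 0 < q * rS / 2 by rewrite divr_gt0// mulr_gt0.
have c20 : 0 < c / 2 by rewrite divr_gt0.
have /cvgrPdist_lt/(_ _ d0)[n1 _ Hn1] := expR_natM_cvg0 c20.
apply: filterS LB => w [n0 Hn0]; exists (maxn n0 n1) => n; rewrite geq_max => /andP[h0 h1].
apply: le_trans (Hn0 n h0); rewrite lee_fin; apply: ler_wpM2r.
  by apply: hmm_lik_ge0 => //; exact: Hvd.1.
have := Hn1 n h1; rewrite /= sub0r normrN ger0_norm ?expR_ge0// => h2.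
apply: (@le_trans _ _ (expR (- (n%:R * (c / 2))) * expR (- (n%:R * (c / 2))))).
  by rewrite -expRD ler_expR; lra.
apply: ler_pM; rewrite ?expR_ge0 ?(ltW h2)//.
rewrite ler_expR lerN2; apply: ler_wpM2l => //.
apply: (@le_trans _ _ (eta * (24 + q^-1))).
  rewrite mulrDr [eta * 24]mulrC lerD2l.
  by apply: ler_wpM2r => //; rewrite invr_ge0 ltW.
by rewrite -ler_pdivlMr.
Qed.

Lemma weak_consistency (U : set (l.-tuple Obs -> R)) :
  weak_nbhd lam (hmm_dens Qs (stat_dist Qs) fs (n:=l)) U ->
  {ae P, forall w, (posterior piQ piF Qof fof mu
     [set th | U (hmm_dens (Qof th.1) (stat_dist (Qof th.1)) (fof th.2) (n:=l))]
     [tuple Yobs i w | i < n]) @[n --> \oo] --> (1 : R)}.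
Proof.
move=> [m [g [e [e0 [gb HU]]]]].
have mg i : measurable_fun setT (g i) by apply: tcont_measurable; have [] := gb i.
have [M M0 gM] : exists2 M : R, 0 < M & forall i y, `|g i y| <= M.
  have /choice[Mf HMf] : forall i, exists M : R, forall y, `|g i y| <= M by move=> i; have [] := gb i.
  exists (1 + \sum_i `|Mf i|); first by rewrite ltr_pwDl// sumr_ge0.
  move=> i y; apply: (le_trans (HMf i y)); apply: (le_trans (ler_norm _)).
  rewrite (bigD1 i)//= addrCA lerDl addr_ge0// sumr_ge0//.
(* On B the means are within 2 tau + tau / 2 of the true ones, the second term from replacing the
   stationary law by mu Q^w; rescaling by 2 M gives 5 M tau <= e. *)
pose tau := Num.min 1 (e / (5 * M)).
have t0 : 0 < tau by rewrite lt_min ltr01 divr_gt0// mulr_gt0.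
have ht : 0 < tau <= 1 by rewrite t0 ge_min lexx.
have te : 5 * M * tau <= e.
  rewrite mulrC -ler_pdivlMr ?mulr_gt0//; by rewrite ge_min lexx orbT.
have [w Hw] := gap_exists hk hq HQlb (divr_gt0 t0 (ltr0n _ 2)).
have L0 : (0 < w + l)%N by rewrite addn_gt0 (leq_trans _ hl) ?orbT.
pose h i s := (seq_ext (g i) s + M) / (2 * M).
have hP Q f v (HQ : is_trans Q) (Hf : forall j, is_density lam (f j)) (Hv : is_dist v) i :=
  @iint_bounded_test R d k lam hlam Q f HQ Hf l (g i) M v (mg i) M0 (gM i) Hv.
have mh i : smeas (h i) by have [] := hP _ _ _ HQs Hfs Hvd i.
have h01 i s : 0 <= h i s <= 1 by have [_ H _] := hP _ _ _ HQs Hfs Hvd i; exact: H.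
(* Both h i and its complement are tested, since a block test detects only means that are too large;
   further indices are filled with 0. *)
pose fam (n a : nat) : seq Obs -> R :=
  if insub a is Some i then h i else if insub (a - m)%N is Some i then (fun s => 1 - h i s) else (fun=> 0).
have mfam n a : smeas (fam n a).
  rewrite /fam; case: insubP => [i _ _|_]; first exact: mh.
  case: insubP => [i _ _|_]; first exact: smeas_compl.
  by move=> n'; exact: measurable_cst.
have fam01 n a s : 0 <= fam n a s <= 1.
  rewrite /fam; case: insubP => [i _ _|_]; first exact: h01.
  case: insubP => [i _ _|_]; first exact: (compl01 (h01 i)).
  by rewrite lexx ler01.
have b0 := kappa_rate_gt0 ht L0.
have [K HK] := @sum_expR_bounded R (m + m)%:R _ (ler0n _ _) b0.
pose B := [set th | ~ Z th] `&` \bigcap_(i in [set: 'I_m])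
  [set th | `|mean_from lam (Qth th) (fth th) (h i) l (chain_law w (Qth th) mu) -
     mean_from lam Qs fs (h i) l vs| < 2 * tau].
have mB : measurable B.
  apply: measurableI; first exact: measurableC.
  apply: fin_bigcap_measurable => // i _; apply: measurable_ltr_set => //.
  apply: measurableT_comp => //; apply: measurable_funB => //.
  exact: (measurable_mean_from hlam HQth HQmth Hfth Hfmth Hmu).
have HB n th : (0 < n)%N -> ~ B th -> ~ set0 th -> ~ Z th ->
  exists2 a, (a < m + m)%N & mean_from lam Qs fs (fam n a) l vs + 2 * tau <=
    mean_from lam (Qth th) (fth th) (fam n a) l (chain_law w (Qth th) mu).
  move=> _ nB _ nZ.
  have [i Hi] : exists i, ~ (`|mean_from lam (Qth th) (fth th) (h i) l (chain_law w (Qth th) mu) -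
     mean_from lam Qs fs (h i) l vs| < 2 * tau).
    by apply/existsNP => H; apply: nB; split => // i _; exact: H.
  have Hc := chain_law_dist w (HQth th) Hmu.
  move/negP: Hi; rewrite -leNgt ler_normr => /orP[Hi|Hi].
    exists i; first by rewrite ltn_addr.
    by rewrite /fam valK; lra.
  exists (m + i)%N; first by rewrite ltn_add2l.
  rewrite /fam insubF ?ltnNge ?leq_addr// addKn valK.
  by rewrite (mean_from_compl hlam HQs Hfs)// (mean_from_compl hlam (HQth th) (Hfth th))//; lra.
have BA : B `<=` [set th | U (hmm_dens (Qof th.1) (stat_dist (Qof th.1)) (fof th.2) (n:=l))].
  move=> th [nZ HBth] /=; apply: HU.
    have Hst := stat_distP hk (HQth th).
    have E : hmm_dens (Qof th.1) (stat_dist (Qof th.1)) (fof th.2) (n:=l) =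
      (fun y : l.-tuple Obs => hmm_lik (Qth th) (fth th) (stat_dist (Qth th)) y).
      by apply/funext => y; rewrite hmm_densE//; exact: Hst.1.
    have ff0 j y : 0 <= fth th j y by have [_ []] := Hfth th j.
    rewrite E; split; [|split].
    - by apply: smeas_hmm_lik => j; have [] := Hfth th j.
    - by move=> y; apply: hmm_lik_ge0 => //; exact: Hst.1.1.
    - by rewrite iint_hmm_lik//; [rewrite Hst.1.2|exact: Hst.1.1].
  move=> i; have Hst := stat_distP hk (HQth th).
  have Ei : iint lam (fun y : l.-tuple Obs => (g i y * hmm_dens (Qof th.1) (stat_dist (Qof th.1)) (fof th.2) y)%:E) =
     (2 * M * mean_from lam (Qth th) (fth th) (h i) l (stat_dist (Qth th)) - M)%:E.
    have [_ _ <-] := hP _ _ _ (HQth th) (Hfth th) Hst.1 i.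
    by apply: eq_iint => y; rewrite hmm_densE//; exact: Hst.1.
  have Es : iint lam (fun y : l.-tuple Obs => (g i y * hmm_dens Qs (stat_dist Qs) fs y)%:E) =
     (2 * M * mean_from lam Qs fs (h i) l vs - M)%:E.
    have [_ _ <-] := hP _ _ _ HQs Hfs Hvd i.
    by apply: eq_iint => y; rewrite hmm_densE.
  rewrite Ei Es -EFinB abse_EFin lte_fin.
  have := HBth i I; rewrite /=.
  have := mean_from_lip hlam (HQth th) (Hfth th) l (mh i) (h01 i) (chain_law w (Qth th) (stat_dist (Qth th))) (chain_law w (Qth th) mu).
  move=> /le_trans/(_ (chain_law_mixing w hk (HZ nZ) Hst.1 Hmu))/le_trans/(_ Hw).
  rewrite (chain_law_stat w Hst).
  set a := mean_from _ _ _ _ _ (stat_dist _); set b := mean_from _ _ _ _ _ (chain_law _ _ _).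
  set c := mean_from _ _ _ _ _ _ => h1 h2.
  have -> : 2 * M * a - M - (2 * M * c - M) = 2 * M * (a - c) by ring.
  rewrite normrM ger0_norm ?mulr_ge0 ?(ltW M0)//.
  apply: lt_le_trans te.
  have : `|a - c| < 5 / 2 * tau.
    have -> : a - c = (a - b) + (b - c) by ring.
    by rewrite (le_lt_trans (ler_normD _ _))//; lra.
  by rewrite -(ltr_pM2l (_ : 0 < 2 * M)) ?mulr_gt0//; lra.
have PW n : (0 < n)%N -> (Pi set0 <= (0 * expR (- (n%:R * 1)))%:E)%E.
  by move=> _; rewrite measure0 mul0r.
have := @consistency_from_blocks R d k lam hlam Qs fs Hfs vs dO Om P Yobs HYm Hlaw _ _ Pi Pi1
  Qth fth HQth HQmth Hfth Hfmth mu Hmu q tau w l hk HQlb Hvs ht Hw L0 (fun=> (m + m)%N) fam K mfam fam01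
  HK (fun=> set0) 0 1 (lexx _) ltr01 (fun=> measurable0) PW Z B mZ PZ HZ mB HB A1_evidence _ BA.
by apply: filterS => w0; under [in X in _ -> X]eq_cvg do rewrite posteriorE.
Qed.

Hypothesis hA2 : A2 lam piF fof q l.

Lemma L1_consistency (e : R) : 0 < e ->
  {ae P, forall w, (posterior piQ piF Qof fof mu
     [set th | (L1dist lam
                  (hmm_dens (Qof th.1) (stat_dist (Qof th.1)) (fof th.2) (n:=l))
                  (hmm_dens Qs (stat_dist Qs) fs (n:=l)) < e%:E)%E]
     [tuple Yobs i w | i < n]) @[n --> \oo] --> (1 : R)}.
Proof.
(* Off B the L1 distance is at least e / 2. Passing to a center costs e / 12 and Scheffe halves the
   rest, so m1 - ms >= 5 e / 24; returning from the center to theta costs e / 12 again, which leaves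
   e / 8 >= 2 tau. *)
move=> e0; pose tau := Num.min 1 (e / 16).
have t0 : 0 < tau by rewrite lt_min ltr01 divr_gt0.
have ht : 0 < tau <= 1 by rewrite t0 ge_min lexx.
have te : tau <= e / 16 by rewrite ge_min lexx orbT.
have [w Hw] := gap_exists hk hq HQlb (divr_gt0 t0 (ltr0n _ 2)).
have L0 : (0 < w + l)%N by rewrite addn_gt0 (leq_trans _ hl) ?orbT.
have := kappa_rate_gt0 ht L0; set b := (X in 0 < X) => b0.
(* The grid error accumulates over w gap transitions and l observations to (w + l) k eta <= e / 24;
   with the emission error l dl <= e / 36 the total stays below e / 12. *)
pose eta := e / 24 / ((w + l)%:R * k%:R + 1).
have K1 : 0 < (w + l)%:R * k%:R + 1 :> R by rewrite ltr_wpDl// mulr_ge0.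
have eta0 : 0 < eta by rewrite !divr_gt0.
have etaE : (w + l)%:R * k%:R * eta <= e / 24.
  rewrite /eta mulrA ler_pdivrMr// mulrC; apply: ler_wpM2l; last by rewrite lerDl.
  by rewrite divr_ge0// ltW.
have [G [Qg [G0 [Qglb Qgcov]]]] := transition_grid eta0 HQlb.
(* delta <= e controls the covering radius; delta <= 1 and delta <= b give delta^2 <= b, so that the
   weight in (A2) dominates exp(- n b). *)
pose delta := Num.min 1 (Num.min b e).
have delta0 : 0 < delta by rewrite !lt_min ltr01 b0.
have delta1 : delta <= 1 by rewrite ge_min lexx.
have deltab : delta <= b by rewrite /delta !ge_min lexx orbT.
have deltae : delta <= e by rewrite /delta !ge_min lexx !orbT.
have l0 : 0 < l%:R :> R by rewrite ltr0n (leq_trans _ hl).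
have l1 : 1 <= l%:R :> R by rewrite ler1n (leq_trans _ hl).
have [Fn [r1 [C [r10 C0 HFn Hsum]]]] := hA2 delta0.
pose en (n : nat) : R := expR (- (n%:R * delta ^+ 2 * k%:R ^+ 2 * q ^+ 2 / (32 * l%:R))).
pose dl := delta / (36 * l%:R).
pose cov n := cov_num lam dl (fof @` Fn n).
have en_ge n : expR (- (n%:R * b)) <= en n.
  rewrite ler_expR lerN2 ler_pdivrMr ?mulr_gt0//.
  have kq1 : k%:R ^+ 2 * q ^+ 2 <= 1.
    by rewrite -exprMn expr_le1 ?(trans_lb_kq hk HQlb)// mulr_ge0// ltW.
  have kq0 : 0 <= k%:R ^+ 2 * q ^+ 2 by rewrite mulr_ge0 ?sqr_ge0.
  have d2 : delta ^+ 2 <= b by apply: le_trans deltab; rewrite expr2 ler_piMl// ltW.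
  rewrite [X in X <= _](_ : _ = n%:R * (delta ^+ 2 * (k%:R ^+ 2 * q ^+ 2))); last by ring.
  rewrite -[X in _ <= X]mulrA; apply: ler_wpM2l => //.
  apply: (@le_trans _ _ (b * 1)); first by apply: ler_pM => //; exact: sqr_ge0.
  by apply: ler_wpM2l; [exact: ltW|lra].
have cov0 n : (0 <= cov n)%E.
  by apply/ereal_infP => _ [N _ <-]; rewrite lee_fin.
have ten0 n : (0 <= cov n * (en n)%:E)%E by rewrite mule_ge0// lee_fin expR_ge0.
have [S HS] : exists S : R, forall n, (\sum_(1 <= i < n) cov i * (en i)%:E <= S%:E)%E.
  have S0 : (0 <= \sum_(1 <= n <oo) cov n * (en n)%:E)%E by exact: nneseries_ge0.
  exists (fine (\sum_(1 <= n <oo) cov n * (en n)%:E)%E) => n.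
  rewrite fineK; last by rewrite ge0_fin_numE.
  by apply: nneseries_lim_ge => i _ _.
(* A finite series with positive weights has finite covering numbers. *)
have covfin n : (0 < n)%N -> cov n \is a fin_num.
  move=> n0; rewrite ge0_fin_numE// ltey; apply/negP => /eqP Ec.
  have := HS n.+1; rewrite big_nat_recr//= Ec gt0_mulye ?lte_fin ?expR_gt0//.
  by rewrite addey ?leye_eq// -ltNye (lt_le_trans (ltNy0 : (-oo < (0 : \bar R))%E))// sume_ge0.
(* Covers whose size is within 1 of the infimum; this slack produces the extra geometric sum K in
   [HM]. At n = 0, where (A2) says nothing, the family of tests is empty. *)
have /choice[Nc HNc] : forall n, exists Nc : nat * (nat -> 'I_k -> Obs -> R),
    [/\ forall j i, is_density lam (Nc.2 j i),
        (0 < n)%N -> Nc.1%:R <= fine (cov n) + 1, n = 0%N -> Nc.1 = 0%N &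
        (0 < n)%N -> forall t, Fn n t -> exists2 j, (j < Nc.1)%N & (Defs.dF lam (fof t) (Nc.2 j) <= dl%:E)%E].
  case=> [|n]; first by exists (0%N, fun=> fs); split.
  have [_ [N [c [cd ccov]] <-] hN] := lb_ereal_inf_adherent ltr01 (covfin n.+1 isT).
  exists (N, fun j => if insub j is Some j' then c j' else fs); split => //=.
  - by move=> j i; case: insubP.
  - move=> _; apply: ltW; rewrite -lte_fin EFinD fineK//; exact: covfin.
  - move=> _ t Ft; have [j Hj] := ccov (fof t) (imageP _ Ft).
    by exists j => //; rewrite valK.
pose N n := (Nc n).1; pose cc n := (Nc n).2.
have ccd n j i : is_density lam (cc n j i) by have [H _ _ _] := HNc n; exact: H.
pose u1 a := chain_law w (Qg a) mu.
have u1d a : is_dist (u1 a) by apply: chain_law_dist => //; exact: (Qglb a).1.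
(* The index i encodes a pair: the quotient by G selects the emission center, the remainder the grid
   matrix. *)
pose fam n i := larger_on (Qg (i %% G)%N) Qs (cc n (i %/ G)%N) fs (u1 (i %% G)%N) vs.
have mfam n i : smeas (fam n i).
  exact: (smeas_larger_on (Qg (i %% G)%N) Qs (u1 (i %% G)%N) vs (ccd n _) Hfs).
have fam01 n i s : 0 <= fam n i s <= 1 by exact: larger_on01.
pose M n := (N n * G)%N.
have [K HK] := @sum_expR_bounded R 1 b ler01 b0.
have HM n : \sum_(0 <= i < n) (M i)%:R * expR (- (i%:R * b)) <= G%:R * (S + K).
  have HK1 : \sum_(1 <= i < n) expR (- (i%:R * b)) <= K.
    apply: le_trans (HK n); case: n => [|n]; first by rewrite !big_geq.
    rewrite [X in _ <= X]big_ltn//= mul1r.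
    under [X in _ <= _ + X]eq_bigr do rewrite mul1r.
    by rewrite lerDr expR_ge0.
  have HS1 : \sum_(1 <= i < n) fine (cov i) * en i <= S.
    rewrite -lee_fin -sumEFin; apply: le_trans (HS n).
    rewrite big_nat_cond [X in (_ <= X)%E]big_nat_cond.
    by apply: lee_sum => i /andP[/andP[i1 _] _]; rewrite EFinM fineK// covfin.
  apply: (@le_trans _ _ (\sum_(1 <= i < n) G%:R * (fine (cov i) * en i + expR (- (i%:R * b))))).
    case: n {HK1 HS1} => [|n]; first by rewrite !big_geq.
    rewrite big_ltn// [M 0%N](_ : _ = 0%N) ?mul0r ?add0r; last first.
      by rewrite /M /N; have [_ _ -> //] := HNc 0%N.
    rewrite big_nat_cond [X in _ <= X]big_nat_cond.
    apply: ler_sum => i /andP[/andP[i1 _] _].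
    rewrite /M natrM mulrAC mulrC; apply: ler_wpM2l => //.
    have [_ /(_ i1) hN _ _] := HNc i.
    apply: (@le_trans _ _ ((fine (cov i) + 1) * expR (- (i%:R * b)))).
      by apply: ler_wpM2r; rewrite ?expR_ge0.
    rewrite mulrDl mul1r lerD2r; apply: ler_wpM2l => //.
    exact: fine_ge0.
  rewrite -mulr_sumr big_split /=; apply: ler_wpM2l => //; exact: lerD.
pose W n : set (TQ * TF) := if n is 0 then set0 else setT `*` ~` Fn n.
have mW n : measurable (W n).
  case: n => [|n]; first exact: measurable0.
  apply: measurableX => //; apply: measurableC; exact: (HFn n.+1 isT).1.
have PW n : (0 < n)%N -> (Pi (W n) <= (C * expR (- (n%:R * r1)))%:E)%E.
  case: n => // n _; have [mFn HPn] := HFn n.+1 isT.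
  rewrite [X in (X <= _)%E]product_measure1E//; last exact: measurableC.
  by rewrite [X in (X * _ <= _)%E](probability_setT piQ) mul1e.
pose ath th := chain_law w (Qth th) mu.
have athd th : is_dist (ath th) by exact: chain_law_dist.
pose pth th := hmm_lik (Qth th) (fth th) (ath th).
pose ps := hmm_lik Qs fs vs.
have mpth th : smeas (pth th) by apply: smeas_hmm_lik => j; have [] := Hfth th j.
have mps : smeas ps by exact: smeas_hmm_lik.
pose B := [set th | ~ Z th] `&`
  [set th | (iint lam (fun y : l.-tuple Obs => (`|pth th y - ps y|)%:E) < (e / 2)%:E)%E].
have mB : measurable B.
  apply: measurableI; first exact: measurableC.
  apply: measurable_lte_set => //.
  exact: (measurable_L1dist hlam HQmth Hfmth mu w l mps).
have HB n th : (0 < n)%N -> ~ B th -> ~ W n th -> ~ Z th ->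
  exists2 i, (i < M n)%N & mean_from lam Qs fs (fam n i) l vs + 2 * tau <=
    mean_from lam (Qth th) (fth th) (fam n i) l (chain_law w (Qth th) mu).
  move=> n0 nB nW nZ.
  have hD : ((e / 2)%:E <= iint lam (fun y : l.-tuple Obs => (`|pth th y - ps y|)%:E))%E.
    by rewrite leNgt; apply/negP => h; apply: nB; split.
  have Fth : Fn n th.2.
    by apply: contrapT => h; apply: nW; case: (n) n0 h => // n' _ h; split.
  have [_ _ _ /(_ n0 _ Fth)[j jN Hj]] := HNc n.
  have [a aG Ha] := Qgcov _ (HZ nZ).
  exists (j * G + a)%N.
    apply: (@leq_trans (j * G + G)%N); first by rewrite ltn_add2l.
    by rewrite -mulSnr leq_mul2r jN orbT.
  rewrite /fam divnMDl// modnMDl divn_small// addn0 modn_small//.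
  set g := larger_on _ _ _ _ _ _.
  have HQa := (Qglb a).1; pose p1 := hmm_lik (Qg a) (cc n j) (u1 a).
  have mg : smeas g by exact: (smeas_larger_on (Qg a) Qs (u1 a) vs (ccd n j) Hfs).
  have g01 s : 0 <= g s <= 1 by exact: larger_on01.
  have mp1 : smeas p1 by apply: smeas_hmm_lik => i; have [] := ccd n j i.
  have p10 s : 0 <= p1 s.
    by apply: hmm_lik_ge0 => //; [move=> i y; have [_ []] := ccd n j i|exact: (u1d a).1].
  have pth0 s : 0 <= pth th s.
    by apply: hmm_lik_ge0 => //; [move=> i y; have [_ []] := Hfth th i|exact: (athd th).1].
  have Hdd i : (\int[lam]_y (`|fth th i y - cc n j i y|)%:E <= dl%:E)%E.
    apply: le_trans Hj.
    exact: (le_bigmax _ (fun i => \int[lam]_y (`|fof th.2 i y - cc n j i y|)%:E)%E i).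
  have dl0 : 0 <= dl by rewrite divr_ge0 ?(ltW delta0)// mulr_ge0// ltW.
  have X1 : (iint lam (fun y : l.-tuple Obs => (`|pth th y - p1 y|)%:E) <= (e / 12)%:E)%E.
    apply: (le_trans (hmm_lik_perturb hlam (HQth th) (Hfth th) HQa (ccd n j) dl0 (ltW eta0)
      Hdd Ha l (ath th) (u1d a).1)).
    rewrite lee_fin (u1d a).2 mulr1.
    have h1 := chain_law_perturb w (HQth th) HQa Hmu Ha.
    have h2 : l%:R * dl <= e / 36.
      rewrite /dl; have -> : l%:R * (delta / (36 * l%:R)) = delta / 36 by field; rewrite gt_eqF.
      by rewrite ler_pM2r.
    apply: (le_trans (lerD h1 (lexx _))).
    rewrite mulrDr addrCA mulrA mulrA -mulrDl -mulrDl -natrD.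
    lra.
  have E1 := iint_L1_larger hlam HQa (ccd n j) (u1d a) HQs Hfs Hvd l.
  rewrite -/g in E1.
  set m1 := mean_from _ (Qg a) _ _ _ _ in E1; set ms := mean_from _ Qs _ _ _ _ in E1 *.
  set mt := mean_from _ _ _ _ _ _.
  have h1 : e / 2 <= e / 12 + 2 * (m1 - ms).
    rewrite -lee_fin EFinD -E1; apply: (le_trans hD).
    apply: (le_trans (iint_L1_triangle hlam l (mpth th) mp1 mps)).
    exact: leeD.
  have h2 : m1 <= mt + e / 12.
    rewrite -lee_fin EFinD /m1 /mt /mean_from.
    rewrite -(block_mean_linear hlam HQa (ccd n j) _ mg g01 (u1d a).1).
    rewrite -(block_mean_linear hlam (HQth th) (Hfth th) _ mg g01 (athd th).1).
    apply: (le_trans (iint_test_L1 hlam l mg g01 mp1 (mpth th) p10 pth0)).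
    exact: leeD.
  lra.
have BA : B `<=` [set th | (L1dist lam
     (hmm_dens (Qof th.1) (stat_dist (Qof th.1)) (fof th.2) (n:=l))
     (hmm_dens Qs (stat_dist Qs) fs (n:=l)) < e%:E)%E].
  move=> th [nZ HBth] /=; have Hst := stat_distP hk (HQth th).
  have E1 (y : l.-tuple Obs) : hmm_dens (Qof th.1) (stat_dist (Qof th.1)) (fof th.2) y =
      hmm_lik (Qth th) (fth th) (stat_dist (Qth th)) y by rewrite hmm_densE//; exact: Hst.1.
  have E2 (y : l.-tuple Obs) : hmm_dens Qs (stat_dist Qs) fs y = ps y by rewrite hmm_densE.
  rewrite /L1dist; under eq_iint do rewrite E1 E2.
  have mst : smeas (hmm_lik (Qth th) (fth th) (stat_dist (Qth th))).
    by apply: smeas_hmm_lik => j; have [] := Hfth th j.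
  apply: (le_lt_trans (iint_L1_triangle hlam l mst (mpth th) mps)).
  have z0 (j : 'I_k) : (\int[lam]_y (`|fth th j y - fth th j y|)%:E <= (0 : R)%:E)%E.
    by under eq_integral do rewrite subrr normr0; rewrite integral0.
  have q0 i j : `|Qth th i j - Qth th i j| <= 0 by rewrite subrr normr0.
  (* With identical Q and f the perturbation bound reduces to the l1 distance between the initial
     laws, here the stationary law and mu Q^w. *)
  have h := hmm_lik_perturb hlam (HQth th) (Hfth th) (HQth th) (Hfth th) (lexx 0) (lexx 0)
    z0 q0 l (stat_dist (Qth th)) (athd th).1.
  have hm := chain_law_mixing w hk (HZ nZ) Hst.1 Hmu.
  rewrite (chain_law_stat w Hst) in hm.
  apply: (@lt_le_trans _ _ ((e / 32)%:E + (e / 2)%:E)%E); last first.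
    by rewrite -EFinD lee_fin; lra.
  apply: (@le_lt_trans _ _ ((e / 32)%:E +
    iint lam (fun y : l.-tuple Obs => (`|pth th y - ps y|)%:E))%E); last by rewrite lteD2lE.
  apply: leeD => //; apply: (le_trans h); rewrite lee_fin mulr0 addr0 mulr0 mul0r addr0.
  by apply: (le_trans hm); apply: (le_trans Hw); lra.
have := @consistency_from_blocks R d k lam hlam Qs fs Hfs vs dO Om P Yobs HYm Hlaw _ _ Pi Pi1
  Qth fth HQth HQmth Hfth Hfmth mu Hmu q tau w l hk HQlb Hvs ht Hw L0 M fam _ mfam fam01
  HM W C r1 (ltW C0) r10 mW PW Z B mZ PZ HZ mB HB A1_evidence _ BA.
by apply: filterS => w0; under [in X in _ -> X]eq_cvg do rewrite posteriorE.
Qed.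

End Consistency.

Theorem theorem1
  (R : realType) (d k : nat) (hd : (0 < d)%N) (hk : (0 < k)%N)
  (* sigma-finite reference measure on R^d *)
  (lam : {measure set (d.-tuple R) -> \bar R}) (hlam : sigma_finite setT lam)
  (* parameter space Theta, parameterized by (s, t) |-> (Qof s, fof t) in
     Delta_k^k x F^k; prior pi = piQ (x) piF *)
  (dQ dF : measure_display) (TQ : measurableType dQ) (TF : measurableType dF)
  (piQ : probability TQ R) (piF : probability TF R)
  (Qof : TQ -> 'M[R]_k) (fof : TF -> 'I_k -> d.-tuple R -> R)
  (HQof : forall s, is_trans (Qof s))
  (HQm : forall i j, measurable_fun setT (fun s => Qof s i j))
  (Hfof : forall t j, is_density lam (fof t j))
  (Hfm : forall j, measurable_fun setT (fun ty : TF * d.-tuple R => fof ty.1 j ty.2))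
  (* fixed initial distribution mu used in the likelihood *)
  (mu : 'rV[R]_k) (Hmu : is_dist mu)
  (* true parameter theta* = (Qs, fs) *)
  (Qs : 'M[R]_k) (fs : 'I_k -> d.-tuple R -> R)
  (HQs : is_trans Qs) (Hfs : forall j, is_density lam (fs j))
  (* observations Y_1, Y_2, ... (Yobs t = Y_{t+1}) with law P^{theta*} *)
  (dO : measure_display) (Om : measurableType dO) (P : probability Om R)
  (Yobs : nat -> Om -> d.-tuple R)
  (HYm : forall t, measurable_fun setT (Yobs t))
  (HYlaw : forall (n : nat) (B : 'I_n.+1 -> set (d.-tuple R)),
      (forall t, measurable (B t)) ->
      P [set w | forall t : 'I_n.+1, B t (Yobs t w)] =
      iint lam (fun y : n.+1.-tuple (d.-tuple R) =>
        ((\prod_(t < n.+1) (\1_(B t) (tnth y t) : R)) *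
         hmm_dens Qs (stat_dist Qs) fs y)%:E))
  (* q, l *)
  (q : R) (l : nat) (hq : 0 < q) (hl : (3 <= l)%N)
  (Hsupp : piQ [set s | ~ trans_lb q (Qof s)] = 0%E)
  (Hmu_lb : forall i, q <= mu 0 i) :
  (A1 lam piQ piF Qof fof q Qs fs ->
   forall U : set (l.-tuple (d.-tuple R) -> R),
     weak_nbhd lam (hmm_dens Qs (stat_dist Qs) fs (n:=l)) U ->
     {ae P, forall w, (posterior piQ piF Qof fof mu
          [set th | U (hmm_dens (Qof th.1) (stat_dist (Qof th.1)) (fof th.2) (n:=l))]
          [tuple Yobs i w | i < n]) @[n --> \oo] --> (1 : R)}) /\
  (A1 lam piQ piF Qof fof q Qs fs -> A2 lam piF fof q l ->
   forall e : R, 0 < e ->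
     {ae P, forall w, (posterior piQ piF Qof fof mu
          [set th | (L1dist lam
                       (hmm_dens (Qof th.1) (stat_dist (Qof th.1)) (fof th.2) (n:=l))
                       (hmm_dens Qs (stat_dist Qs) fs (n:=l)) < e%:E)%E]
          [tuple Yobs i w | i < n]) @[n --> \oo] --> (1 : R)}).
Proof.
split=> [hA1 U HU|hA1 hA2 e e0].
- exact: (weak_consistency hk hlam HQof HQm Hfof Hfm Hmu HQs Hfs HYm HYlaw hq hl
    Hsupp Hmu_lb hA1 HU).
- exact: (L1_consistency hk hlam HQof HQm Hfof Hfm Hmu HQs Hfs HYm HYlaw hq hl
    Hsupp Hmu_lb hA1 hA2 e0).
Qed.
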